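(* Let $p(\varrho)=\varrho^2$. There exist constants $\varrho_-,\varrho_+\in\mathbb{R}^+$ and $v_-,v_+\in\mathbb{R}^2$ such that, for the Riemann initial data $$(\varrho_0,v_0)(x)=\begin{cases}(\varrho_-,v_-) & \text{if } x_2<0,\\ (\varrho_+,v_+) & \text{if } x_2>0,\end{cases}\qquad x=(x_1,x_2)\in\mathbb{R}^2,$$ there are infinitely many energy conserving weak solutions $(\varrho,v)$ on $[0,\infty)\times\mathbb{R}^2$ to the two-dimensional isentropic compressible Euler equations $$\partial_t\varrho+\operatorname{div}_x(\varrho v)=0,\qquad \partial_t(\varrho v)+\operatorname{div}_x(\varrho v\otimes v)+\nabla_x p(\varrho)=0,\qquad \varrho(0,x)=\varrho_0(x),\quad v(0,x)=v_0(x).$$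
   Context: Here $\mathbb{R}^+=(0,\infty)$; the unknowns are the density $\varrho=\varrho(t,x)\in\mathbb{R}^+$ and the velocity $v=v(t,x)\in\mathbb{R}^2$ for $t\in[0,\infty)$, $x\in\mathbb{R}^2$. The pressure potential associated with $p(\varrho)=\varrho^2$ is $P(\varrho)=\varrho^2$. Weak solution: a pair $(\varrho,v)\in L^\infty_{loc}([0,\infty)\times\mathbb{R}^2;\mathbb{R}^+\times\mathbb{R}^2)$ such that for all $\psi\in C_c^\infty([0,\infty)\times\mathbb{R}^2,\mathbb{R})$ and all $\phi\in C_c^\infty([0,\infty)\times\mathbb{R}^2,\mathbb{R}^2)$, $$\int_0^\infty\int_{\mathbb{R}^2}\big(\varrho\,\partial_t\psi+\varrho v\cdot\nabla_x\psi\big)\,dx\,dt+\int_{\mathbb{R}^2}\varrho_0(x)\,\psi(0,x)\,dx=0,$$ $$\int_0^\infty\int_{\mathbb{R}^2}\big(\varrho v\cdot\partial_t\phi+\varrho\,(v\otimes v):D_x\phi+p(\varrho)\operatorname{div}_x\phi\big)\,dx\,dt+\int_{\mathbb{R}^2}\varrho_0(x)v_0(x)\cdot\phi(0,x)\,dx=0.$$ Energy conserving weak solution: a weak solution for which the energy equality $$\partial_t\Big(\tfrac12\varrho|v|^2+P(\varrho)\Big)+\operatorname{div}_x\Big[\Big(\tfrac12\varrho|v|^2+P(\varrho)+p(\varrho)\Big)v\Big]=0$$ holds in the weak sense, i.e. for all $\varphi\in C_c^\infty([0,\infty)\times\mathbb{R}^2,\mathbb{R})$, $$\int_0^\infty\int_{\mathbb{R}^2}\Big[\Big(\tfrac12\varrho|v|^2+P(\varrho)\Big)\partial_t\varphi+\Big(\tfrac12\varrho|v|^2+P(\varrho)+p(\varrho)\Big)v\cdot\nabla_x\varphi\Big]dx\,dt+\int_{\mathbb{R}^2}\Big(\tfrac12\varrho_0|v_0|^2+P(\varrho_0)\Big)\varphi(0,x)\,dx=0.$$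 Solutions are identified if they agree almost everywhere on $(0,\infty)\times\mathbb{R}^2$. *)

(* Defs.v *)
From HB Require Import structures.
From mathcomp Require Import all_boot all_order all_algebra.
From mathcomp Require Import all_classical all_reals all_analysis.

Set Implicit Arguments.
Unset Strict Implicit.
Unset Printing Implicit Defensive.

Import Order.TTheory GRing.Theory Num.Theory.
Import numFieldNormedType.Exports.

Local Open Scope classical_set_scope.
Local Open Scope ring_scope.

(* The library's sigma-finiteness of m1 \x m2 is not available by canonical
   structure inference, which only finds it for subprobability factors. *)
Lemma product_sigma_finite d1 d2 (T1 : measurableType d1)
    (T2 : measurableType d2) (R : realType)
    (m1 : {sigma_finite_measure set T1 -> \bar R})
    (m2 : {sigma_finite_measure set T2 -> \bar R}) :
  sigma_finite [set: T1 * T2] (m1 \x m2)%E.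
Proof.
have /sigma_finiteP[F [TF ndF Foo]] := sigma_finiteT m1.
have /sigma_finiteP[G [TG ndG Goo]] := sigma_finiteT m2.
exists (fun n => F n `*` G n).
  rewrite -setXTT TF TG predeqE => -[x y]; split.
    move=> [/= [n _ Fnx] [k _ Gky]]; exists (maxn n k) => //; split.
    - by move: x Fnx; exact/subsetPset/ndF/leq_maxl.
    - by move: y Gky; exact/subsetPset/ndG/leq_maxr.
  by move=> [n _ []/= ? ?]; split; exists n.
move=> k; have [? ?] := Foo k; have [? ?] := Goo k.
split; first exact: measurableX.
by rewrite product_measure1E// lte_mul_pinfty// ge0_fin_numE.
Qed.

Section smooth.
Context {R : realType} {V W : normedModType R}.

Fixpoint Ck (k : nat) (f : V -> W) : Prop :=
  if k is k'.+1 then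
    (forall z, differentiable f z) /\ (forall h, Ck k' ('D_h f))
  else continuous f.

Definition smooth (f : V -> W) : Prop := forall k, Ck k f.

(* The elements of C_c^oo([0,oo) x R^2) are the restrictions to t >= 0 of
   smooth compactly supported functions on the whole space R x R^2, so
   they need not vanish at t = 0. *)
Definition test_function (f : V -> W) : Prop :=
  smooth f /\ compact (closure [set z | f z != 0]).

End smooth.

Section euler.
Context {R : realType}.

(* Points of space-time are z = (t, (x_1, x_2)); the values of a state are
   (rho, (v_1, v_2)). *)
Local Notation plane := (R * R)%type.
Local Notation spacetime := (R * (R * R))%type.
Local Notation state := (R * (R * R))%type.

Definition dot (a b : plane) : R := a.1 * b.1 + a.2 * b.2.

Definition lebesgue2 : set (measurableTypeR R * measurableTypeR R) -> \bar R :=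
  (lebesgue_measure \x lebesgue_measure)%E.

HB.instance Definition _ := Measure.on lebesgue2.

Lemma lebesgue2_sigma_finite : sigma_finite [set: _] lebesgue2.
Proof. exact: product_sigma_finite. Qed.

HB.instance Definition _ := Measure_isSigmaFinite.Build _ _ _ lebesgue2
  lebesgue2_sigma_finite.

Definition lebesgue3 :
    set (measurableTypeR R * (measurableTypeR R * measurableTypeR R)) -> \bar R :=
  (lebesgue_measure \x lebesgue2)%E.

HB.instance Definition _ := Measure.on lebesgue3.

Lemma lebesgue3_sigma_finite : sigma_finite [set: _] lebesgue3.
Proof. exact: product_sigma_finite. Qed.

HB.instance Definition _ := Measure_isSigmaFinite.Build _ _ _ lebesgue3
  lebesgue3_sigma_finite.

Definition halfspace : set spacetime := [set z | 0 <= z.1].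

Definition open_halfspace : set spacetime := [set z | 0 < z.1].

Definition dt {W : normedModType R} (f : spacetime -> W) : spacetime -> W :=
  'D_((1, (0, 0)) : spacetime) f.
Definition dx1 {W : normedModType R} (f : spacetime -> W) : spacetime -> W :=
  'D_((0, (1, 0)) : spacetime) f.
Definition dx2 {W : normedModType R} (f : spacetime -> W) : spacetime -> W :=
  'D_((0, (0, 1)) : spacetime) f.

Definition grad (f : spacetime -> R) (z : spacetime) : plane :=
  (dx1 f z, dx2 f z).

Definition div (f : spacetime -> plane) (z : spacetime) : R :=
  (dx1 f z).1 + (dx2 f z).2.

(* (a (x) a) : D_x f, the sum over i, j of a_i a_j d_(x_j) f_i *)
Definition tensor_contract (a : plane) (f : spacetime -> plane)
    (z : spacetime) : R :=
  a.1 * (a.1 * (dx1 f z).1 + a.2 * (dx2 f z).1)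
  + a.2 * (a.1 * (dx1 f z).2 + a.2 * (dx2 f z).2).

Definition pressure (r : R) : R := r ^+ 2.

(* P with P'(r) r - P(r) = p(r), for p(r) = r^2 *)
Definition pressure_potential (r : R) : R := r ^+ 2.

Definition energy (s : state) : R :=
  2^-1 * s.1 * dot s.2 s.2 + pressure_potential s.1.

(* Membership in L^oo_loc([0,oo) x R^2; R^+ x R^2). Every Lebesgue-measurable
   class has a Borel representative, and ae_class identifies states a.e.;
   the norm here is the max norm, equivalent to the Euclidean one. *)
Definition Linfty_loc (U : spacetime -> state) : Prop :=
  [/\ measurable_fun halfspace U,
      {ae lebesgue3, forall z, halfspace z -> 0 < (U z).1} &
      forall K : set spacetime, compact K -> K `<=` halfspace ->
        exists M : R, {ae lebesgue3, forall z, K z -> `|U z| <= M}].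

Section equations.
Variables (U0 : plane -> state) (U : spacetime -> state).

Local Notation rho0 x := (U0 x).1.
Local Notation v0 x := (U0 x).2.
Local Notation rho z := (U z).1.
Local Notation v z := (U z).2.

Definition weak_mass : Prop :=
  forall psi : spacetime -> R, test_function psi ->
    \int[lebesgue3]_(z in halfspace)
      (rho z * dt psi z + rho z * dot (v z) (grad psi z))
    + \int[lebesgue2]_(x in setT) (rho0 x * psi (0, x)) = 0.

Definition weak_momentum : Prop :=
  forall phi : spacetime -> plane, test_function phi ->
    \int[lebesgue3]_(z in halfspace)
      (rho z * dot (v z) (dt phi z) + rho z * tensor_contract (v z) phi z
       + pressure (rho z) * div phi z)
    + \int[lebesgue2]_(x in setT) (rho0 x * dot (v0 x) (phi (0, x))) = 0.

Definition weak_energy : Prop :=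
  forall varphi : spacetime -> R, test_function varphi ->
    \int[lebesgue3]_(z in halfspace)
      (energy (U z) * dt varphi z
       + (energy (U z) + pressure (rho z)) * dot (v z) (grad varphi z))
    + \int[lebesgue2]_(x in setT) (energy (U0 x) * varphi (0, x)) = 0.

Definition weak_solution : Prop :=
  [/\ Linfty_loc U, weak_mass & weak_momentum].

Definition energy_conserving_weak_solution : Prop :=
  weak_solution /\ weak_energy.

End equations.

(* The value on the null set x_2 = 0 is immaterial. *)
Definition riemann_data (minus plus : state) (x : plane) : state :=
  if x.2 < 0 then minus else plus.

Definition ae_class (U : spacetime -> state) : set (spacetime -> state) :=
  [set W | ae_eq lebesgue3 open_halfspace U W].

End euler.

(* Main.v *)
(* The data are rho = 1/2, v = (0, 1) for x2 < 0 and rho = 1/2, v = (0, -1) for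
   x2 > 0. These states persist outside the cone |x2| <= t; inside it rho = 1
   and v is any bounded field with |v|^2 = 1/2, div v = 0 and
   d_t v + div (v (x) v - 1/4 I) = 0 whose extension by zero solves the same
   linear system on all of space-time. Since rho and |v|^2 are constant in the
   cone, mass, momentum and energy there all reduce to this linear system, and
   the constants are chosen so that the remaining piecewise constant parts
   satisfy the Rankine-Hugoniot conditions on x2 = t and x2 = -t, including the
   one for the energy.
   Infinitely many v come from convex integration. The cone is tiled by unit
   cells in the null coordinates t - x2, t + x2 and x1, and the problem is
   solved on every cell separately. Starting from a subsolution, i.e. (v, u)
   with u traceless, d_t v + div u = 0 and l/2 I - v (x) v + u >= 0, one adds on
   a fine grid localized plane waves that keep this inequality and raise the
   kinetic energy by an amount quadratic in the deficit, while moving finitely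
   many prescribed linear functionals of v arbitrarily little. Iterating drives
   the deficit to zero geometrically, the velocities converge almost everywhere,
   and the limit attains |v|^2 = 1/2. A functional that tells two subsolutions
   of a cell apart still separates the two limits, and using the second limit in
   one cell only, for infinitely many choices of that cell, gives infinitely
   many solutions. *)
Require Import Defs.
From HB Require Import structures.
From mathcomp Require Import all_boot all_order all_algebra.
From mathcomp Require Import all_classical all_reals all_analysis.
From mathcomp Require Import measurable_realfun.
From mathcomp Require Import ring lra.

Set Implicit Arguments.
Unset Strict Implicit.
Unset Printing Implicit Defensive.

Import Order.TTheory GRing.Theory Num.Theory.
Import numFieldNormedType.Exports.

Local Open Scope classical_set_scope.
Local Open Scope ring_scope.

(** * Integration over space-time *)

Section integration.
Context {R : realType}.
Local Notation ST := (R * (R * R))%type.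
Local Notation mu := (@lebesgue_measure R).

(** Averaged over a cell, the cone carries density 1, velocity 0, stress 5/4 I (pressure 1 plus
    |v|^2/2 = 1/4) and energy |v|^2/2 + 1 = 5/4. Its energy flux (5/4 + 1) v is a multiple of the
    mass flux, so it averages to zero as well. The jump conditions on x2 = t then read 1/2 - 1 =
    -1/2 for mass, -1/2 = 3/4 - 5/4 for momentum and 1/2 - 5/4 = -3/4 for energy. Two obstacles
    shape the construction. Weak limits do not preserve |v|^2 = 1/2: one of the controlled
    functionals is therefore the pairing with the previous velocity, which makes the increments
    nearly orthogonal, and the bounded energy then forces strong convergence. Cells can be treated
    separately only if nothing crosses their faces: the waves are third derivatives of potentials
    that vanish to high order there, so their extensions by zero are exact solutions. Cutting off
    the waves and freezing coefficients violates the inequality for (v, u) slightly; this is paid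
    for by raising l, which never exceeds 1/2. *)

Lemma open_measurable3 (O : set ST) : open O -> measurable O.
Proof.
move=> oO.
(* Boxes with rational corners form a countable base; an index holds the six endpoints. *)
pose I := (rat * rat * (rat * rat) * (rat * rat))%type.
pose bx (i : I) : set ST := `]ratr i.1.1.1, ratr i.1.1.2[%classic `*`
   (`]ratr i.1.2.1, ratr i.1.2.2[%classic `*` `]ratr i.2.1, ratr i.2.2[%classic).
pose F (i : I) : set ST := if `[< bx i `<=` O >] then bx i else set0.
have -> : O = \bigcup_i F i.
  apply/seteqP; split => [y Oy|y [i _]]; last first.
    by rewrite /F; case: asboolP => // h; exact: h.
  have /nbhs_ballP[e /= e0 he] := open_nbhs_nbhs (conj oO Oy).
  have ex (x : R) : exists ab : rat * rat, [/\ x - e < ratr ab.1, ratr ab.1 < x,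
      x < ratr ab.2 & ratr ab.2 < x + e].
    have [a] := @rat_in_itvoo R (x - e) x ltac:(lra).
    have [b] := @rat_in_itvoo R x (x + e) ltac:(lra).
    rewrite !in_itv/= => /andP[? ?] /andP[? ?].
    by exists (a, b).
  have [a [a1 a2 a3 a4]] := ex y.1.
  have [b [b1 b2 b3 b4]] := ex y.2.1.
  have [c [c1 c2 c3 c4]] := ex y.2.2.
  have hy : bx (a, b, c) y by rewrite /bx /=; do !split; rewrite /= in_itv /=; apply/andP.
  exists (a, b, c) => //; rewrite /F asboolT// => z.
  rewrite /bx /= => -[/=]; rewrite in_itv/= => /andP[z1 z2] [/=]; rewrite !in_itv/= => /andP[z3 z4] /andP[z5 z6].
  have near (x r lo hi : R) : lo < r -> r < hi -> x - e < lo -> hi < x + e -> ball x e r.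
    by move=> *; rewrite -ball_normE /ball_ /= ltr_norml; apply/andP; split; lra.
  by apply: he; split; [exact: near z1 z2 a1 a4|split; [exact: near z3 z4 b1 b4|exact: near z5 z6 c1 c4]].
apply: countable_bigcupT_measurable => [|i]; first exact: countableP.
rewrite /F; case: ifP => // _; rewrite /bx.
by apply: measurableX => //; apply: measurableX.
Qed.

Lemma continuous_measurable3 (f : ST -> R) : continuous f -> measurable_fun setT f.
Proof.
move=> cf mD; apply: (measurability _ (measurable_realfun.RGenOInfty.measurableE R)) => //.
move=> _ [_ [a ->] <-]; rewrite setTI; apply: open_measurable3.
by apply: open_comp => //; exact: rray_open.
Qed.

Definition box (M : R) : set ST := `[- M, M] `*` (`[- M, M] `*` `[- M, M]).

Lemma boxP M (z : ST) : box M z <-> [/\ `|z.1| <= M, `|z.2.1| <= M & `|z.2.2| <= M].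
Proof.
by rewrite /box /= !in_itv /= -!ler_norml; split => [[? []]|[]].
Qed.

Lemma box_compact M : compact (box M).
Proof. by apply: compact_setX; [|apply: compact_setX]; exact: segment_compact. Qed.

Lemma box_measurable M : measurable (box M : set ST).
Proof. by apply: measurableX => //; apply: measurableX. Qed.

Lemma lebesgue3_setX (A B C : set R) : measurable A -> measurable B -> measurable C ->
  lebesgue3 (A `*` (B `*` C)) = (mu A * (mu B * mu C))%E.
Proof.
move=> mA mB mC; rewrite -(product_measure1E mu mu mB mC).
exact: (product_measure1E mu lebesgue2 mA (measurableX mB mC)).
Qed.

Lemma lebesgue3_box M : 0 <= M -> lebesgue3 (box M) = ((M *+ 2) ^+ 3)%:E.
Proof.
move=> M0; rewrite lebesgue3_setX// lebesgue_measure_itv/= lte_fin.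
case: ifPn => [_|]; first by rewrite -EFinB -!EFinM; congr EFin; ring.
rewrite -leNgt => h; have -> : M = 0 by lra.
by rewrite !mul0e mul0rn expr0n.
Qed.

Lemma box_lty M : (lebesgue3 (box M) < +oo)%E.
Proof.
have [M0|M0] := leP 0 M; first by rewrite lebesgue3_box ?ltry.
rewrite lebesgue3_setX// lebesgue_measure_itv/= lte_fin ifF ?mul0e//.
by apply/negbTE; rewrite -leNgt; lra.
Qed.

Lemma continuous_bounded_box (f : ST -> R) M : continuous f ->
  exists B, forall z, box M z -> `|f z| <= B.
Proof.
move=> cf; have : compact (f @` box M).
  apply: continuous_compact; last exact: box_compact.
  exact: continuous_subspaceT.
move=> /compact_bounded[B [_ hB]]; exists (B + 1) => z bz.
by apply: (hB (B + 1)); [lra|exists z].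
Qed.

Definition box_supported M (f : ST -> R) := forall z, ~ box M z -> f z = 0.

Lemma box_supported_restrict M f : box_supported M f -> f \_ (box M) = f.
Proof.
move=> h; apply/funext => z; rewrite patchE; case: ifPn => // /negP zB.
by rewrite h// => /mem_set.
Qed.

Lemma integrable_box (f : ST -> R) M B : measurable_fun setT f ->
  box_supported M f -> (forall z, box M z -> `|f z| <= B) ->
  lebesgue3.-integrable setT (EFin \o f).
Proof.
move=> mf sf bf.
rewrite -(box_supported_restrict sf) -restrict_EFin.
apply/integrable_restrict => //; first exact: box_measurable.
rewrite setTI; apply: measurable_bounded_integrable; first exact: box_measurable.
- exact: box_lty.
- exact: measurable_funS mf.
- exists B; split; first exact: num_real.
  by move=> x Bx z /= /bf /le_trans; apply; exact: ltW.
Qed.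

Lemma integrable_continuous_box (f : ST -> R) M : continuous f -> box_supported M f ->
  lebesgue3.-integrable setT (EFin \o f).
Proof.
move=> cf sf; have [B hB] := continuous_bounded_box M cf.
by apply: integrable_box hB => //; exact: continuous_measurable3.
Qed.

Lemma integral_deriv0 (H G : R -> R) M : (forall x : R, is_derive x 1 H (G x)) ->
  continuous G -> (forall x, M < `|x| -> H x = 0 /\ G x = 0) ->
  (\int[mu]_x (G x)%:E)%E = 0%E.
Proof.
move=> dH cG z0.
(* [M] may be negative; [N] is positive and lies beyond the support, so both boundary terms
   vanish. *)
pose N := `|M| + 1; have N0 : 0 < N by rewrite /N ltr_pwDr.
have MN : M < N by rewrite /N; have := ler_norm M; lra.
have -> : (fun x => (G x)%:E) = (fun x => (G x)%:E) \_ `[- N, N].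
  apply/funext => x; rewrite patchE; case: ifPn => // /negP h.
  have /z0[_ ->//] : M < `|x|.
  apply: (lt_trans MN); rewrite ltNge; apply/negP => xN; apply: h.
  by rewrite inE /= in_itv /= -ler_norml.
have cH : continuous H.
  by move=> x; apply: differentiable_continuous; apply/derivable1_diffP; have [] := dH x.
rewrite -integral_mkcond (@continuous_FTC2 _ G H)//; last 4 first.
- by rewrite gtrN.
- exact: continuous_subspaceT.
- split; first by move=> x _; have [] := dH x.
  + exact: cvg_at_right_filter (cH _).
  + exact: cvg_at_left_filter (cH _).
- by move=> x _; rewrite derive1E; have [] := dH x.
have [-> _] : H N = 0 /\ G N = 0 by apply: z0; rewrite gtr0_norm.
have [-> _] : H (- N) = 0 /\ G (- N) = 0 by apply: z0; rewrite normrN gtr0_norm.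
by rewrite subee.
Qed.

Lemma iterated_integral0 (K : ST -> R) : lebesgue3.-integrable setT (EFin \o K) ->
  (forall t, (\int[lebesgue2]_x (K (t, x))%:E)%E = 0%E) ->
  \int[lebesgue3]_z K z = 0.
Proof.
move=> iK h; rewrite /Rintegral -(integral12_prod_meas1 iK)/=.
by under eq_integral do rewrite /fubini_F /= h; rewrite integral0.
Qed.

Lemma continuous_pair (X Y Z : topologicalType) (f : X -> Y) (g : X -> Z) :
  continuous f -> continuous g -> continuous (fun x => (f x, g x)).
Proof.
move=> cf cg x; apply: (@cvg_pair _ _ _ _ (nbhs (f x)) (nbhs (g x))).
  exact: cf.
exact: cg.
Qed.

Lemma continuous_slice (X Y Z : topologicalType) (f : X -> Y) (g : Y -> Z) :
  continuous g -> continuous f -> continuous (fun x => g (f x)).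
Proof. by move=> cg cf x; apply: continuous_comp; [exact: cf|exact: cg]. Qed.

End integration.

(** * Plane waves with compact support *)

Section expressions.
Context {R : realType}.
Local Notation ST := (R * (R * R))%type.

Variant axis := At | A1 | A2.

Definition axis_eq (i j : axis) : R :=
  match i, j with At, At => 1 | A1, A1 => 1 | A2, A2 => 1 | _, _ => 0 end.

Definition crd (i : axis) (y : ST) : R :=
  match i with At => y.1 | A1 => y.2.1 | A2 => y.2.2 end.

Definition upd (i : axis) (y : ST) (s : R) : ST :=
  match i with At => (s, y.2) | A1 => (y.1, (s, y.2.2)) | A2 => (y.1, (y.2.1, s)) end.

Lemma upd_crd i y : upd i y (crd i y) = y.
Proof. by case: y => t [a b]; case: i. Qed.

(** Stated on one-variable slices, so that one-variable calculus applies directly and Fubini can use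
    it line by line. *)
Definition pderive (i : axis) (f g : ST -> R) :=
  forall y, is_derive (crd i y) 1 (fun s => f (upd i y s)) (g y).

Lemma pderiveD i f f' g g' : pderive i f f' -> pderive i g g' ->
  pderive i (fun y => f y + g y) (fun y => f' y + g' y).
Proof. by move=> df dg y; apply: is_deriveD; [exact: df|exact: dg]. Qed.

Lemma pderiveM i f f' g g' : pderive i f f' -> pderive i g g' ->
  pderive i (fun y => f y * g y) (fun y => f' y * g y + f y * g' y).
Proof.
move=> df dg y; have := is_deriveM (df y) (dg y); rewrite !upd_crd => h.
by apply: is_derive_eq h _; rewrite /GRing.scale/= addrC [g y * _]mulrC.
Qed.

Lemma pderive_comp i (h : R -> R) dh f f' : (forall x : R, is_derive x 1 h (dh x)) ->
  pderive i f f' -> pderive i (fun y => h (f y)) (fun y => dh (f y) * f' y).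
Proof.
move=> hh df y; apply: (@is_derive1_comp _ h (fun s => f (upd i y s))); last exact: df.
by rewrite upd_crd.
Qed.

Lemma pderive_unique i f f' f'' : pderive i f f' -> pderive i f f'' -> f' =1 f''.
Proof. by move=> h1 h2 y; have [_ <-] := h1 y; have [_ <-] := h2 y. Qed.

(** A quadratic remainder bound treats the kink of [pospow 2] at zero and the smooth points
    alike. *)
Lemma is_derive_quadratic (f : R -> R) (s d : R) :
  (forall h, `|f (s + h) - f s - d * h| <= h ^+ 2) -> is_derive s 1 f d.
Proof.
move=> H.
have cv : h^-1 *: (f (h *: 1 + s) - f s) @[h --> 0^'] --> d.
  apply/cvgrPdist_le => e e0; near=> h.
  have h0 : h != 0 by near: h; exact: nbhs_dnbhs_neq.
  have he : `|h| <= e.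
    near: h; apply: dnbhs0_le; exact: e0.
  apply: le_trans he.
  have -> : d - h^-1 *: (f (h *: 1 + s) - f s) = - (h^-1 * (f (s + h) - f s - d * h)).
    rewrite /GRing.scale/= mulr1 [h + s]addrC; by field.
  rewrite normrN normrM normfV ler_pdivrMl ?normr_gt0//.
  by apply: le_trans (H h) _; rewrite -normrM -expr2 ler_norm.
split; last exact: cvg_lim.
by apply/cvg_ex; exists d.
Unshelve. all: by end_near. Qed.

(** Truncated powers yield cutoffs of any prescribed finite smoothness whose derivatives stay in the
    same family, which is what a formal calculus of derivatives requires. *)
Definition pospow (n : nat) (s : R) : R := Num.max 0 s ^+ n.

Lemma is_derive_pospow2 (s : R) : is_derive s 1 (pospow 2) (2 * pospow 1 s).
Proof.
apply: is_derive_quadratic => h; rewrite /pospow expr1.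
case: (leP 0 (s + h)) => h1; case: (leP 0 s) => h2; rewrite ler_norml; apply/andP; nra.
Qed.

Lemma is_derive_pospow n (s : R) :
  is_derive s 1 (pospow n.+2) (n.+2%:R * pospow n.+1 s).
Proof.
(* Splitting off a polynomial factor leaves [pospow 2] as the only truncated power to differentiate
   by hand. *)
have -> : pospow n.+2 = (fun s => s ^+ n * pospow 2 s).
  apply/funext => x; rewrite /pospow; case: leP => x0.
    by rewrite -exprD addn2.
  by rewrite !expr0n/= mulr0.
have hX : is_derive s 1 (fun x : R => x ^+ n) (n%:R * s ^+ n.-1).
  by split; [exact: exprn_derivable|rewrite -derive1E exp_derive1].
have h := is_deriveM hX (is_derive_pospow2 s).
apply: is_derive_eq h _; rewrite /GRing.scale /= /pospow.
case: leP => x0; last by rewrite !expr0n/= !mulr0 mul0r addr0.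
case: n {hX} => [|n]; first by rewrite !expr0 !expr1; ring.
by rewrite -!natr1 /= !exprS; ring.
Qed.

Lemma continuous_pospow n : continuous (pospow n).
Proof.
move=> s; rewrite /pospow; apply: (@continuous_comp _ _ _ (fun s : R => Num.max 0 s) (fun x => x ^+ n)).
  rewrite (_ : (fun s : R => _) = (fun s : R => (s + `|s|) / 2)); last first.
    by apply/funext => x; case: (leP 0 x) => x0; [rewrite ger0_norm//|rewrite ltr0_norm//]; field.
  apply: cvgMl; apply: cvgD; first exact: cvg_id.
  exact: norm_continuous.
exact: exprn_continuous.
Qed.

(* A syntax closed under differentiation: the high derivatives of the wave
   potentials are computed by D. Pp n e stands for max(0, e)^n, and ok k e makes
   e k times differentiable. *)
Inductive sexp :=
  | Cst of R | Var of axis | Add of sexp & sexp | Mul of sexp & sexp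
  | Sin of sexp | Cos of sexp | Pp of nat & sexp.

Fixpoint ev (e : sexp) (y : ST) : R :=
  match e with
  | Cst r => r
  | Var i => crd i y
  | Add a b => ev a y + ev b y
  | Mul a b => ev a y * ev b y
  | Sin a => sin (ev a y)
  | Cos a => cos (ev a y)
  | Pp n a => pospow n (ev a y)
  end.

(** [pospow 0] is the constant 1 even for negative arguments, so on [Pp 1] the formal derivative
    misses the truncation. The condition [ok 1] demands exponents of at least 2. *)
Fixpoint D (i : axis) (e : sexp) : sexp :=
  match e with
  | Cst r => Cst 0
  | Var j => Cst (axis_eq i j)
  | Add a b => Add (D i a) (D i b)
  | Mul a b => Add (Mul (D i a) b) (Mul a (D i b))
  | Sin a => Mul (Cos a) (D i a)
  | Cos a => Mul (Mul (Cst (-1)) (Sin a)) (D i a)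
  | Pp n a => Mul (Mul (Cst n%:R) (Pp n.-1 a)) (D i a)
  end.

Fixpoint ok (k : nat) (e : sexp) : bool :=
  match e with
  | Cst _ | Var _ => true
  | Add a b | Mul a b => ok k a && ok k b
  | Sin a | Cos a => ok k a
  | Pp n a => (k < n)%N && ok k a
  end.

Lemma ok_le k l e : (k <= l)%N -> ok l e -> ok k e.
Proof.
move=> kl; elim: e => //= [a IHa b IHb|a IHa b IHb|n a IHa] /andP[].
- by move=> /IHa -> /IHb.
- by move=> /IHa -> /IHb.
- by move=> /(leq_ltn_trans kl) -> /IHa.
Qed.

Lemma ok_D k i e : ok k.+1 e -> ok k (D i e).
Proof.
have S a : ok k.+1 a -> ok k a by exact: ok_le.
elim: e => //= [a IHa b IHb|a IHa b IHb|a IHa|a IHa|n a IHa].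
- by move=> /andP[/IHa -> /IHb].
- by move=> /andP[ha hb]; rewrite IHa// IHb// !S.
- by move=> h; rewrite IHa// S.
- by move=> h; rewrite IHa// S.
- by case: n => // n /andP[n1 h]; rewrite /= IHa// S// !andbT -ltnS.
Qed.

Lemma pderive_ev i e : ok 1 e -> pderive i (ev e) (ev (D i e)).
Proof.
elim: e => /= [r|j|a IHa b IHb|a IHa b IHb|a IHa|a IHa|n a IHa].
- by move=> _ y; exact: is_derive_cst.
- move=> _ y; case: i; case: j => /=; (exact: is_derive_cst || exact: is_derive_id).
- by move=> /andP[/IHa ha /IHb hb]; exact: pderiveD.
- by move=> /andP[/IHa ha /IHb hb]; exact: pderiveM.
- by move=> /IHa; apply: pderive_comp => x; exact: is_derive_sin.
- move=> /IHa h; apply: (pderive_comp (dh := fun x => -1 * sin x) _ h) => x.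
  by rewrite mulN1r; exact: is_derive_cos.
- case: n => [|[|n]] //= /IHa h.
  apply: (pderive_comp (dh := fun x => n.+2%:R * pospow n.+1 x) _ h) => x.
  exact: is_derive_pospow.
Qed.

Lemma continuous_crd i : continuous (crd i).
Proof.
have h1 : continuous (fun y : ST => y.1) by move=> y; exact: cvg_fst.
have h2 : continuous (fun y : ST => y.2) by move=> y; exact: cvg_snd.
case: i => //= y.
- by apply: (@continuous_comp _ _ _ (fun y : ST => y.2) fst); [exact: h2|exact: cvg_fst].
- by apply: (@continuous_comp _ _ _ (fun y : ST => y.2) snd); [exact: h2|exact: cvg_snd].
Qed.

Lemma continuous_ev e : continuous (ev e).
Proof.
elim: e => /= [r|j|a IHa b IHb|a IHa b IHb|a IHa|a IHa|n a IHa].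
- by move=> y; exact: cvg_cst.
- exact: continuous_crd.
- by move=> y; apply: cvgD; [exact: IHa|exact: IHb].
- by move=> y; apply: cvgM; [exact: IHa|exact: IHb].
- by move=> y; apply: (@continuous_comp _ _ _ (ev a) sin); [exact: IHa|exact: continuous_sin].
- by move=> y; apply: (@continuous_comp _ _ _ (ev a) cos); [exact: IHa|exact: continuous_cos].
- by move=> y; apply: (@continuous_comp _ _ _ (ev a) (pospow n)); [exact: IHa|exact: continuous_pospow].
Qed.

(** Schwarz's theorem for formal derivatives: an induction on the syntax in which every case is a
    ring identity. *)
Lemma ev_DD i j e : ev (D i (D j e)) =1 ev (D j (D i e)).
Proof.
elim: e => /= [r|k|a IHa b IHb|a IHa b IHb|a IHa|a IHa|n a IHa] y //=;
  rewrite ?IHa ?IHb; by [|ring].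
Qed.

(** Formal derivatives are genuine ones, hence depend on values only. This permits commuting
    derivatives underneath an outer [D]. *)
Lemma ev_D_eq i a b : ok 1 a -> ok 1 b -> ev a =1 ev b -> ev (D i a) =1 ev (D i b).
Proof.
move=> oa ob ab; have := pderive_ev i oa.
have -> : ev a = ev b by apply/funext.
by move=> /pderive_unique; apply; exact: pderive_ev.
Qed.

(* Every term of e carries a factor Pp n b with n >= k and b <= 0 at y, so the
   derivatives of e of order less than k vanish at y. *)
Fixpoint flat (k : nat) (e : sexp) (y : ST) : Prop :=
  match e with
  | Add a b => flat k a y /\ flat k b y
  | Mul a b => flat k a y \/ flat k b y
  | Pp n a => (k <= n)%N /\ ev a y <= 0
  | _ => False
  end.

Lemma flat_le k l e y : (k <= l)%N -> flat l e y -> flat k e y.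
Proof.
move=> kl; elim: e => //= [a IHa b IHb|a IHa b IHb|n a IHa].
- by move=> [/IHa ? /IHb].
- by move=> [/IHa|/IHb]; [left|right].
- by move=> [/(leq_trans kl)].
Qed.

Lemma flat_D k i e y : flat k.+1 e y -> flat k (D i e) y.
Proof.
have S a : flat k.+1 a y -> flat k a y by exact: flat_le.
elim: e => //= [a IHa b IHb|a IHa b IHb|n a IHa].
- by move=> [/IHa ? /IHb].
- by move=> [h|h]; split; [left; exact: IHa|left; exact: S|right; exact: S|right; exact: IHb].
- by case: n => [[]//|n] [n1 h]; left; right.
Qed.

Lemma flat_ev e y : flat 1 e y -> ev e y = 0.
Proof.
elim: e => //= [a IHa b IHb|a IHa b IHb|n a IHa].
- by move=> [/IHa -> /IHb ->]; rewrite addr0.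
- by move=> [/IHa ->|/IHb ->]; rewrite ?mul0r ?mulr0.
- by case: n => [[]//|n] [_ h]; rewrite /pospow max_l// expr0n.
Qed.

End expressions.

(** * Weak form of the linear system and its exact solutions from potentials *)

Section weak_form.
Context {R : realType}.
Local Notation ST := (R * (R * R))%type.
Local Notation D := (@D R).
Local Notation mu := (@lebesgue_measure R).

Definition C1 (psi : ST -> R) (d : axis -> ST -> R) :=
  [/\ continuous psi, forall i, continuous (d i) & forall i, pderive i psi (d i)].

Definition intg2 (f : R * R -> R) := lebesgue2.-integrable [set: R * R] (EFin \o f).

Lemma slice_integrable (f : ST -> R) M B t : measurable_fun [set: ST] f ->
  box_supported M f -> (forall y, box M y -> `|f y| <= B) -> intg2 (fun x => f (t, x)).
Proof.
move=> mf sf bf; pose sb : set (R * R) := `[- M, M] `*` `[- M, M].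
rewrite /intg2; have -> : (fun x => f (t, x)) = (fun x => f (t, x)) \_ sb.
  apply/funext => x; rewrite patchE; case: ifPn => // /negP xB.
  by apply: sf => -[_ /= h]; apply: xB; rewrite inE.
rewrite -restrict_EFin; apply/integrable_restrict => //; first exact: measurableX.
rewrite setTI; have [tM|tM] := boolP (`|t| <= M); last first.
  have -> : EFin \o (fun x => f (t, x)) = cst 0%E.
    apply/funext => x; congr EFin; apply: sf => -[/= + _].
    by rewrite in_itv/= -ler_norml; exact/negP.
  exact: integrable0.
apply: measurable_bounded_integrable; first exact: measurableX.
- suff : (lebesgue2 sb < +oo)%E by [].
  pose J : set R := `[- M, M]%classic.
  have -> : lebesgue2 sb = (mu J * mu J)%E by exact: (product_measure1E mu mu).
  rewrite lebesgue_measure_itv/=.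
  by case: ifPn => _; rewrite ?mul0e// -EFinB -EFinM ltry.
- exact: measurable_funS (measurable_fun_pair2 t mf).
- exists B; split; first exact: num_real.
  move=> b Bb x /= xs; apply: (le_trans _ (ltW Bb)); apply: bf; split => //=.
  by rewrite in_itv/= -ler_norml.
Qed.

(** On each line in direction [i] the coefficient is constant, so Fubini reduces the claim to the
    fundamental theorem of calculus. It serves for coefficients with jumps: the indicator of the
    half-space and the piecewise constant outer states. *)
Lemma coefficient_space_derivative0 i (c K G : ST -> R) M : i <> At ->
  measurable_fun [set: ST] c -> (forall y, `|c y| <= 1) -> (forall y s, c (upd i y s) = c y) ->
  continuous G -> box_supported M K -> box_supported M G -> pderive i K G ->
  \int[lebesgue3]_y (c y * G y) = 0.
Proof.
move=> iAt mc bc ic cG sK sG dK.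
have [B hB] := continuous_bounded_box M cG.
have mf : measurable_fun [set: ST] (fun y => c y * G y).
  by apply: measurable_funM => //; exact: continuous_measurable3.
have sf : box_supported M (fun y => c y * G y) by move=> y /sG ->; rewrite mulr0.
have bf y : box M y -> `|c y * G y| <= B.
  by move=> /hB h; rewrite normrM -[leRHS]mul1r ler_pM.
have cc (X Y : topologicalType) (a : Y) : continuous (fun _ : X => a).
  by move=> ?; exact: cvg_cst.
have ci (X : topologicalType) : continuous (fun x : X => x) by move=> ?; exact: cvg_id.
apply: iterated_integral0 => [|t]; first exact: integrable_box mf sf bf.
have i2 := slice_integrable t mf sf bf.
have core (H' G' : R -> R) (a : R) : (forall x : R, is_derive x 1 H' (G' x)) -> continuous G' ->
    (forall x, M < `|x| -> H' x = 0 /\ G' x = 0) -> (\int[mu]_x (a * G' x)%:E)%E = 0%E.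
  move=> dH cG' z; apply: (@integral_deriv0 _ (fun x => a * H' x) _ M).
  - by move=> x; apply: cvgM; [exact: cvg_cst|exact: cG'].
  - by move=> x /z[-> ->]; rewrite mulr0.
case: i iAt ic dK => // _ ic dK.
- rewrite -(integral21_prod_meas1 i2)/=.
  rewrite -[RHS](integral0 mu setT); apply: eq_integral => y _; rewrite /fubini_G /=.
  have dKx (x : R) : is_derive x 1 (fun s => K (t, (s, y))) (G (t, (x, y))) := dK (t, (x, y)).
  have cx : continuous (fun x => G (t, (x, y))).
    by apply: continuous_slice => //; do 2 apply: continuous_pair => //.
  have zx x : M < `|x| -> K (t, (x, y)) = 0 /\ G (t, (x, y)) = 0.
    by move=> xM; split; [apply: sK|apply: sG] => /boxP[/= _ h _]; move: xM; rewrite ltNge h.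
  rewrite -(core _ _ (c (t, (0, y))) dKx cx zx).
  by apply: eq_integral => x _; rewrite (ic (t, (0, y)) x).
- rewrite -(integral12_prod_meas1 i2)/=.
  rewrite -[RHS](integral0 mu setT); apply: eq_integral => x _; rewrite /fubini_F /=.
  have dKx (y : R) : is_derive y 1 (fun s => K (t, (x, s))) (G (t, (x, y))) := dK (t, (x, y)).
  have cx : continuous (fun y => G (t, (x, y))).
    by apply: continuous_slice => //; do 2 apply: continuous_pair => //.
  have zx y : M < `|y| -> K (t, (x, y)) = 0 /\ G (t, (x, y)) = 0.
    by move=> yM; split; [apply: sK|apply: sG] => /boxP[/= _ _ h]; move: yM; rewrite ltNge h.
  rewrite -(core _ _ (c (t, (x, 0))) dKx cx zx).
  by apply: eq_integral => y _; rewrite (ic (t, (x, 0)) y).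
Qed.

Lemma integral_pderive0 (H G : ST -> R) M i : continuous G ->
  box_supported M H -> box_supported M G -> pderive i H G ->
  \int[lebesgue3]_z G z = 0.
Proof.
move=> cG sH sG HG.
have space : i <> At -> \int[lebesgue3]_z G z = 0.
  move=> iAt; have := @coefficient_space_derivative0 i (cst 1) H G M iAt _ _ _ cG sH sG HG.
  by under eq_Rintegral do rewrite mul1r; apply => // y; rewrite normr1.
case: i HG space => HG space; [clear space|exact: space|exact: space].
rewrite /Rintegral -(integral21_prod_meas1 (integrable_continuous_box cG sG))/=.
rewrite -[RHS]/(fine 0%E) -(integral0 lebesgue2 setT); congr fine.
apply: eq_integral => x _; rewrite /fubini_G /=.
apply: (@integral_deriv0 _ (fun t => H (t, x)) _ M) => [t||t tM].
- exact: HG (t, x).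
- apply: continuous_slice => //; apply: continuous_pair; first by move=> ?; exact: cvg_id.
  by move=> ?; exact: cvg_cst.
- by split; [apply: sH|apply: sG] => /boxP[/= h _ _]; move: tM; rewrite ltNge h.
Qed.

Lemma continuousM3 (f g : ST -> R) : continuous f -> continuous g ->
  continuous (fun y => f y * g y).
Proof. by move=> cf cg y; apply: cvgM; [exact: cf|exact: cg]. Qed.

Lemma continuousD3 (f g : ST -> R) : continuous f -> continuous g ->
  continuous (fun y => f y + g y).
Proof. by move=> cf cg y; apply: cvgD; [exact: cf|exact: cg]. Qed.

(** The integral of each d_i (F_i psi) vanishes; in their sum the terms with psi itself cancel
    because F is divergence free. *)
Lemma divergence_free_weak M (F G : axis -> ST -> R) psi d :
  (forall i, continuous (F i)) -> (forall i, continuous (G i)) ->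
  (forall i, box_supported M (F i)) -> (forall i, box_supported M (G i)) ->
  (forall i, pderive i (F i) (G i)) ->
  (forall y, G At y + G A1 y + G A2 y = 0) -> C1 psi d ->
  \int[lebesgue3]_y (F At y * d At y + F A1 y * d A1 y + F A2 y * d A2 y) = 0.
Proof.
move=> cF cG sF sG FG div0 [cpsi cd dpsi].
pose K i y := G i y * psi y + F i y * d i y.
have cK i : continuous (K i) by apply: continuousD3; exact: continuousM3.
have sK i : box_supported M (K i) by move=> y h; rewrite /K (sG i)// (sF i)// !mul0r addr0.
have IK i : \int[lebesgue3]_y K i y = 0.
  apply: (@integral_pderive0 (fun y => F i y * psi y) _ M i) => //.
    by move=> y h; rewrite (sF i)// mul0r.
  exact: pderiveM.
have iK i := integrable_continuous_box (cK i) (sK i).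
have -> : \int[lebesgue3]_y (F At y * d At y + F A1 y * d A1 y + F A2 y * d A2 y) =
    \int[lebesgue3]_y (K At y + K A1 y + K A2 y).
  apply: eq_Rintegral => y _; rewrite /K.
  suff -> : G At y = - G A1 y - G A2 y by ring.
  by have := div0 y; lra.
rewrite RintegralD//; last first.
  apply: (@integrable_continuous_box _ _ M); first exact: continuousD3.
  by move=> y h; rewrite (sK At)// (sK A1)// addr0.
by rewrite RintegralD// !IK !addr0.
Qed.

(* The velocity (fv1, fv2) and the traceless symmetric stress [[fa, fb], [fb, -fa]]. *)
Record field := Field { fv1 : ST -> R; fv2 : ST -> R; fa : ST -> R; fb : ST -> R }.

(** The integrals run over all of space-time and [psi] has no support condition, as the fields
    themselves have bounded support. The equations thus hold for the extension by zero, without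
    boundary terms on the faces of a cell, and even psi = t is admissible. *)
Definition weak_euler (z : field) := forall psi d, C1 psi d ->
  [/\ \int[lebesgue3]_y (fv1 z y * d A1 y + fv2 z y * d A2 y) = 0,
      \int[lebesgue3]_y (fv1 z y * d At y + fa z y * d A1 y + fb z y * d A2 y) = 0 &
      \int[lebesgue3]_y (fv2 z y * d At y + fb z y * d A1 y - fa z y * d A2 y) = 0].

(* With potential e: v = (-d_2, d_1) Laplace e, a = 2 d_1 d_2 d_t e and
   b = (d_2^2 - d_1^2) d_t e solve div v = 0, d_t v + div u = 0 identically. *)
Definition laplace (e : @sexp R) := Add (D A1 (D A1 e)) (D A2 (D A2 e)).
Definition eV1 e := Mul (Cst (-1)) (D A2 (laplace e)).
Definition eV2 e := D A1 (laplace e).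
Definition eA e := Mul (Cst 2) (D A1 (D A2 (D At e))).
Definition eB e := Add (D A2 (D A2 (D At e))) (Mul (Cst (-1)) (D A1 (D A1 (D At e)))).

Definition potential_field (e : @sexp R) : field :=
  Field (ev (eV1 e)) (ev (eV2 e)) (ev (eA e)) (ev (eB e)).

Lemma ev_D_swap i j k e : ok 3 e -> ev (D i (D j (D k e))) =1 ev (D i (D k (D j e))).
Proof. by move=> oe; apply: ev_D_eq; [do 2 apply: ok_D|do 2 apply: ok_D|exact: ev_DD]. Qed.

Lemma ev_DD_swap i j k l e : ok 4 e ->
  ev (D i (D j (D k (D l e)))) =1 ev (D i (D j (D l (D k e)))).
Proof. by move=> oe; apply: ev_D_eq; [do 3 apply: ok_D|do 3 apply: ok_D|apply: ev_D_swap; exact: ok_le oe]. Qed.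

(** Three derivatives build the field and a fourth its divergence, whence [ok 4]. After these four,
    [flat 5] has become [flat 1], which still gives vanishing outside the box. The divergence
    identities hold by commuting derivatives. *)
Lemma weak_euler_potential M e : ok 4 e -> (forall y, ~ box M y -> flat 5 e y) ->
  weak_euler (potential_field e).
Proof.
move=> oe fe psi d Cpsi.
have o1 : ok 1 (eV1 e) by rewrite /= !ok_D.
have o2 : ok 1 (eV2 e) by rewrite /= !ok_D.
have oA : ok 1 (eA e) by rewrite /= !ok_D.
have oB : ok 1 (eB e) by rewrite /= !ok_D.
have f1 y : ~ box M y -> flat 2 (eV1 e) y.
  by move=> /fe h; right; split; do 3 apply: flat_D.
have f2 y : ~ box M y -> flat 2 (eV2 e) y.
  by move=> /fe h; split; do 3 apply: flat_D.
have fA y : ~ box M y -> flat 2 (eA e) y.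
  by move=> /fe h; right; do 3 apply: flat_D.
have fB y : ~ box M y -> flat 2 (eB e) y.
  by move=> /fe h; split; [|right]; do 3 apply: flat_D.
have key (F : axis -> @sexp R) : (forall i, ok 1 (F i)) ->
    (forall i y, ~ box M y -> flat 2 (F i) y) ->
    (forall y, ev (D At (F At)) y + ev (D A1 (F A1)) y + ev (D A2 (F A2)) y = 0) ->
    \int[lebesgue3]_y (ev (F At) y * d At y + ev (F A1) y * d A1 y + ev (F A2) y * d A2 y) = 0.
  move=> oF fF div0.
  apply: (@divergence_free_weak M (fun i => ev (F i)) (fun i => ev (D i (F i))) psi) => //.
  - by move=> i; exact: continuous_ev.
  - by move=> i; exact: continuous_ev.
  - by move=> i y /(fF i) h; apply: flat_ev; exact: flat_le h.
  - by move=> i y /(fF i) h; apply: flat_ev; exact: flat_D.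
  - by move=> i; exact: pderive_ev.
(* The constraint div v = 0 is treated as a space-time divergence whose time component is this zero
   multiple. *)
have zM : flat 2 (Mul (Cst 0) (eV1 e)) = fun y => flat 2 (eV1 e) y.
  by apply/funext => y /=; apply/propext; split => [[]|]; by [|right].
(* Normal form of the fourth derivatives: the time derivative goes innermost, where [eA] and [eB]
   already have it. *)
have toAt i j k y : ev (D At (D i (D j (D k e)))) y = ev (D i (D j (D k (D At e)))) y.
  by rewrite ev_DD [LHS]ev_D_swap ?ok_D// [LHS]ev_DD_swap.
split.
- rewrite -[RHS](key (fun i => match i with At => Mul (Cst 0) (eV1 e) | A1 => eV1 e | A2 => eV2 e end)).
  + by apply: eq_Rintegral => y _; rewrite /potential_field /=; ring.
  + by case.
  + by case=> y h; [rewrite zM; exact: f1|exact: f1|exact: f2].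
  + by move=> y; have := ev_DD A1 A2 (laplace e) y; rewrite /= => ->; ring.
- rewrite -[RHS](key (fun i => match i with At => eV1 e | A1 => eA e | A2 => eB e end)).
  + by apply: eq_Rintegral => y _.
  + by case.
  + by case=> y h; [exact: f1|exact: fA|exact: fB].
  + move=> y; rewrite /= !toAt.
    have -> : ev (D A2 (D A1 (D A1 (D At e)))) y = ev (D A1 (D A1 (D A2 (D At e)))) y.
      by rewrite ev_DD [LHS]ev_D_swap ?ok_D.
    ring.
- rewrite -[RHS](key (fun i => match i with At => eV2 e | A1 => eB e | A2 => Mul (Cst (-1)) (eA e) end)).
  + by apply: eq_Rintegral => y _; rewrite /potential_field /=; ring.
  + by case.
  + by case=> y h; [exact: f2|exact: fB|right; exact: fA].
  + move=> y; rewrite /= !toAt.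
    have -> : ev (D A2 (D A1 (D A2 (D At e)))) y = ev (D A1 (D A2 (D A2 (D At e)))) y.
      by rewrite ev_DD.
    ring.
Qed.

End weak_form.

(** * Geometry of the hull: stability and admissible wave directions *)

Section hull.
Context {R : realFieldType}.

(* l/2 I - v (x) v + u >= 0 with u = [[a, b], [b, -a]], as a quadratic form in k. *)
Definition in_hull (l v1 v2 a b : R) := forall k1 k2 : R,
  0 <= l / 2 * (k1 ^+ 2 + k2 ^+ 2) - (v1 * k1 + v2 * k2) ^+ 2
       + a * (k1 ^+ 2 - k2 ^+ 2) + 2 * b * (k1 * k2).

Lemma in_hull_diag (l v1 v2 a b : R) : in_hull l v1 v2 a b ->
  0 <= l / 2 - v1 ^+ 2 + a /\ 0 <= l / 2 - v2 ^+ 2 - a.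
Proof. by move=> h; split; [have := h 1 0|have := h 0 1]; lra. Qed.

Lemma in_hull_bound (l v1 v2 a b : R) : in_hull l v1 v2 a b -> v1 ^+ 2 + v2 ^+ 2 <= l.
Proof. by move=> /in_hull_diag[]; lra. Qed.

Lemma in_hull_swap (l v1 v2 a b : R) : in_hull l v1 v2 a b -> in_hull l v2 v1 (- a) b.
Proof. by move=> h k1 k2; have := h k2 k1; lra. Qed.

(** The matrix l/2 I - v (x) v + u has diagonal p, r and off-diagonal q. Its form at (q, -p) equals
    p (p r - q^2), which settles p > 0; p = 0 forces q = 0. *)
Lemma in_hull_det (l v1 v2 a b : R) : in_hull l v1 v2 a b ->
  (b - v1 * v2) ^+ 2 <= (l / 2 - v1 ^+ 2 + a) * (l / 2 - v2 ^+ 2 - a).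
Proof.
move=> h; have [p0 r0] := in_hull_diag h.
set p := l / 2 - v1 ^+ 2 + a in p0 *; set r := l / 2 - v2 ^+ 2 - a in r0 *.
set q := b - v1 * v2.
have Q k1 k2 : 0 <= p * k1 ^+ 2 + 2 * q * (k1 * k2) + r * k2 ^+ 2.
  by have := h k1 k2; rewrite /p /q /r; lra.
move: p0; rewrite le_eqVlt => /predU1P[p0|p0]; last first.
  have := Q q (- p); rewrite (_ : _ + _ = p * (p * r - q ^+ 2)); last by ring.
  by rewrite pmulr_rge0//; lra.
rewrite -p0 mul0r; have [->|q0] := eqVneq q 0; first by rewrite expr0n.
(* With p = 0 the form is 2 q k1 k2 + r k2^2, which takes the value -1 at this point. *)
have := Q (- (r + 1) / (2 * q)) 1.
rewrite -p0 (_ : _ + _ = - 1); last by field.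
by rewrite oppr_ge0 ler10.
Qed.

Lemma in_hull_le (l l' v1 v2 a b : R) : l <= l' -> in_hull l v1 v2 a b -> in_hull l' v1 v2 a b.
Proof.
move=> ll h k1 k2; have := h k1 k2; have := sqr_ge0 k1; have := sqr_ge0 k2; nra.
Qed.

(** With K = |k|^2, the stress errors cost at most eps K + 2 eps K and the error in the squared
    velocity term at most 3 eps K + 2 eps K. Raising l by 40 eps gains 20 eps K. *)
Lemma in_hull_perturb (l l' eps v1 v2 a b w1 w2 wa wb : R) :
  0 <= l <= 1 -> 0 <= eps <= 1 -> l + 40 * eps <= l' ->
  `|w1 - v1| <= eps -> `|w2 - v2| <= eps -> `|wa - a| <= eps -> `|wb - b| <= eps ->
  in_hull l v1 v2 a b -> in_hull l' w1 w2 wa wb.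
Proof.
move=> /andP[l0 l1] /andP[e0 e1] le h1 h2 ha hb h k1 k2.
have vb := in_hull_bound h.
have H := h k1 k2.
set A := w1 - v1 in h1; set B := w2 - v2 in h2.
have -> : w1 = v1 + A by rewrite /A; ring.
have -> : w2 = v2 + B by rewrite /B; ring.
set Aa := wa - a in ha; set Bb := wb - b in hb.
have -> : wa = a + Aa by rewrite /Aa; ring.
have -> : wb = b + Bb by rewrite /Bb; ring.
set K := k1 ^+ 2 + k2 ^+ 2.
have K0 : 0 <= K by rewrite addr_ge0// sqr_ge0.
have kk : `|k1 * k2| <= K.
  rewrite ler_norml; apply/andP; split; rewrite /K; have := sqr_ge0 (k1 + k2); have := sqr_ge0 (k1 - k2); nra.
have kd : `|k1 ^+ 2 - k2 ^+ 2| <= K.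
  rewrite ler_norml; apply/andP; split; rewrite /K; have := sqr_ge0 k1; have := sqr_ge0 k2; lra.
have T1 : - (eps * K) <= Aa * (k1 ^+ 2 - k2 ^+ 2).
  have : `|Aa * (k1 ^+ 2 - k2 ^+ 2)| <= eps * K by rewrite normrM ler_pM.
  by rewrite ler_norml => /andP[].
have T2 : - (eps * K) <= Bb * (k1 * k2).
  have : `|Bb * (k1 * k2)| <= eps * K by rewrite normrM ler_pM.
  by rewrite ler_norml => /andP[].
pose x := v1 * k1 + v2 * k2; pose y := A * k1 + B * k2.
have x2 : x ^+ 2 <= K.
  have : x ^+ 2 <= (v1 ^+ 2 + v2 ^+ 2) * K.
    by rewrite /x /K; have := sqr_ge0 (v1 * k2 - v2 * k1); lra.
  by move=> /le_trans; apply; rewrite -[leRHS]mul1r ler_wpM2r//; lra.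
have sq (z : R) : `|z| <= eps -> z ^+ 2 <= eps ^+ 2.
  by move=> h0; rewrite -real_normK ?num_real// lerXn2r ?nnegrE.
have y2 : y ^+ 2 <= 2 * eps ^+ 2 * K.
  have : y ^+ 2 <= (A ^+ 2 + B ^+ 2) * K.
    by rewrite /y /K; have := sqr_ge0 (A * k2 - B * k1); lra.
  move=> /le_trans; apply; rewrite ler_wpM2r//.
  by have := sq _ h1; have := sq _ h2; lra.
have xy : 2 * (x * y) <= 3 * eps * K.
  move: e0; rewrite le_eqVlt => /predU1P[e0|e0].
    have : y ^+ 2 <= 0 by move: y2; rewrite -e0 expr0n mulr0 mul0r.
    rewrite le_eqVlt ltNge sqr_ge0 orbF sqrf_eq0 => /eqP ->.
    by rewrite -e0; lra.
  (* AM-GM *)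
  have : 0 <= (eps * x - y) ^+ 2 by exact: sqr_ge0.
  rewrite (_ : _ ^+ 2 = eps ^+ 2 * x ^+ 2 - eps * (2 * (x * y)) + y ^+ 2); last by ring.
  have : eps ^+ 2 * x ^+ 2 <= eps ^+ 2 * K by rewrite ler_wpM2l// sqr_ge0.
  move=> X Y; rewrite -(ler_pM2l e0).
  by rewrite (_ : eps * (3 * eps * K) = eps ^+ 2 * K + 2 * eps ^+ 2 * K); [lra|ring].
have yy : y ^+ 2 <= 2 * eps * K.
  apply: (le_trans y2); rewrite ler_wpM2r// expr2; have := e1; nra.
rewrite (_ : _ * k1 + _ * k2 = x + y); last by rewrite /x /y; ring.
have LK : 40 * eps * K <= (l' - l) * K by rewrite ler_wpM2r//; lra.
have EK : 0 <= eps * K by rewrite mulr_ge0.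
move: H; rewrite -/x -/K; nra.
Qed.

(** Let X = l/2 I - v (x) v + u have diagonal p >= r and first column m = (p, q). The prescribed
    motion changes X by -c m (x) m with c <= 1/p, whereas X >= m (x) m / p because det X >= 0. Since
    the trace of X is e, p >= e/2 and therefore |m|^2 >= e^2/4. *)
Lemma in_hull_direction_aux (l v1 v2 a b : R) : 0 <= l <= 2^-1 -> in_hull l v1 v2 a b ->
  let e := l - v1 ^+ 2 - v2 ^+ 2 in
  0 < e -> l / 2 - v2 ^+ 2 - a <= l / 2 - v1 ^+ 2 + a ->
  exists m1 m2 tau : R, let n := m1 ^+ 2 + m2 ^+ 2 in
  [/\ 0 < n, e ^+ 2 / 4 <= n &
   forall th, `|th| <= 1 -> in_hull l (v1 + th * (m1 / 4)) (v2 + th * (m2 / 4))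
     (a + th * (- (tau / (4 * n)) * (2 * m1 * m2)))
     (b + th * (tau / (4 * n) * (m1 ^+ 2 - m2 ^+ 2)))].
Proof.
move=> /andP[l0 l1] h e e0 rp.
have [p0 r0] := in_hull_diag h.
have det := in_hull_det h.
set p := l / 2 - v1 ^+ 2 + a in rp p0 det; set r := l / 2 - v2 ^+ 2 - a in rp r0 det.
pose q := b - v1 * v2; rewrite -/q in det.
have pe : e / 2 <= p by rewrite /e /p; move: rp; rewrite /p /r; lra.
have ppos : 0 < p by lra.
have p1 : p <= 2^-1 by have := sqr_ge0 v1; have := sqr_ge0 v2; move: r0; rewrite /r /p; lra.
(* [tau] is the component of v along m' = (-q, p). In v = al m + (tau / n) m', the second summand
   produces a mixed part in the change of v (x) v, and the motion of u cancels it exactly. *)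
exists p, q, (v2 * p - v1 * q) => n.
have n0 : 0 < n by rewrite /n ltr_pwDl ?sqr_ge0// exprn_gt0.
have np : p ^+ 2 <= n by rewrite /n lerDl sqr_ge0.
split => //.
  apply: le_trans np; rewrite (_ : _ / 4 = (e / 2) ^+ 2); last by field.
  by rewrite lerXn2r ?nnegrE//; lra.
move=> th th1 k1 k2.
pose al := (v1 * p + v2 * q) / n.
have al2 : al ^+ 2 <= (p^-1) ^+ 2.
  rewrite /al expr_div_n.
  have vm : (v1 * p + v2 * q) ^+ 2 <= n.
    have : (v1 * p + v2 * q) ^+ 2 <= (v1 ^+ 2 + v2 ^+ 2) * n.
      by rewrite /n; have := sqr_ge0 (v1 * q - v2 * p); lra.
    move=> /le_trans; apply; rewrite -[leRHS]mul1r ler_wpM2r//; first exact: ltW.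
    by have := in_hull_bound h; lra.
  rewrite ler_pdivrMr ?exprn_gt0// exprVn ler_pdivlMl ?exprn_gt0//.
  by rewrite [n ^+ 2]expr2 ler_pM// ?sqr_ge0.
have al1 : `|al| <= p^-1.
  by rewrite -ler_sqr ?nnegrE ?invr_ge0// real_normK ?num_real.
pose c := 2 * th * al / 4 + th ^+ 2 / 16.
have cp : c <= p^-1.
  have ip : 2 <= p^-1 by rewrite -[leLHS]invrK lef_pV2 ?posrE// invr_gt0.
  have : `|th * al| <= 1 * p^-1 by rewrite normrM ler_pM.
  rewrite ler_norml => /andP[_ h1].
  have : th ^+ 2 <= 1 by rewrite -real_normK ?num_real// exprn_ile1.
  by rewrite /c; lra.
have -> : l / 2 * (k1 ^+ 2 + k2 ^+ 2) -
  ((v1 + th * (p / 4)) * k1 + (v2 + th * (q / 4)) * k2) ^+ 2 +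
  (a + th * (- ((v2 * p - v1 * q) / (4 * n)) * (2 * p * q))) * (k1 ^+ 2 - k2 ^+ 2) +
  2 * (b + th * ((v2 * p - v1 * q) / (4 * n) * (p ^+ 2 - q ^+ 2))) * (k1 * k2) =
  (p * k1 ^+ 2 + 2 * q * (k1 * k2) + r * k2 ^+ 2) - c * (p * k1 + q * k2) ^+ 2.
  rewrite /c /al.
  have -> : l / 2 = p + v1 ^+ 2 - a by rewrite /p; ring.
  have -> : r = p + v1 ^+ 2 - a - v2 ^+ 2 - a by rewrite /p /r; ring.
  have -> : b = q + v1 * v2 by rewrite /q; ring.
  rewrite /n; field.
  by rewrite -/n gt_eqF.
(* Completing the square in k1; the remaining term is det X times k2^2 / p. *)
have Q : (p * k1 + q * k2) ^+ 2 / p <= p * k1 ^+ 2 + 2 * q * (k1 * k2) + r * k2 ^+ 2.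
  rewrite ler_pdivrMr//.
  have : 0 <= (p * r - q ^+ 2) * k2 ^+ 2 by rewrite mulr_ge0 ?sqr_ge0// subr_ge0.
  lra.
rewrite subr_ge0; apply: le_trans Q.
by rewrite mulrC ler_wpM2l ?sqr_ge0.
Qed.

(** If the second diagonal entry is the larger one, exchange the axes. This reflection reverses the
    sign of [tau]. *)
Lemma in_hull_direction (l v1 v2 a b : R) : 0 <= l <= 2^-1 -> in_hull l v1 v2 a b ->
  let e := l - v1 ^+ 2 - v2 ^+ 2 in
  0 < e ->
  exists m1 m2 tau : R, let n := m1 ^+ 2 + m2 ^+ 2 in
  [/\ 0 < n, e ^+ 2 / 4 <= n &
   forall th, `|th| <= 1 -> in_hull l (v1 + th * (m1 / 4)) (v2 + th * (m2 / 4))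
     (a + th * (- (tau / (4 * n)) * (2 * m1 * m2)))
     (b + th * (tau / (4 * n) * (m1 ^+ 2 - m2 ^+ 2)))].
Proof.
move=> l01 h e e0.
have [rp|/ltW pr] := leP (l / 2 - v2 ^+ 2 - a) (l / 2 - v1 ^+ 2 + a).
  exact: in_hull_direction_aux.
have [||m1 [m2 [tau [n0 en H]]]] := in_hull_direction_aux l01 (in_hull_swap h).
- by move: e0; rewrite /e; lra.
- by lra.
exists m2, m1, (- tau) => n.
have nE : n = m1 ^+ 2 + m2 ^+ 2 by rewrite /n addrC.
split; rewrite ?nE//; first by rewrite /e -addrAC.
move=> th /H /in_hull_swap; rewrite opprD opprK.
set E := _ + m2 ^+ 2; congr in_hull.
  by congr (_ + _); ring.
by congr (_ + _); ring.
Qed.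

End hull.

(** * High-frequency plane waves and their leading terms *)

Section wave.
Context {R : realType}.
Local Notation ST := (R * (R * R))%type.
Local Notation D := (@D R).

Definition linear_form (x0 x1 x2 : R) : @sexp R :=
  Add (Mul (Cst x0) (Var At)) (Add (Mul (Cst x1) (Var A1)) (Mul (Cst x2) (Var A2))).

Definition phase (x0 x1 x2 N th : R) : @sexp R :=
  Add (Mul (Cst N) (linear_form x0 x1 x2)) (Cst th).

Definition covec (x0 x1 x2 : R) (i : axis) : R :=
  match i with At => x0 | A1 => x1 | A2 => x2 end.

Lemma ev_bounded (e : @sexp R) M : exists B, forall y, box M y -> `|ev e y| <= B.
Proof. exact/continuous_bounded_box/continuous_ev. Qed.

(** By the Leibniz rule each derivative falling on [chi] costs a factor N. With all three on the
    cosine one gets the leading term, as cos''' = sin. The constant is uniform in the phase shift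
    [th]. *)
Lemma wave_leading_term x0 x1 x2 (chi : @sexp R) M i j k :
  exists B, 0 <= B /\ forall N th y, 1 <= N -> box M y ->
  `|ev (D i (D j (D k (Mul chi (Cos (phase x0 x1 x2 N th)))))) y
    - N ^+ 3 * (covec x0 x1 x2 i * covec x0 x1 x2 j * covec x0 x1 x2 k)
      * (ev chi y * sin (ev (phase x0 x1 x2 N th) y))| <= B * N ^+ 2.
Proof.
pose xi := covec x0 x1 x2.
(* [B0], [B1] and [B2] bound the terms with three, two and one derivatives on [chi]; these carry
   N^0, N^1 and N^2. *)
have [B0 hB0] := ev_bounded (D i (D j (D k chi))) M.
have [B1 hB1] := ev_bounded (Add (Mul (Cst (xi i)) (D j (D k chi)))
  (Add (Mul (Cst (xi j)) (D i (D k chi))) (Mul (Cst (xi k)) (D i (D j chi))))) M.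
have [B2 hB2] := ev_bounded (Add (Mul (Cst (xi i * xi j)) (D k chi))
  (Add (Mul (Cst (xi j * xi k)) (D i chi)) (Mul (Cst (xi i * xi k)) (D j chi)))) M.
exists (`|B0| + `|B1| + `|B2|); split; first by rewrite !addr_ge0.
move=> N th y N1 by_.
set W := phase _ _ _ _ _.
have -> : ev (D i (D j (D k (Mul chi (Cos W))))) y -
  N ^+ 3 * (covec x0 x1 x2 i * covec x0 x1 x2 j * covec x0 x1 x2 k) *
      (ev chi y * sin (ev W y)) =
  ev (D i (D j (D k chi))) y * cos (ev W y)
  - N * (ev (Add (Mul (Cst (xi i)) (D j (D k chi)))
  (Add (Mul (Cst (xi j)) (D i (D k chi))) (Mul (Cst (xi k)) (D i (D j chi))))) y) * sin (ev W y)
  - N ^+ 2 * (ev (Add (Mul (Cst (xi i * xi j)) (D k chi))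
  (Add (Mul (Cst (xi j * xi k)) (D i chi)) (Mul (Cst (xi i * xi k)) (D j chi)))) y) * cos (ev W y).
  rewrite /W /= !(mul0r, mulr0, add0r, addr0).
  have xiE l : x0 * axis_eq l At + (x1 * axis_eq l A1 + x2 * axis_eq l A2) = xi l :> R.
    by case: l => /=; rewrite !(mulr0, mulr1, add0r, addr0).
  by rewrite !xiE /xi; ring.
have := hB0 _ by_; have := hB1 _ by_; have := hB2 _ by_.
set E2 := ev _ y; set E1 := ev _ y; set E0 := ev _ y => h2 h1 h0.
clearbody E0 E1 E2.
have bnd (x t B : R) : `|x| <= B -> `|t| <= 1 -> `|x * t| <= `|B|.
  move=> xB t1; rewrite normrM -[leRHS]mulr1 ler_pM//.
  by apply: (le_trans xB); exact: ler_norm.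
have c1 : `|cos (ev W y)| <= 1 by rewrite ler_norml cos_geN1 cos_le1.
have s1 : `|sin (ev W y)| <= 1 by rewrite ler_norml sin_geN1 sin_le1.
have N0 : 0 <= N by lra.
have NN : N <= N ^+ 2 by rewrite expr2 ler_peMl.
have NN1 : 1 <= N ^+ 2 by apply: le_trans NN.
rewrite -[N * E1 * _]mulrA -[N ^+ 2 * E2 * _]mulrA.
apply: (le_trans (ler_normB _ _)); rewrite mulrDl; apply: lerD; last first.
  rewrite normrM (ger0_norm (exprn_ge0 2 N0)) [leRHS]mulrC.
  by rewrite ler_wpM2l ?exprn_ge0//; exact: bnd.
apply: (le_trans (ler_normB _ _)); rewrite mulrDl; apply: lerD.
  by rewrite -[leLHS]mulr1; apply: ler_pM => //; exact: bnd.
by rewrite normrM (ger0_norm N0) [leRHS]mulrC ler_pM//; exact: bnd.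
Qed.

End wave.

Section packet.
Context {R : realType}.
Local Notation ST := (R * (R * R))%type.
Local Notation D := (@D R).
Local Notation mu := (@lebesgue_measure R).

(* The amplitude N^-3 balances the three derivatives of potential_field, and the
   covector (tau, m2, -m1) makes the leading velocity parallel to (m1, m2). *)
Definition packet (chi : @sexp R) (m1 m2 tau N th : R) : @sexp R :=
  Mul (Cst ((4 * (m1 ^+ 2 + m2 ^+ 2))^-1 / N ^+ 3))
      (Mul chi (Cos (phase tau m2 (- m1) N th))).

Lemma ev_D3_scale i j k r (e : @sexp R) y :
  ev (D i (D j (D k (Mul (Cst r) e)))) y = r * ev (D i (D j (D k e))) y.
Proof. by rewrite /=; ring. Qed.

(** The spatial part of the covector has squared length n, so the prefactor 1/(4n) makes the leading
    velocity exactly f m/4, the motion that [in_hull_direction] admits for |f| <= 1. [N] is fixed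
    before [th], which leaves the phase free. *)
Lemma packet_leading_term chi M (m1 m2 tau eps : R) :
  let n := m1 ^+ 2 + m2 ^+ 2 in 0 < n -> 0 < eps ->
  exists N, forall th y, box M y ->
    let z := potential_field (packet chi m1 m2 tau N th) in
    let f := ev chi y * sin (ev (phase tau m2 (- m1) N th) y) in
    [/\ `|fv1 z y - f * (m1 / 4)| <= eps, `|fv2 z y - f * (m2 / 4)| <= eps,
        `|fa z y - f * (- (tau / (4 * n)) * (2 * m1 * m2))| <= eps &
        `|fb z y - f * (tau / (4 * n) * (m1 ^+ 2 - m2 ^+ 2))| <= eps].
Proof.
move=> n n0 eps0.
have lead i j k := wave_leading_term tau m2 (- m1) chi M i j k.
have [B1 [B10 h1]] := lead A2 A1 A1.
have [B2 [B20 h2]] := lead A2 A2 A2.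
have [B3 [B30 h3]] := lead A1 A1 A1.
have [B4 [B40 h4]] := lead A1 A2 A2.
have [B5 [B50 h5]] := lead A1 A2 At.
have [B6 [B60 h6]] := lead A2 A2 At.
have [B7 [B70 h7]] := lead A1 A1 At.
pose A0 := (4 * n)^-1.
have A00 : 0 < A0 by rewrite invr_gt0; lra.
pose S := A0 * (B1 + B2 + B3 + B4 + 2 * B5 + B6 + B7).
have [S12 S34 S55 S67] : [/\ A0 * (B1 + B2) <= S, A0 * (B3 + B4) <= S,
    A0 * (B5 + B5) <= S & A0 * (B6 + B7) <= S].
  split; rewrite ler_wpM2l ?(ltW A00)//; move: B10 B20 B30 B40 B50 B60 B70; clear; lra.
exists (1 + S / eps) => th y by_ z f.
have S0 : 0 <= S by apply: mulr_ge0; [exact: ltW|lra].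
set N := 1 + _ in z f *.
have N1 : 1 <= N by rewrite lerDl divr_ge0// ltW.
have N0 : 0 < N by lra.
have SN : S / N <= eps.
  rewrite ler_pdivrMr//; have -> : eps * N = eps + S by rewrite /N; field; rewrite gt_eqF.
  by lra.
have main (T x c B : R) : `|T - N ^+ 3 * x * f| <= B * N ^+ 2 ->
    `|A0 / N ^+ 3 * T - f * (A0 * x)| <= A0 * B / N.
  move=> hT.
  have -> : A0 / N ^+ 3 * T - f * (A0 * x) = A0 / N ^+ 3 * (T - N ^+ 3 * x * f).
    by field; rewrite gt_eqF.
  rewrite normrM ger0_norm; last by rewrite divr_ge0 ?exprn_ge0// ltW.
  have -> : A0 * B / N = A0 / N ^+ 3 * (B * N ^+ 2) by field; rewrite gt_eqF.
  by rewrite ler_wpM2l// divr_ge0 ?exprn_ge0// ltW.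
have M1 := main _ _ 0 _ (h1 N th y N1 by_).
have M2 := main _ _ 0 _ (h2 N th y N1 by_).
have M3 := main _ _ 0 _ (h3 N th y N1 by_).
have M4 := main _ _ 0 _ (h4 N th y N1 by_).
have M5 := main _ _ 0 _ (h5 N th y N1 by_).
have M6 := main _ _ 0 _ (h6 N th y N1 by_).
have M7 := main _ _ 0 _ (h7 N th y N1 by_).
have nE : A0 * n = 4^-1 by rewrite /A0; field; rewrite gt_eqF.
have add (X Y x x' B B' : R) : `|X - x| <= A0 * B / N -> `|Y - x'| <= A0 * B' / N ->
    A0 * (B + B') <= S -> `|(X + Y) - (x + x')| <= eps.
  move=> hX hY hS; apply: le_trans SN.
  rewrite opprD addrACA; apply: (le_trans (ler_normD _ _)).
  apply: (le_trans (lerD hX hY)).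
  by rewrite -mulrDl ler_wpM2r ?invr_ge0 ?(ltW N0)// -mulrDr.
rewrite /z /potential_field /fv1 /fv2 /fa /fb /eV1 /eV2 /eA /eB /laplace /packet -/n -/A0.
have evA a b : ev (Add a b) y = ev a y + ev b y by [].
have evM a b : ev (Mul a b) y = ev a y * ev b y by [].
have evC r : ev (@Cst R r) y = r by [].
have DA i a b : D i (Add a b) = Add (D i a) (D i b) by [].
pose xi := covec tau m2 (- m1).
split.
- rewrite evM evC mulN1r DA evA !ev_D3_scale.
  have -> : f * (m1 / 4) = - (f * (A0 * (xi A2 * xi A1 * xi A1)) +
      f * (A0 * (xi A2 * xi A2 * xi A2))).
    by rewrite /= -[_ / 4]/(m1 * 4^-1) -nE /n; ring.
  rewrite -opprD normrN.
  exact: (add _ _ _ _ _ _ M1 M2 S12).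
- rewrite DA evA !ev_D3_scale.
  have -> : f * (m2 / 4) = f * (A0 * (xi A1 * xi A1 * xi A1)) +
      f * (A0 * (xi A1 * xi A2 * xi A2)).
    by rewrite /= -[_ / 4]/(m2 * 4^-1) -nE /n; ring.
  exact: (add _ _ _ _ _ _ M3 M4 S34).
- rewrite evM evC !ev_D3_scale.
  have -> : f * (- (tau / (4 * n)) * (2 * m1 * m2)) =
      f * (A0 * (xi A1 * xi A2 * xi At)) + f * (A0 * (xi A1 * xi A2 * xi At)).
    by rewrite /= /A0; ring.
  rewrite mulrDl mul1r; exact: (add _ _ _ _ _ _ M5 M5 S55).
- rewrite evA evM evC mulN1r !ev_D3_scale.
  have -> : f * (tau / (4 * n) * (m1 ^+ 2 - m2 ^+ 2)) =
      f * (A0 * (xi A2 * xi A2 * xi At)) - f * (A0 * (xi A1 * xi A1 * xi At)).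
    by rewrite /= /A0; ring.
  have M7' : `|- (A0 / N ^+ 3 * ev (D A1 (D A1 (D At (Mul chi (Cos (phase tau m2 (- m1) N th)))))) y) -
      - (f * (A0 * (xi A1 * xi A1 * xi At)))| <= A0 * B7 / N.
    by rewrite -opprD normrN.
  exact: (add _ _ _ _ _ _ M6 M7' S67).
Qed.

End packet.

(** * Cells in null coordinates and their bump functions *)

Section cells.
Context {R : realType}.
Local Notation ST := (R * (R * R))%type.
Local Notation mu := (@lebesgue_measure R).

Definition intg (f : ST -> R) := lebesgue3.-integrable setT (EFin \o f).

Lemma intgZ r f : intg f -> intg (fun y => r * f y).
Proof.
move=> fi; rewrite /intg (_ : _ \o _ = fun y => (r%:E * (f y)%:E)%E).
  exact: integrableZl.
by apply/funext => y /=; rewrite EFinM.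
Qed.

Lemma intgD f g : intg f -> intg g -> intg (fun y => f y + g y).
Proof.
move=> fi gi; rewrite /intg (_ : _ \o _ = fun y => ((f y)%:E + (g y)%:E)%E).
  exact: integrableD.
by apply/funext => y /=; rewrite EFinD.
Qed.

Lemma intgB f g : intg f -> intg g -> intg (fun y => f y - g y).
Proof.
move=> fi gi; rewrite (_ : (fun y => _) = (fun y => f y + -1 * g y)).
  by apply: intgD => //; exact: intgZ.
by apply/funext => y; rewrite mulN1r.
Qed.

Lemma intg_sum (I : Type) (s : seq I) (f : I -> ST -> R) : (forall i, intg (f i)) ->
  intg (fun y => \sum_(i <- s) f i y).
Proof.
move=> fi; elim: s => [|i s IH].
  under eq_fun do rewrite big_nil; exact: integrable0.
by under eq_fun do rewrite big_cons; exact: intgD.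
Qed.

Lemma Rintegral_sum3 (I : Type) (s : seq I) (f : I -> ST -> R) : (forall i, intg (f i)) ->
  \int[lebesgue3]_y (\sum_(i <- s) f i y) = \sum_(i <- s) \int[lebesgue3]_y f i y.
Proof.
move=> fi; elim: s => [|i s IH].
  under eq_Rintegral do rewrite big_nil.
  by rewrite big_nil Rintegral_cst// mul0r.
under eq_Rintegral do rewrite big_cons.
by rewrite RintegralD//; [rewrite IH big_cons|exact: fi|exact: intg_sum].
Qed.

(* The null coordinates t - x2 and t + x2 make unit cells tile the cone exactly. *)
Definition cell (cp cq cr h : R) : set ST :=
  [set y | [/\ cp <= y.1 - y.2.2 < cp + h, cq <= y.1 + y.2.2 < cq + h &
               cr <= y.2.1 < cr + h]].

Lemma measurable_preimage3 (f : ST -> R) (A : set R) : continuous f -> measurable A ->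
  measurable (f @^-1` A).
Proof.
move=> cf mA; rewrite -[X in measurable X]setTI.
exact: (continuous_measurable3 cf measurableT).
Qed.

Lemma continuous_t : continuous (fun y : ST => y.1).
Proof. exact: (@continuous_crd R At). Qed.
Lemma continuous_x1 : continuous (fun y : ST => y.2.1).
Proof. exact: (@continuous_crd R A1). Qed.
Lemma continuous_x2 : continuous (fun y : ST => y.2.2).
Proof. exact: (@continuous_crd R A2). Qed.

Lemma measurable_cell cp cq cr h : measurable (cell cp cq cr h : set ST).
Proof.
rewrite (_ : cell _ _ _ _ =
  ((fun y : ST => y.1 - y.2.2) @^-1` `[cp, cp + h[%classic) `&`
  (((fun y : ST => y.1 + y.2.2) @^-1` `[cq, cq + h[%classic) `&`
   ((fun y : ST => y.2.1) @^-1` `[cr, cr + h[%classic))); last first.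
  by apply/seteqP; split => [y []|y [/= + []]]; rewrite /= !in_itv.
apply: measurableI; [|apply: measurableI]; apply: measurable_preimage3 => //.
- by move=> y; apply: cvgB; [exact: continuous_t|exact: continuous_x2].
- by move=> y; apply: cvgD; [exact: continuous_t|exact: continuous_x2].
- exact: continuous_x1.
Qed.

Lemma cell_box cp cq cr h : 0 <= h -> cell cp cq cr h `<=` box (`|cp| + `|cq| + `|cr| + h).
Proof.
move=> h0 y [/andP[p1 p2] /andP[q1 q2] /andP[r1 r2]]; apply/boxP.
have := ler_norm cp; have := ler_norm (- cp); rewrite normrN => P1 P2.
have := ler_norm cq; have := ler_norm (- cq); rewrite normrN => Q1 Q2.
have := ler_norm cr; have := ler_norm (- cr); rewrite normrN => R1 R2.
by split; rewrite ler_norml; apply/andP; split; lra.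
Qed.

Lemma lebesgue_measure_itvcc (a b : R) : a <= b -> mu `[a, b]%classic = (b - a)%:E.
Proof.
rewrite le_eqVlt => /predU1P[->|ab]; first by rewrite set_itv1 lebesgue_measure_set1 subrr.
by rewrite lebesgue_measure_itv/= lte_fin ab EFinB.
Qed.

(** A cell lies in an axis-parallel cube of side [h]. The change to null coordinates has Jacobian
    1/2, so a factor 2 is lost, which only affects constants. *)
Lemma cell_volume_le cp cq cr h : 0 < h ->
  fine (lebesgue3 (cell cp cq cr h)) <= h ^+ 3.
Proof.
move=> h0.
pose t0 := (cp + cq) / 2; pose x0 := (cq - cp) / 2.
pose B : set ST := `[t0, t0 + h]%classic `*` (`[cr, cr + h]%classic `*` `[x0 - h / 2, x0 + h / 2]%classic).
have vB : lebesgue3 B = (h ^+ 3)%:E.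
  by rewrite lebesgue3_setX// !lebesgue_measure_itvcc -?EFinM; [congr EFin; field|lra..].
have mB : measurable B by apply: measurableX => //; apply: measurableX.
have sB : (lebesgue3 (cell cp cq cr h) <= lebesgue3 B)%E.
  apply: le_measure; rewrite ?inE//; first exact: measurable_cell.
  move=> y [/andP[p1 p2] /andP[q1 q2] /andP[r1 r2]].
  by rewrite /B /t0 /x0; split=> /=; [|split=> /=]; rewrite in_itv/=; apply/andP; split; lra.
have -> : h ^+ 3 = fine (lebesgue3 B) by rewrite vB.
apply: fine_le; [|by rewrite vB|exact: sB].
rewrite ge0_fin_numE; last exact: measure_ge0.
by apply: le_lt_trans sB _; rewrite vB ltry.
Qed.

Lemma cell_lty cp cq cr h : 0 <= h -> (lebesgue3 (cell cp cq cr h) < +oo)%E.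
Proof.
move=> h0; apply: le_lt_trans (box_lty (`|cp| + `|cq| + `|cr| + h)).
apply: le_measure; rewrite ?inE; [exact: measurable_cell|exact: box_measurable|exact: cell_box].
Qed.

Lemma integrable_indic3 (A : set ST) : measurable A -> (lebesgue3 A < +oo)%E ->
  lebesgue3.-integrable setT (EFin \o (\1_A : ST -> R)).
Proof.
move=> mA fA; rewrite (_ : _ \o _ = (cst 1%E) \_ A); last first.
  by apply/funext => y /=; rewrite indic_restrict restrict_EFin.
apply/integrable_restrict; [exact: mA|exact: measurableT|rewrite setTI].
apply: measurable_bounded_integrable; [exact: mA|exact: fA| |exact: bounded_cst].
exact: measurable_cst.
Qed.

Lemma Rintegral_indic3 (A : set ST) : measurable A ->
  \int[lebesgue3]_y (\1_A : ST -> R) y = fine (lebesgue3 A).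
Proof.
move=> mA; rewrite /Rintegral; congr fine.
by have := integral_indic lebesgue3 measurableT mA; rewrite setIT; apply.
Qed.

(** The parabola 4 s (1 - s) in the rescaled variable s: it is positive only within the slab, and at
    most 1. *)
Definition bump1 (L : @sexp R) (c h : R) : @sexp R :=
  let s := Mul (Cst h^-1) (Add L (Cst (- c))) in
  Mul (Cst 4) (Mul s (Add (Cst 1) (Mul (Cst (-1)) s))).

(** Sixth powers make the product [flat 6] outside the cell and [ok 4], enough for three derivatives
    and a divergence. *)
Definition bump (cp cq cr h : R) : @sexp R :=
  Mul (Pp 6 (bump1 (linear_form 1 0 (-1)) cp h))
      (Mul (Pp 6 (bump1 (linear_form 1 0 1) cq h)) (Pp 6 (bump1 (linear_form 0 1 0) cr h))).

Lemma ev_bump1 L c h y : ev (bump1 L c h) y =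
  4 * ((ev L y - c) / h * (1 - (ev L y - c) / h)).
Proof. by rewrite /=; ring. Qed.

Lemma bump1_le0 L c h y : 0 < h -> ~~ (c <= ev L y < c + h) -> ev (bump1 L c h) y <= 0.
Proof.
move=> h0; rewrite ev_bump1; set s := _ / h.
have -> : ev L y = c + s * h by rewrite /s divfK ?gt_eqF//; ring.
rewrite negb_and -ltNge -leNgt => /orP[H|H].
  have : s < 0 by rewrite -(pmulr_llt0 _ h0); lra.
  nra.
have : 1 <= s by rewrite -(ler_pM2r h0); lra.
nra.
Qed.

Lemma bump1_le1 L c h y : ev (bump1 L c h) y <= 1.
Proof. by rewrite ev_bump1; set s := _ / h; have := sqr_ge0 (2 * s - 1); lra. Qed.

Lemma bump1_middle L c h y : 0 < h -> c + h / 4 <= ev L y <= c + 3 * h / 4 ->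
  3 / 4 <= ev (bump1 L c h) y.
Proof.
move=> h0 /andP[h1 h2]; rewrite ev_bump1; set s := _ / h.
have s1 : 1 / 4 <= s by rewrite /s ler_pdivlMr//; lra.
have s2 : s <= 3 / 4 by rewrite /s ler_pdivrMr//; lra.
nra.
Qed.

Lemma flat_bump cp cq cr h y : 0 < h -> ~ cell cp cq cr h y -> flat 6 (bump cp cq cr h) y.
Proof.
move=> h0 ncell.
have P (L : @sexp R) c l : ev L y = l -> ~~ (c <= l < c + h) ->
    (6 <= 6)%N /\ ev (bump1 L c h) y <= 0.
  by move=> <- H; split => //; exact: bump1_le0.
have Ep : ev (linear_form 1 0 (-1)) y = y.1 - y.2.2 by rewrite /=; ring.
have Eq : ev (linear_form 1 0 1) y = y.1 + y.2.2 by rewrite /=; ring.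
have Er : ev (linear_form 0 1 0) y = y.2.1 by rewrite /=; ring.
have [p|p] := boolP (cp <= y.1 - y.2.2 < cp + h); last by left; exact: P Ep p.
right; have [q|q] := boolP (cq <= y.1 + y.2.2 < cq + h); last by left; exact: P Eq q.
right; apply: P Er _.
by apply/negP => r; apply: ncell.
Qed.

Lemma pospow_ge0 n (s : R) : 0 <= pospow n s.
Proof. by rewrite exprn_ge0// le_max lexx. Qed.

Lemma pospow_le1 n (s : R) : s <= 1 -> pospow n s <= 1.
Proof. by move=> s1; rewrite exprn_ile1// ?le_max ?lexx// ge_max ler01. Qed.

Lemma bump_bounds cp cq cr h y : 0 <= ev (bump cp cq cr h) y <= 1.
Proof.
have L (L : @sexp R) c : 0 <= pospow 6 (ev (bump1 L c h) y) <= 1.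
  by rewrite pospow_ge0 pospow_le1// bump1_le1.
have /andP[a0 a1] := L (linear_form 1 0 (-1)) cp.
have /andP[b0 b1] := L (linear_form 1 0 1) cq.
have /andP[c0 c1] := L (linear_form 0 1 0) cr.
rewrite [ev _ _]/(_ * (_ * _)); apply/andP; split.
  by apply: mulr_ge0 => //; exact: mulr_ge0.
by apply: mulr_ile1 => //; [exact: mulr_ge0|exact: mulr_ile1].
Qed.

(** Where the three rescaled variables lie in [1/4, 3/4], each parabola is at least 3/4. This region
    contains a box of volume h^3/32, over which the square of the bump is integrated. *)
Definition bump_mass : R := (((3 / 4) ^+ 6) ^+ 3) ^+ 2 / 32.

Lemma bump_mass_gt0 : 0 < bump_mass.
Proof. by rewrite divr_gt0// !exprn_gt0//; lra. Qed.

Lemma integrable_continuous_cell (f : ST -> R) cp cq cr h : 0 <= h -> continuous f ->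
  (forall y, ~ cell cp cq cr h y -> f y = 0) -> lebesgue3.-integrable setT (EFin \o f).
Proof.
move=> h0 cf sf; apply: (integrable_continuous_box cf) => y nb.
by apply: sf => /(cell_box h0) /nb.
Qed.

Lemma bump_integral cp cq cr h : 0 < h ->
  bump_mass * h ^+ 3 <= \int[lebesgue3]_y (ev (bump cp cq cr h) y ^+ 2).
Proof.
move=> h0.
pose t0 := (cp + cq) / 2; pose x0 := (cq - cp) / 2.
pose B : set ST := `[t0 + 3 * h / 8, t0 + 5 * h / 8]%classic `*`
  (`[cr + h / 4, cr + 3 * h / 4]%classic `*` `[x0 - h / 8, x0 + h / 8]%classic).
have vB : lebesgue3 B = (h ^+ 3 / 32)%:E.
  by rewrite lebesgue3_setX// !lebesgue_measure_itvcc -?EFinM; [congr EFin; field|lra..].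
have mB : measurable B by apply: measurableX => //; apply: measurableX.
have iB := integrable_indic3 mB ltac:(by rewrite vB ltry).
pose k : R := ((3 / 4) ^+ 6) ^+ 3.
have -> : bump_mass * h ^+ 3 = \int[lebesgue3]_y (k ^+ 2 * (\1_B : ST -> R) y).
  rewrite RintegralZl// Rintegral_indic3// vB /bump_mass -/k /=.
  by move: (k ^+ 2) (h ^+ 3) => x z; field.
have cb := @continuous_ev R (bump cp cq cr h).
apply: le_Rintegral => //.
- exact: intgZ.
- apply: (@integrable_continuous_cell _ cp cq cr h); first exact: ltW.
    by move=> y; apply: cvgM; exact: cb.
  by move=> y /(flat_bump h0) fb; rewrite (@flat_ev R _ y) ?expr0n//; exact: flat_le fb.
- move=> y _; rewrite indicE; set E := ev _ y; case: (boolP (y \in B)) => [|_]; last by rewrite mulr0 sqr_ge0.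
  rewrite inE mulr1 /B /t0 /x0 => -[/= + [/=]]; rewrite !in_itv/= => /andP[a1 a2] /andP[b1 b2] /andP[c1 c2].
  have P (L : @sexp R) c : c + h / 4 <= ev L y <= c + 3 * h / 4 ->
      (3 / 4) ^+ 6 <= pospow 6 (ev (bump1 L c h) y).
    move=> /(bump1_middle h0) H; rewrite /pospow lerXn2r ?nnegrE ?le_max ?lexx ?H ?orbT//; lra.
  have p0 : 0 <= (3 / 4) ^+ 6 :> R by rewrite exprn_ge0//; lra.
  have -> : k = (3 / 4) ^+ 6 * ((3 / 4) ^+ 6 * (3 / 4) ^+ 6) by rewrite /k exprS expr2.
  have /andP[b0 _] := bump_bounds cp cq cr h y.
  have q0 : 0 <= (3 / 4) ^+ 6 * (3 / 4) ^+ 6 :> R by exact: mulr_ge0.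
  apply: lerXn2r; [by rewrite nnegrE; exact: mulr_ge0|by rewrite nnegrE|].
  have -> : E = pospow 6 (ev (bump1 (linear_form 1 0 (-1)) cp h) y) *
    (pospow 6 (ev (bump1 (linear_form 1 0 1) cq h) y) *
     pospow 6 (ev (bump1 (linear_form 0 1 0) cr h) y)) by [].
  apply: ler_pM => //.
    by apply: P; rewrite /=; apply/andP; split; lra.
  by apply: ler_pM => //; apply: P; rewrite /=; apply/andP; split; lra.
Qed.

End cells.

(** * One localized wave in a small cell *)

Section cell_wave.
Context {R : realType}.
Local Notation ST := (R * (R * R))%type.
Local Notation D := (@D R).

Definition continuous_field (w : @field R) :=
  [/\ continuous (fv1 w), continuous (fv2 w), continuous (fa w) & continuous (fb w)].

Lemma continuousX3 (f : ST -> R) n : continuous f -> continuous (fun y => f y ^+ n).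
Proof.
move=> cf y; apply: (@continuous_comp _ _ _ f (fun x => x ^+ n)); first exact: cf.
exact: exprn_continuous.
Qed.

Definition vanishes (w : @field R) (y : ST) :=
  [/\ fv1 w y = 0, fv2 w y = 0, fa w y = 0 & fb w y = 0].

Lemma continuous_potential (e : @sexp R) : continuous_field (potential_field e).
Proof. by split; exact: continuous_ev. Qed.

Lemma vanishes_potential (e : @sexp R) y : flat 4 e y -> vanishes (potential_field e) y.
Proof.
move=> fe; split; apply: flat_ev.
- by right; split; do 3 apply: flat_D.
- by split; do 3 apply: flat_D.
- by right; do 3 apply: flat_D.
- by split; [|right]; do 3 apply: flat_D.
Qed.

(** 512 = 16 * 2 * 2 * 2 * 4: the squared amplitude 1/16, Young's inequality, the choice of the
    phase, the share given up to errors, and n >= e^2/4. *)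
Definition wave_gain : R := @bump_mass R / 512.

Lemma wave_gain_gt0 : 0 < wave_gain.
Proof. by apply: divr_gt0; [exact: bump_mass_gt0|rewrite ltr0n]. Qed.

(** As sin^2 and cos^2 add up to 1, one of the phases 0 and pi/2 carries at least half of the mass,
    whatever the frequency. This takes the place of a Riemann-Lebesgue argument. *)
Lemma phase_choice cp cq cr h (x0 x1 x2 N : R) : 0 < h ->
  exists th, bump_mass * h ^+ 3 / 2 <= \int[lebesgue3]_y
    ((ev (bump cp cq cr h) y * sin (ev (phase x0 x1 x2 N th) y)) ^+ 2).
Proof.
move=> h0.
pose f th (y : ST) := (ev (bump cp cq cr h) y * sin (ev (phase x0 x1 x2 N th) y)) ^+ 2.
have cb := @continuous_ev R (bump cp cq cr h).
have fi th : intg (f th).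
  apply: (@integrable_continuous_cell _ _ cp cq cr h); first exact: ltW.
    apply: continuousX3; apply: continuousM3; first exact: cb.
    by move=> y; apply: (@continuous_comp _ _ _ (ev (phase x0 x1 x2 N th)) sin);
      [exact: continuous_ev|exact: continuous_sin].
  move=> y /(flat_bump h0) fb; rewrite /f (@flat_ev R (bump cp cq cr h) y) ?mul0r ?expr0n//.
have E : \int[lebesgue3]_y (ev (bump cp cq cr h) y ^+ 2) =
    \int[lebesgue3]_y f 0 y + \int[lebesgue3]_y f (pi / 2) y.
  rewrite -RintegralD; [|exact: measurableT|exact: fi|exact: fi].
  apply: eq_Rintegral => y _; rewrite /f !exprMn -mulrDr.
  have -> : ev (phase x0 x1 x2 N (pi / 2)) y = ev (phase x0 x1 x2 N 0) y + pi / 2.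
    by rewrite /= addr0.
  by rewrite sinDpihalf addrC cos2Dsin2 mulr1.
have B := bump_integral cp cq cr h0.
rewrite E in B.
have [H|H] := leP (bump_mass * h ^+ 3 / 2) (\int[lebesgue3]_y f 0 y); first by exists 0.
by exists (pi / 2); rewrite -/(f (pi / 2)) ; move: B H; rewrite /f; lra.
Qed.

(** The leading part of the packet keeps the constant state in the hull; the remainder is uniformly
    small. The perturbed state is therefore only within [eps] of hull points, an error to be
    absorbed later by a larger l. *)
Lemma cell_wave cp cq cr h (l v1 v2 a b eps : R) : 0 < h -> 0 <= l <= 2^-1 ->
  in_hull l v1 v2 a b -> 0 < eps ->
  exists w : field,
  [/\ continuous_field w, forall y, ~ cell cp cq cr h y -> vanishes w y, weak_euler w,
      forall y, exists u1 u2 ua ub, [/\ in_hull l u1 u2 ua ub,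
        `|v1 + fv1 w y - u1| <= eps, `|v2 + fv2 w y - u2| <= eps,
        `|a + fa w y - ua| <= eps & `|b + fb w y - ub| <= eps] &
      wave_gain * (l - v1 ^+ 2 - v2 ^+ 2) ^+ 2 * h ^+ 3 <=
        \int[lebesgue3]_y (fv1 w y ^+ 2 + fv2 w y ^+ 2)].
Proof.
move=> h0 l01 hull eps0.
set e := l - v1 ^+ 2 - v2 ^+ 2.
have e0 : 0 <= e by have := in_hull_bound hull; rewrite /e; lra.
(* Without deficit the required gain is zero and the zero field will do. *)
move: e0; rewrite le_eqVlt => /predU1P[e0|e0].
  exists (Field (cst 0) (cst 0) (cst 0) (cst 0)); split => //=.
  - by split => y; exact: cvg_cst.
  - move=> psi d _; split; rewrite -[RHS](@mul0r R (fine (lebesgue3 [set: ST]))) -Rintegral_cst//;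
    by apply: eq_Rintegral => y _ /=; ring.
  - by move=> y; exists v1, v2, a, b; rewrite !addr0 !subrr normr0 ltW.
  - rewrite (_ : wave_gain * _ * _ = 0); last by rewrite -e0; ring.
    by apply: Rintegral_ge0 => y _; rewrite expr0n addr0.
have [m1 [m2 [tau [n0 en H]]]] := in_hull_direction l01 hull e0.
set n := m1 ^+ 2 + m2 ^+ 2 in n0 en H.
pose X := n * bump_mass / 256.
have bm0 := @bump_mass_gt0 R.
have X0 : 0 < X by apply: divr_gt0; [exact: mulr_gt0|rewrite ltr0n].
(* [X] limits the squared errors to 2 X h^3, half of the gain n bump_mass h^3 / 64; the bound by 1
   ensures eps'^2 <= eps'. *)
pose eps' := Num.min eps (Num.min 1 X).
have eps'0 : 0 < eps' by rewrite /eps' !lt_min eps0 ltr01.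
have eps'e : eps' <= eps by rewrite /eps' ge_min lexx.
have eps'X : eps' ^+ 2 <= X.
  have x1 : eps' <= 1 by rewrite /eps' !ge_min lexx orbT.
  have x2 : eps' <= X by rewrite /eps' !ge_min lexx !orbT.
  by rewrite expr2; nra.
pose M := `|cp| + `|cq| + `|cr| + h.
have [N HN] := packet_leading_term (bump cp cq cr h) M tau n0 eps'0.
have [th Hth] := phase_choice cp cq cr tau m2 (- m1) N h0.
pose phi := packet (bump cp cq cr h) m1 m2 tau N th.
have fphi y : ~ cell cp cq cr h y -> flat 6 phi y.
  by move=> /(flat_bump h0) fb; right; left.
have W0 y : ~ cell cp cq cr h y -> vanishes (potential_field phi) y.
  by move=> /fphi fb; apply: vanishes_potential; exact: flat_le fb.
pose f (y : ST) := ev (bump cp cq cr h) y * sin (ev (phase tau m2 (- m1) N th) y).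
have f1 y : `|f y| <= 1.
  have /andP[b0 b1] := bump_bounds cp cq cr h y.
  rewrite /f normrM -[leRHS]mulr1 ler_pM//; first by rewrite ger0_norm.
  by rewrite ler_norml sin_geN1 sin_le1.
have f0 y : ~ cell cp cq cr h y -> f y = 0.
  move=> /(flat_bump h0) fb; rewrite /f (@flat_ev R (bump cp cq cr h) y) ?mul0r//.
exists (potential_field phi); split => //.
- exact: continuous_potential.
- apply: (@weak_euler_potential R M) => [//|y nb].
  have : ~ cell cp cq cr h y by move=> /(cell_box (ltW h0)).
  by move=> /fphi; exact: flat_le.
- move=> y; have Hf := H (f y) (f1 y).
  have shift (x z g : R) : `|z - g| <= eps' -> `|x + z - (x + g)| <= eps.
    by rewrite opprD addrACA subrr add0r => /le_trans; apply.
  do 4 eexists; split; first exact: Hf; apply: shift;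
    case: (EM (cell cp cq cr h y)) => [/(cell_box (ltW h0)) /(HN th) []//|ny];
    have [z1 z2 z3 z4] := W0 _ ny;
    by rewrite ?z1 ?z2 ?z3 ?z4 f0// mul0r subrr normr0 ltW.
pose w := potential_field phi.
have w1 : continuous (fv1 w) by exact: continuous_ev.
have w2 : continuous (fv2 w) by exact: continuous_ev.
have wi : intg (fun y => fv1 w y ^+ 2 + fv2 w y ^+ 2).
  apply: (@integrable_continuous_cell _ _ cp cq cr h); first exact: ltW.
    by apply: continuousD3; exact: continuousX3.
  by move=> y /W0[z1 z2 _ _]; rewrite z1 z2 expr0n addr0.
have fi : intg (fun y => f y ^+ 2).
  apply: (@integrable_continuous_cell _ _ cp cq cr h); first exact: ltW.
    apply: continuousX3; apply: continuousM3; first exact: continuous_ev.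
    by move=> y; apply: (@continuous_comp _ _ _ (ev (phase tau m2 (- m1) N th)) sin);
      [exact: continuous_ev|exact: continuous_sin].
  by move=> y /f0 ->; rewrite expr0n.
pose C := cell cp cq cr h.
have ci : intg (\1_C : ST -> R).
  by apply: integrable_indic3; [exact: measurable_cell|exact/cell_lty/ltW].
have vC : \int[lebesgue3]_y (\1_C : ST -> R) y <= h ^+ 3.
  by rewrite Rintegral_indic3; [exact: cell_volume_le|exact: measurable_cell].
have low : \int[lebesgue3]_y (n / 32 * f y ^+ 2 - 2 * eps' ^+ 2 * (\1_C : ST -> R) y) <=
    \int[lebesgue3]_y (fv1 w y ^+ 2 + fv2 w y ^+ 2).
  apply: le_Rintegral; [exact: measurableT|by apply: intgB; exact: intgZ|exact: wi|].
  move=> y _; rewrite indicE; case: (boolP (y \in C)) => [|/negP yC]; last first.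
    rewrite f0; last by move=> yc; apply: yC; rewrite inE.
    by rewrite expr0n !mulr0 subrr addr_ge0// sqr_ge0.
  rewrite inE => /(cell_box (ltW h0)) /(HN th) [E1 E2 _ _].
  (* Young's inequality: the energy of the wave is at least half of that of its leading part, minus
     the squared error. *)
  have sq (x z : R) : `|x - z| <= eps' -> z ^+ 2 / 2 - eps' ^+ 2 <= x ^+ 2.
    move=> xz; have : (x - z) ^+ 2 <= eps' ^+ 2.
      by rewrite -[leLHS]real_normK ?num_real// lerXn2r ?nnegrE// ltW.
    by have := sqr_ge0 (2 * x - z); nra.
  have := sq _ _ E1; have := sq _ _ E2; rewrite -/(f y) -/phi -/w => S2 S1.
  have -> : n / 32 * f y ^+ 2 = (f y * (m1 / 4)) ^+ 2 / 2 + (f y * (m2 / 4)) ^+ 2 / 2.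
    by rewrite /n; field.
  by rewrite mulr1; lra.
apply: le_trans low.
rewrite RintegralB; [|exact: measurableT|exact: intgZ|exact: intgZ].
rewrite RintegralZl; [|exact: measurableT|exact: fi].
rewrite RintegralZl; [|exact: measurableT|exact: ci].
set I1 := \int[_]_y _ in Hth *; set I2 := \int[_]_y _ in vC *.
have h3 : 0 < h ^+ 3 by exact: exprn_gt0.
have A1 : n / 32 * (bump_mass * h ^+ 3 / 2) <= n / 32 * I1.
  by rewrite ler_wpM2l//; apply: divr_ge0; [exact: ltW|rewrite ler0n].
have A2 : 2 * eps' ^+ 2 * I2 <= 2 * X * h ^+ 3.
  apply: (@le_trans _ _ (2 * eps' ^+ 2 * h ^+ 3)).
    by rewrite ler_wpM2l// mulr_ge0// sqr_ge0.
  by apply: ler_wpM2r; [exact: ltW|lra].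
have A3 : wave_gain * e ^+ 2 * h ^+ 3 <= n * bump_mass * h ^+ 3 / 128.
  have : e ^+ 2 / 4 * (bump_mass * h ^+ 3 / 128) <= n * (bump_mass * h ^+ 3 / 128).
    rewrite ler_wpM2r//; apply: divr_ge0; [by rewrite mulr_ge0// ltW|by rewrite ler0n].
  rewrite /wave_gain; move: (@bump_mass R) (h ^+ 3) => bm hh.
  have -> : n * bm * hh / 128 = n * (bm * hh / 128) by rewrite !mulrA.
  by have -> : bm / 512 * e ^+ 2 * hh = e ^+ 2 / 4 * (bm * hh / 128) by field.
apply: (le_trans A3); move: A1 A2; rewrite /X; lra.
Qed.

End cell_wave.

(** * Convex integration in one cell *)

Section field_tools.
Context {R : realType}.
Local Notation ST := (R * (R * R))%type.

Definition close3 (d : R) (y y' : ST) :=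
  [/\ `|y.1 - y'.1| < d, `|y.2.1 - y'.2.1| < d & `|y.2.2 - y'.2.2| < d].

(** Heine-Cantor, with only the first point confined to the compact box. *)
Lemma uniform_oscillation (f : ST -> R) M eps : continuous f -> 0 < eps ->
  exists2 d, 0 < d & forall y y', box M y -> close3 d y y' -> `|f y - f y'| < eps.
Proof.
move=> cf e0.
pose P d (y : ST) := forall y', close3 d y y' -> `|f y - f y'| < eps.
have H : \forall d \near (0 : R)^'+, box M `<=` P d.
  apply: ((@compact_near_coveringP ST (box M)).1 (@box_compact R M) R _ P).
  move=> x _.
  have /cvgrPdist_lt /(_ (eps / 2)) := cf x.
  move=> /(_ ltac:(lra)) /nbhs_ballP[r /= r0 hr].
  exists (ball x (r / 2), [set d | d < r / 2]) => /=.
    split; first by apply: nbhsx_ballx; lra.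
    by apply: nbhs_right_lt; lra.
  move=> [y d] /= [by_ dr] y' [c1 c2 c3].
  have h1 : `|f x - f y| < eps / 2 by apply: hr; apply: le_ball by_; lra.
  have h2 : `|f x - f y'| < eps / 2.
    apply: hr; have -> : r = r / 2 + r / 2 by field.
    apply: ball_triangle by_ _; split; last split; rewrite -ball_normE /ball_ /=; lra.
  rewrite (_ : f y - f y' = (f x - f y') - (f x - f y)); last by ring.
  by apply: le_lt_trans (ler_normB _ _) _; lra.
near (0 : R)^'+ => d; exists d; first by near: d; exact: nbhs_right_gt.
have Hd : box M `<=` P d by near: d.
by move=> y y' /Hd; apply.
Unshelve. all: by end_near. Qed.

Lemma uniform_oscillation_seq (s : seq (ST -> R)) M eps :
  (forall i, continuous (nth (cst 0) s i)) -> 0 < eps ->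
  exists2 d, 0 < d & forall i y y', box M y -> close3 d y y' ->
    `|nth (cst 0) s i y - nth (cst 0) s i y'| < eps.
Proof.
move=> cs e0; elim: s cs => [|f s IH] cs.
  by exists 1 => // i y y' _ _; rewrite nth_nil subrr normr0.
have [d d0 hd] := IH (fun i => cs i.+1).
have [d' d'0 hd'] := uniform_oscillation M (cs 0%N) e0.
exists (Num.min d d'); first by rewrite lt_min d0.
move=> i y y' By [c1 c2 c3]; move: c1 c2 c3; rewrite !lt_min => /andP[? ?] /andP[? ?] /andP[? ?].
by case: i => [|i]; [exact: hd'|exact: hd].
Qed.

Lemma C1_time : C1 (fun y : ST => y.1) (fun i => cst (axis_eq i At)).
Proof.
split; [exact: continuous_t|by move=> i y; exact: cvg_cst|].
by move=> i; exact: (@pderive_ev R i (Var At)).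
Qed.

(** Test with psi = t. Zero mean is what makes a wave nearly orthogonal to functions that hardly
    vary on its cell. *)
Lemma weak_euler_mean0 (w : @field R) : weak_euler w ->
  \int[lebesgue3]_y fv1 w y = 0 /\ \int[lebesgue3]_y fv2 w y = 0.
Proof.
move=> /(_ _ _ C1_time)[_ h1 h2]; split.
  by rewrite -[RHS]h1; apply: eq_Rintegral => y _ /=; ring.
by rewrite -[RHS]h2; apply: eq_Rintegral => y _ /=; ring.
Qed.

Definition field_add (z w : @field R) : field :=
  Field (fun y => fv1 z y + fv1 w y) (fun y => fv2 z y + fv2 w y)
        (fun y => fa z y + fa w y) (fun y => fb z y + fb w y).

Definition supported_field M (z : @field R) := forall y, ~ box M y -> vanishes z y.

Lemma intg_field_test M z (f g : ST -> R) : supported_field M z -> continuous f ->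
  (forall y, vanishes z y -> f y = 0) -> continuous g -> intg (fun y => f y * g y).
Proof.
move=> sz cf fz cg; apply: (@integrable_continuous_box _ _ M); first exact: continuousM3.
by move=> y /sz /fz ->; rewrite mul0r.
Qed.

Lemma weak_euler_add M z w : continuous_field z -> continuous_field w ->
  supported_field M z -> supported_field M w -> weak_euler z -> weak_euler w ->
  weak_euler (field_add z w).
Proof.
move=> cz cw sz sw Wz Ww psi d Cpsi.
have [_ cd _] := Cpsi.
have iz (f : ST -> R) i : continuous f -> (forall y, vanishes z y -> f y = 0) ->
  intg (fun y => f y * d i y) by move=> cf f0; exact: (intg_field_test sz).
have iw (f : ST -> R) i : continuous f -> (forall y, vanishes w y -> f y = 0) ->
  intg (fun y => f y * d i y) by move=> cf f0; exact: (intg_field_test sw).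
have [Z1 Z2 Z3] := Wz _ _ Cpsi; have [W1 W2 W3] := Ww _ _ Cpsi.
have [z1 z2 za zb] := cz; have [w1 w2 wa wb] := cw.
have vz : forall y, vanishes z y -> [/\ fv1 z y = 0, fv2 z y = 0, fa z y = 0 & fb z y = 0] by [].
have vw : forall y, vanishes w y -> [/\ fv1 w y = 0, fv2 w y = 0, fa w y = 0 & fb w y = 0] by [].
split.
- rewrite -[RHS]addr0 -[X in X + _]Z1 -[X in _ + X]W1 -RintegralD //.
  + by apply: eq_Rintegral => y _ /=; ring.
  + by apply: intgD; apply: iz => // y /vz[].
  + by apply: intgD; apply: iw => // y /vw[].
- rewrite -[RHS]addr0 -[X in X + _]Z2 -[X in _ + X]W2 -RintegralD //.
  + by apply: eq_Rintegral => y _ /=; ring.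
  + by do 2 (apply: intgD; last by apply: iz => // y /vz[]); apply: iz => // y /vz[].
  + by do 2 (apply: intgD; last by apply: iw => // y /vw[]); apply: iw => // y /vw[].
- rewrite -[RHS]addr0 -[X in X + _]Z3 -[X in _ + X]W3 -RintegralD //.
  + by apply: eq_Rintegral => y _ /=; ring.
  + by apply: intgB; [apply: intgD|]; apply: iz => // y /vz[].
  + by apply: intgB; [apply: intgD|]; apply: iw => // y /vw[].
Qed.

Definition field_sum (I : Type) (s : seq I) (w : I -> @field R) (z : @field R) : field :=
  foldr (fun i u => field_add (w i) u) z s.

Lemma field_sumE (I : Type) (s : seq I) (w : I -> @field R) z y :
  [/\ fv1 (field_sum s w z) y = fv1 z y + \sum_(i <- s) fv1 (w i) y,
      fv2 (field_sum s w z) y = fv2 z y + \sum_(i <- s) fv2 (w i) y,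
      fa (field_sum s w z) y = fa z y + \sum_(i <- s) fa (w i) y &
      fb (field_sum s w z) y = fb z y + \sum_(i <- s) fb (w i) y].
Proof.
elim: s => [|i s [h1 h2 h3 h4]] /=; first by rewrite !big_nil !addr0.
by rewrite !big_cons h1 h2 h3 h4; split; ring.
Qed.

Lemma field_sum_weak (I : Type) (s : seq I) (w : I -> @field R) z M :
  continuous_field z -> (forall i, continuous_field (w i)) ->
  supported_field M z -> (forall i, supported_field M (w i)) ->
  weak_euler z -> (forall i, weak_euler (w i)) ->
  [/\ continuous_field (field_sum s w z), supported_field M (field_sum s w z) &
      weak_euler (field_sum s w z)].
Proof.
move=> cz cw sz sw Wz Ww; elim: s => [//|i s [c1 s1 W1]] /=; split.
- have [a1 a2 a3 a4] := cw i; have [b1 b2 b3 b4] := c1.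
  by split; exact: continuousD3.
- move=> y h; have [a1 a2 a3 a4] := sw i y h; have [b1 b2 b3 b4] := s1 y h.
  by split => /=; rewrite ?a1 ?a2 ?a3 ?a4 ?b1 ?b2 ?b3 ?b4 addr0.
- exact: (@weak_euler_add M).
Qed.

End field_tools.

(** * Grids of waves and the gain of energy *)

Section improve.
Context {R : realType}.
Local Notation ST := (R * (R * R))%type.

Definition subsolution (E : set ST) (l : R) (z : @field R) :=
  [/\ continuous_field z, forall y, ~ E y -> vanishes z y,
      forall y, in_hull l (fv1 z y) (fv2 z y) (fa z y) (fb z y) & weak_euler z].

Definition kinetic (z : @field R) : R := \int[lebesgue3]_y (fv1 z y ^+ 2 + fv2 z y ^+ 2).

Definition pairing (g : (ST -> R) * (ST -> R)) (z : @field R) : R :=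
  \int[lebesgue3]_y (g.1 y * fv1 z y + g.2 y * fv2 z y).

Definition volume (E : set ST) : R := fine (lebesgue3 E).

Lemma sum_collapse (I : finType) (F : I -> R) (J : I) :
  (forall i, i != J -> F i = 0) -> \sum_i F i = F J.
Proof. by move=> F0; rewrite (bigD1 J)//= big1 ?addr0. Qed.

(** The difference of the two sides is a variance for the equal weights [t]. *)
Lemma sum_sqr_ge (I : finType) (e : I -> R) (t : R) :
  \sum_(i : I) t = 1 -> (\sum_i e i * t) ^+ 2 <= \sum_i e i ^+ 2 * t.
Proof.
move=> t1; have t0 : 0 <= t.
  rewrite leNgt; apply/negP => tn; have : \sum_(i : I) t <= 0.
    by apply: sumr_le0 => i _; exact: ltW.
  by rewrite t1 ler10.
set S := \sum_i _; rewrite -subr_ge0.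
have -> : \sum_i e i ^+ 2 * t - S ^+ 2 = \sum_i (e i - S) ^+ 2 * t.
  transitivity (\sum_i (e i ^+ 2 * t + (- 2 * S) * (e i * t) + S ^+ 2 * t)).
    rewrite !big_split/= -!mulr_sumr -/S t1; ring.
  by apply: eq_bigr => i _; ring.
by apply: sumr_ge0 => i _; rewrite mulr_ge0// sqr_ge0.
Qed.

Section grid.
Variables (cp cq cr : R) (n : nat).
Hypothesis n0 : (0 < n)%N.
Let h : R := n%:R^-1.
Let T := ('I_n * 'I_n * 'I_n)%type.

Definition grid_cell (J : T) : set ST :=
  cell (cp + J.1.1%:R * n%:R^-1) (cq + J.1.2%:R * n%:R^-1) (cr + J.2%:R * n%:R^-1) n%:R^-1.

(** The vertex at which t - x2, t + x2 and x1 are all minimal, expressed in the original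
    coordinates. *)
Definition grid_point (J : T) : ST :=
  let p := cp + J.1.1%:R * n%:R^-1 in let q := cq + J.1.2%:R * n%:R^-1 in
  ((p + q) / 2, (cr + J.2%:R * n%:R^-1, (q - p) / 2)).

Let h0 : 0 < h. Proof. by rewrite invr_gt0 ltr0n. Qed.

Lemma grid_point_cell J : grid_cell J (grid_point J).
Proof. by split => /=; apply/andP; split; move: h0; rewrite /h; lra. Qed.

Lemma grid_close J y : grid_cell J y -> close3 (2 * n%:R^-1) (grid_point J) y.
Proof.
move=> [/andP[p1 p2] /andP[q1 q2] /andP[r1 r2]]; move: h0; rewrite /h => hh.
by split => /=; rewrite ltr_norml; apply/andP; split; lra.
Qed.

Lemma slot_unique (c x : R) (i j : 'I_n) :
  c + i%:R * n%:R^-1 <= x < c + i%:R * n%:R^-1 + n%:R^-1 ->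
  c + j%:R * n%:R^-1 <= x < c + j%:R * n%:R^-1 + n%:R^-1 -> i = j.
Proof.
move=> /andP[i1 i2] /andP[j1 j2].
have lt (k l : nat) : c + k%:R * h < c + l%:R * h + h -> (k <= l)%N.
  rewrite -addrA ltrD2l -{3}[h]mul1r -mulrDl ltr_pM2r// natr1 ltr_nat ltnS.
  by [].
by apply/val_inj/eqP; rewrite eqn_leq; apply/andP; split; apply: lt; rewrite /h; lra.
Qed.

Lemma slot_exists (c x : R) : c <= x < c + 1 ->
  exists i : 'I_n, c + i%:R * n%:R^-1 <= x < c + i%:R * n%:R^-1 + n%:R^-1.
Proof.
move=> /andP[x1 x2].
pose k := Num.truncn ((x - c) * n%:R).
have nR : 0 < n%:R :> R by rewrite ltr0n.
have xn0 : 0 <= (x - c) * n%:R by rewrite mulr_ge0// ?subr_ge0// ltW.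
have /andP[k1 k2] := truncn_itv xn0.
have kn : (k < n)%N.
  rewrite -(ltr_nat R); apply: le_lt_trans k1 _.
  by rewrite -[ltRHS]mul1r ltr_pM2r//; lra.
exists (Ordinal kn) => /=; rewrite -/k.
have E : x = c + ((x - c) * n%:R) / n%:R by rewrite mulfK ?gt_eqF//; ring.
apply/andP; split; rewrite {1}E.
  by rewrite lerD2l ler_pM2r// invr_gt0.
rewrite -addrA ltrD2l (_ : _ + n%:R^-1 = k.+1%:R * n%:R^-1).
  by rewrite ltr_pM2r ?invr_gt0.
by rewrite -natr1 mulrDl mul1r.
Qed.

Lemma grid_unique J J' y : grid_cell J y -> grid_cell J' y -> J = J'.
Proof.
move: J J' => [[i j] k] [[i' j'] k'] [/= p q r] [/= p' q' r'].
by rewrite (slot_unique p p') (slot_unique q q') (slot_unique r r').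
Qed.

Lemma grid_cover y : cell cp cq cr 1 y -> exists J, grid_cell J y.
Proof.
move=> [/slot_exists[i hi] /slot_exists[j hj] /slot_exists[k hk]].
by exists (i, j, k).
Qed.

Lemma grid_sub J : grid_cell J `<=` cell cp cq cr 1.
Proof.
have le (i : 'I_n) : i%:R * h + h <= 1.
  rewrite -{2}[h]mul1r -mulrDl natr1 ler_pdivrMr ?ltr0n// mul1r ler_nat.
  exact: ltn_ord.
have ge (i : 'I_n) : 0 <= i%:R * h by rewrite mulr_ge0// ltW.
move=> y [/andP[p1 p2] /andP[q1 q2] /andP[r1 r2]].
have := le J.1.1; have := le J.1.2; have := le J.2.
have := ge J.1.1; have := ge J.1.2; have := ge J.2.
by rewrite /h => *; split; apply/andP; split; lra.
Qed.

(** The bounds h^3 on the volumes of the subcells add up to 1, so they can be used as averaging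
    weights. *)
Lemma grid_volume : \sum_(J : T) n%:R^-1 ^+ 3 = 1 :> R.
Proof.
rewrite sumr_const (_ : #|_| = (n * n * n)%N); last by rewrite !card_prod !card_ord.
rewrite -[LHS]mulr_natr !natrM -/h.
have : h * n%:R = 1 by rewrite mulVf// pnatr_eq0 -lt0n.
by move=> E; transitivity ((h * n%:R) ^+ 3); [ring|rewrite E expr1n].
Qed.

End grid.

Lemma cell_supported (cp cq cr h : R) z : 0 <= h -> (forall y, ~ cell cp cq cr h y -> vanishes z y) ->
  supported_field (`|cp| + `|cq| + `|cr| + h) z.
Proof. by move=> h0 sz y nb; apply: sz => /(cell_box h0). Qed.

Lemma field_intg2 M z (f g : ST -> R) : continuous_field z -> supported_field M z ->
  continuous f -> continuous g -> intg (fun y => f y * fv1 z y + g y * fv2 z y).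
Proof.
move=> [z1 z2 _ _] sz cf cg; apply: (@integrable_continuous_box _ _ M).
  by apply: continuousD3; exact: continuousM3.
by move=> y /sz[-> -> _ _]; rewrite !mulr0 addr0.
Qed.

Lemma kinetic_intg M (z : @field R) : continuous_field z -> supported_field M z ->
  intg (fun y => fv1 z y ^+ 2 + fv2 z y ^+ 2).
Proof.
move=> cz sz; have [z1 z2 _ _] := cz.
have -> : (fun y => fv1 z y ^+ 2 + fv2 z y ^+ 2) = (fun y => fv1 z y * fv1 z y + fv2 z y * fv2 z y).
  by apply/funext => y; rewrite !expr2.
exact: (@field_intg2 M).
Qed.

(** Since [w] has zero mean, [g] may be replaced by its deviation from its value at [c]; 6 = 3 + 3
    collects the two components of [w]. *)
Lemma pairing_grid_bound (cp cq cr h : R) g c eta w : 0 < h ->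
  continuous g.1 -> continuous g.2 -> 0 <= eta ->
  continuous_field w -> (forall y, ~ cell cp cq cr h y -> vanishes w y) -> weak_euler w ->
  (forall y, cell cp cq cr h y -> [/\ `|g.1 y - g.1 c| <= eta, `|g.2 y - g.2 c| <= eta,
     `|fv1 w y| <= 3 & `|fv2 w y| <= 3]) ->
  `|pairing g w| <= 6 * eta * h ^+ 3.
Proof.
move=> h0 cg1 cg2 eta0 cw sw Ww bnd.
have [m1 m2] := weak_euler_mean0 Ww.
have sM := cell_supported (ltW h0) sw.
have cst_c (a : R) : continuous (fun _ : ST => a) by move=> y; exact: cvg_cst.
have iw (f g : ST -> R) := @field_intg2 _ w f g cw sM.
have -> : pairing g w = \int[lebesgue3]_y ((g.1 y - g.1 c) * fv1 w y + (g.2 y - g.2 c) * fv2 w y).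
  have Z : \int[lebesgue3]_y (g.1 c * fv1 w y + g.2 c * fv2 w y) = 0.
    have i1 : intg (fv1 w).
      have := iw (cst 1) (cst 0) (cst_c 1) (cst_c 0).
      by congr intg; apply/funext => y /=; ring.
    have i2 : intg (fv2 w).
      have := iw (cst 0) (cst 1) (cst_c 0) (cst_c 1).
      by congr intg; apply/funext => y /=; ring.
    rewrite RintegralD; [|exact: measurableT|exact: intgZ|exact: intgZ].
    rewrite RintegralZl; [|exact: measurableT|exact: i1].
    rewrite RintegralZl; [|exact: measurableT|exact: i2].
    by rewrite m1 m2 !mulr0 addr0.
  rewrite -[LHS]subr0 -[X in _ - X]Z /pairing -RintegralB; first last.
  - exact: iw.
  - exact: iw.
  - exact: measurableT.
  by apply: eq_Rintegral => y _; ring.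
have iC : intg (\1_(cell cp cq cr h) : ST -> R).
  by apply: integrable_indic3; [exact: measurable_cell|exact/cell_lty/ltW].
have cB (f : ST -> R) (a : R) : continuous f -> continuous (fun y => f y - a).
  by move=> cf y; apply: cvgB; [exact: cf|exact: cvg_cst].
have iF := iw _ _ (cB _ (g.1 c) cg1) (cB _ (g.2 c) cg2).
apply: le_trans (le_normr_Rintegral measurableT iF) _.
apply: (@le_trans _ _ (\int[lebesgue3]_y (6 * eta * (\1_(cell cp cq cr h) : ST -> R) y))).
  apply: le_Rintegral; [exact: measurableT|exact: integrable_norm|exact: intgZ|].
  move=> y _; rewrite indicE; case: (boolP (y \in cell cp cq cr h)) => [|/negP yC]; last first.
    have /sw[-> -> _ _] : ~ cell cp cq cr h y by move=> yc; apply: yC; rewrite inE.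
    by rewrite !mulr0 addr0 normr0.
  rewrite inE => /bnd[b1 b2 b3 b4]; rewrite mulr1; apply: (le_trans (ler_normD _ _)).
  have := ler_pM (normr_ge0 _) (normr_ge0 _) b1 b3.
  have := ler_pM (normr_ge0 _) (normr_ge0 _) b2 b4.
  by rewrite !normrM; lra.
rewrite RintegralZl; [|exact: measurableT|exact: iC].
rewrite ler_wpM2l ?mulr_ge0// Rintegral_indic3; [exact: cell_volume_le|exact: measurable_cell].
Qed.

End improve.

Section improve_step.
Context {R : realType}.
Local Notation ST := (R * (R * R))%type.

Definition continuous_pair_fun (g : (ST -> R) * (ST -> R)) := continuous g.1 /\ continuous g.2.

Lemma volume_cell1 cp cq cr : 0 <= volume (cell cp cq cr (1 : R)) <= 1.
Proof.
rewrite /volume fine_ge0 ?measure_ge0//=.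
by have := cell_volume_le cp cq cr (@ltr01 R); rewrite expr1n.
Qed.

Lemma subsolution_supported (cp cq cr l : R) z : subsolution (cell cp cq cr 1) l z ->
  supported_field (`|cp| + `|cq| + `|cr| + 1) z.
Proof. by move=> [_ sz _ _]; apply: cell_supported sz; exact: ler01. Qed.

Lemma indic_intg (cp cq cr h : R) : 0 <= h -> intg (\1_(cell cp cq cr h) : ST -> R).
Proof. by move=> h0; apply: integrable_indic3; [exact: measurable_cell|exact: cell_lty]. Qed.

Lemma deficitE (cp cq cr l : R) z : subsolution (cell cp cq cr 1) l z ->
  l * volume (cell cp cq cr 1) - kinetic z =
  \int[lebesgue3]_y (l * (\1_(cell cp cq cr 1) : ST -> R) y - (fv1 z y ^+ 2 + fv2 z y ^+ 2)).
Proof.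
move=> sub; have [cz _ _ _] := sub.
have i1 := indic_intg cp cq cr (@ler01 R).
rewrite RintegralB; [|exact: measurableT|exact: intgZ|exact: kinetic_intg cz (subsolution_supported sub)].
rewrite RintegralZl; [|exact: measurableT|exact: i1].
by rewrite Rintegral_indic3//; exact: measurable_cell.
Qed.

Lemma deficit_ge0 (cp cq cr l : R) z : subsolution (cell cp cq cr 1) l z ->
  0 <= l * volume (cell cp cq cr 1) - kinetic z.
Proof.
move=> sub; rewrite (deficitE sub); apply: Rintegral_ge0 => y _; rewrite indicE.
have [_ sz hz _] := sub.
case: (boolP (y \in _)) => [_|/negP yC].
  by rewrite mulr1 subr_ge0; exact: in_hull_bound (hz y).
have [-> -> _ _] : vanishes z y by apply: sz => yc; apply: yC; rewrite inE.
by rewrite expr0n mulr0 addr0 subrr.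
Qed.

Lemma wave_gain_le1 : wave_gain <= 1 :> R.
Proof.
rewrite /wave_gain ler_pdivrMr ?ltr0n// mul1r.
apply: (@le_trans _ _ 1); last by rewrite ler1n.
rewrite /bump_mass ler_pdivrMr ?ltr0n// mul1r.
apply: (@le_trans _ _ 1); last by rewrite ler1n.
by do 3 apply: exprn_ile1 => //; rewrite ?exprn_ge0//; lra.
Qed.

Lemma hull_coord_le1 (l v1 v2 a b : R) : l <= 2^-1 -> in_hull l v1 v2 a b ->
  `|v1| <= 1 /\ `|v2| <= 1.
Proof.
move=> l1 /in_hull_bound hb; have s1 := sqr_ge0 v1; have s2 := sqr_ge0 v2.
by split; rewrite ler_norml; apply/andP; split; nra.
Qed.

(** Each subcell of a fine grid receives a wave made for the value of [z] at its grid point. Having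
    zero mean, the waves pair weakly with the slowly varying [z], [g] and [g'], so the energy rises
    essentially by their own energies, at least [wave_gain] times a sum of squared deficits. By
    Cauchy-Schwarz this dominates the square of the total deficit up to O(eta). *)
Lemma improve (cp cq cr l l' : R) z g g' eps :
  let E := cell cp cq cr 1 in
  0 <= l -> l < l' -> l' <= 2^-1 -> subsolution E l z ->
  continuous_pair_fun g -> continuous_pair_fun g' -> 0 < eps ->
  exists z', [/\ subsolution E l' z',
    kinetic z + wave_gain * (l * volume E - kinetic z) ^+ 2 - eps <= kinetic z',
    `|pairing g z' - pairing g z| <= eps & `|pairing g' z' - pairing g' z| <= eps].
Proof.
move=> E l0 ll l1 sub [cg1 cg2] [cg1' cg2'] eps0.
have [cz sz hz Wz] := sub; have [cz1 cz2 cza czb] := cz.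
pose M := `|cp| + `|cq| + `|cr| + 1.
have sM : supported_field M z by exact: subsolution_supported sub.
(* The energy estimate loses 12 eta + 8 eta, at most half of [eps]. The hull is perturbed by 2 eta,
   at a price of 80 eta in l. The bound 1/4 keeps the components of the waves below 3. *)
pose eta := Num.min (eps / 40) (Num.min ((l' - l) / 80) (1 / 4)).
have eta0 : 0 < eta by rewrite /eta !lt_min; apply/and3P; split; lra.
have eta1 : eta <= eps / 40 by rewrite /eta ge_min lexx.
have eta2 : eta <= (l' - l) / 80 by rewrite /eta !ge_min lexx orbT.
have eta3 : eta <= 1 / 4 by rewrite /eta !ge_min lexx !orbT.
(* All functions that must hardly vary on a subcell. Positions 0, 4 and 6 start the pairs ([fv1 z],
   [fv2 z]), [g] and [g']. *)
pose fs := [:: fv1 z; fv2 z; fa z; fb z; g.1; g.2; g'.1; g'.2].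
have cfs i : continuous (nth (cst 0) fs i).
  by do 8 (case: i => [//|i]); rewrite /= nth_nil => y; exact: cvg_cst.
have [d d0 osc] := uniform_oscillation_seq M cfs eta0.
pose n := (Num.truncn (2 / d)).+1.
have n0 : (0 < n)%N by [].
have nd : 2 * n%:R^-1 < d.
  have nR : 0 < n%:R :> R by rewrite ltr0n.
  rewrite ltr_pdivrMr// mulrC -ltr_pdivrMr//.
  by have /andP[] := truncn_itv (ltW (divr_gt0 (ltr0n R 2) d0)).
pose h : R := n%:R^-1.
have h0 : 0 < h by rewrite invr_gt0 ltr0n.
have h30 : 0 <= h ^+ 3 by rewrite exprn_ge0// ltW.
pose T : finType := ('I_n * 'I_n * 'I_n)%type.
pose C (J : T) : set ST := grid_cell cp cq cr J.
pose c (J : T) : ST := grid_point cp cq cr J.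
have cE J : E (c J) by apply: (@grid_sub _ cp cq cr n n0 J); exact: grid_point_cell.
have near_c i J y : C J y -> `|nth (cst 0) fs i (c J) - nth (cst 0) fs i y| < eta.
  move=> /(grid_close n0)[c1 c2 c3]; apply: osc.
    by apply: cell_box (cE J); exact: ler01.
  by split; [exact: lt_trans c1 nd|exact: lt_trans c2 nd|exact: lt_trans c3 nd].
have l01 : 0 <= l <= 2^-1 by rewrite l0; apply: le_trans l1; exact: ltW.
have /choice[w Hw] : forall J : T, exists w : field,
  [/\ continuous_field w, forall y, ~ C J y -> vanishes w y, weak_euler w,
      forall y, exists u1 u2 ua ub, [/\ in_hull l u1 u2 ua ub,
        `|fv1 z (c J) + fv1 w y - u1| <= eta, `|fv2 z (c J) + fv2 w y - u2| <= eta,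
        `|fa z (c J) + fa w y - ua| <= eta & `|fb z (c J) + fb w y - ub| <= eta] &
      wave_gain * (l - fv1 z (c J) ^+ 2 - fv2 z (c J) ^+ 2) ^+ 2 * h ^+ 3 <= kinetic w].
  by move=> J; exact: cell_wave (hz (c J)) eta0.
have cw J : continuous_field (w J) by have [] := Hw J.
have sw J y : ~ C J y -> vanishes (w J) y by have [_ + _ _ _] := Hw J; exact.
have Ww J : weak_euler (w J) by have [] := Hw J.
have swM J : supported_field M (w J).
  move=> y nb; apply: sw => /(grid_sub n0) Ey; apply: nb; exact: (cell_box ler01 Ey).
pose z' := field_sum (index_enum T) w z.
have zE y := field_sumE (index_enum T) w z y.
have [cz' sz' Wz'] := field_sum_weak (index_enum T) cz cw sM swM Wz Ww.
have big_enumT (F : T -> R) : \sum_(i <- index_enum T) F i = \sum_i F i by [].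
have inC J y : C J y -> [/\ fv1 z' y = fv1 z y + fv1 (w J) y, fv2 z' y = fv2 z y + fv2 (w J) y,
    fa z' y = fa z y + fa (w J) y & fb z' y = fb z y + fb (w J) y].
  move=> Cy; have out i : i != J -> vanishes (w i) y.
    by move=> iJ; apply: sw => Ci; move: iJ; rewrite (grid_unique n0 Ci Cy) eqxx.
  have [-> -> -> ->] := zE y; rewrite !big_enumT.
  by split; congr (_ + _); apply: sum_collapse => i /out[].
have outC y : (forall J, ~ C J y) -> [/\ fv1 z' y = fv1 z y, fv2 z' y = fv2 z y,
    fa z' y = fa z y & fb z' y = fb z y].
  move=> nC; have [-> -> -> ->] := zE y; rewrite !big_enumT.
  by split; rewrite big1 ?addr0// => i _; have [] := sw i y (nC i).
have w3 J y : C J y -> `|fv1 (w J) y| <= 3 /\ `|fv2 (w J) y| <= 3.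
  move=> Cy; have [_ _ _ /(_ y)[u1 [u2 [ua [ub [hu b1 b2 _ _]]]]] _] := Hw J.
  have l2 : l <= 2^-1 by case/andP: l01.
  have [x1 x2] := hull_coord_le1 l2 hu; have [x3 x4] := hull_coord_le1 l2 (hz (c J)).
  have tri (x v u : R) : `|x + v - u| <= eta -> `|u| <= 1 -> `|x| <= 1 -> `|v| <= 3.
    rewrite !ler_norml => /andP[A1 A2] /andP[B1 B2] /andP[C1 C2].
    by apply/andP; split; move: A1 A2 B1 B2 C1 C2 eta3; clear; lra.
  by split; [exact: tri b1 x1 x3|exact: tri b2 x2 x4].
have pair_small k (f : (ST -> R) * (ST -> R)) : continuous f.1 -> continuous f.2 ->
    f.1 = nth (cst 0) fs k -> f.2 = nth (cst 0) fs k.+1 ->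
    forall J, `|pairing f (w J)| <= 6 * eta * h ^+ 3.
  move=> cf1 cf2 E1 E2 J; apply: (@pairing_grid_bound _ _ _ _ h f (c J) eta (w J) h0 cf1 cf2 (ltW
    eta0) (cw J) (sw J) (Ww J)).
  move=> y Cy; have [a1 a2] := w3 J y Cy; split => //.
    by rewrite distrC E1; apply: ltW; exact: near_c.
  by rewrite distrC E2; apply: ltW; exact: near_c.
have sumh : \sum_(J : T) h ^+ 3 = 1 by exact: grid_volume.
have pairE (f : (ST -> R) * (ST -> R)) : continuous f.1 -> continuous f.2 ->
    pairing f z' - pairing f z = \sum_J pairing f (w J).
  move=> cf1 cf2.
  have iz := field_intg2 cz sM cf1 cf2.
  have iz' := field_intg2 cz' sz' cf1 cf2.
  have iw J := field_intg2 (cw J) (swM J) cf1 cf2.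
  rewrite /pairing -RintegralB; [|exact: measurableT|exact: iz'|exact: iz].
  rewrite -big_enumT -Rintegral_sum3; last exact: iw.
  apply: eq_Rintegral => y _; have [-> -> _ _] := zE y.
  by rewrite !big_split/= -!mulr_sumr; ring.
have pair_bound k (f : (ST -> R) * (ST -> R)) : continuous f.1 -> continuous f.2 ->
    f.1 = nth (cst 0) fs k -> f.2 = nth (cst 0) fs k.+1 ->
    `|pairing f z' - pairing f z| <= eps.
  move=> cf1 cf2 E1 E2; rewrite pairE//; apply: le_trans (ler_norm_sum _ _ _) _.
  apply: (@le_trans _ _ (\sum_(J : T) 6 * eta * h ^+ 3)).
    by apply: ler_sum => J _; exact: (pair_small k).
  by rewrite -mulr_sumr sumh; move: eta1; clear -eps0; lra.
exists z'; split; last 2 first.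
- exact: (pair_bound 4%N).
- exact: (pair_bound 6%N).
- split => //.
  + move=> y nE; have [|o1 o2 o3 o4] := outC y; first by move=> J /(grid_sub n0).
    by rewrite /vanishes o1 o2 o3 o4; exact: sz.
  + move=> y; have [[J Cy]|nC] := EM (exists J, C J y); last first.
      have [|-> -> -> ->] := outC y; first by move=> J Cy; apply: nC; exists J.
      by apply: in_hull_le (hz y); exact: ltW.
    have [-> -> -> ->] := inC _ _ Cy.
    have [_ _ _ /(_ y)[u1 [u2 [ua [ub [hu b1 b2 b3 b4]]]]] _] := Hw J.
    have tri (x x' v u : R) : `|x' - x| < eta -> `|x' + v - u| <= eta -> `|x + v - u| <= 2 * eta.
      rewrite ltr_norml !ler_norml => /andP[A1 A2] /andP[B1 B2].
      by apply/andP; split; move: A1 A2 B1 B2; clear; lra.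
    apply: (@in_hull_perturb _ l l' (2 * eta) u1 u2 ua ub) => //.
    * by rewrite l0; move: ll l1; clear; lra.
    * by apply/andP; split; move: eta0 eta3; clear; lra.
    * by move: eta2; clear; lra.
    * exact: tri (near_c 0%N J y Cy) b1.
    * exact: tri (near_c 1%N J y Cy) b2.
    * exact: tri (near_c 2%N J y Cy) b3.
    * exact: tri (near_c 3%N J y Cy) b4.
pose e J := l - fv1 z (c J) ^+ 2 - fv2 z (c J) ^+ 2.
have e0 J : 0 <= e J by have := in_hull_bound (hz (c J)); rewrite /e; clear; lra.
pose S := \sum_J e J * h ^+ 3.
have S0 : 0 <= S by apply: sumr_ge0 => J _; rewrite mulr_ge0.
have S1 : S <= 2^-1.
  apply: (@le_trans _ _ (\sum_(J : T) 2^-1 * h ^+ 3)); last by rewrite -mulr_sumr sumh mulr1.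
  apply: ler_sum => J _; rewrite ler_wpM2r//.
  have := sqr_ge0 (fv1 z (c J)); have := sqr_ge0 (fv2 z (c J)); rewrite /e.
  by move: ll l1; clear; lra.
have gain : kinetic z + wave_gain * S ^+ 2 - 12 * eta <= kinetic z'.
  (* Expanding the square: waves in different subcells have disjoint supports, so only cross terms
     with [z] appear. *)
  have kE : kinetic z' = kinetic z + \sum_J (2 * pairing (fv1 z, fv2 z) (w J) + kinetic (w J)).
    have iz := kinetic_intg cz sM.
    have iw J := kinetic_intg (cw J) (swM J).
    have ip J : intg (fun y => fv1 z y * fv1 (w J) y + fv2 z y * fv2 (w J) y) :=
      field_intg2 (cw J) (swM J) cz1 cz2.
    have igJ J : intg (fun y => 2 * (fv1 z y * fv1 (w J) y + fv2 z y * fv2 (w J) y) +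
        (fv1 (w J) y ^+ 2 + fv2 (w J) y ^+ 2)) by apply: intgD => //; exact: intgZ.
    transitivity (kinetic z + \sum_J \int[lebesgue3]_y (2 * (fv1 z y * fv1 (w J) y + fv2 z y * fv2 (w J) y) +
        (fv1 (w J) y ^+ 2 + fv2 (w J) y ^+ 2))); last first.
      congr (_ + _); apply: eq_bigr => J _.
      rewrite RintegralD; [|exact: measurableT|by apply: intgZ; exact: ip|exact: iw].
      by rewrite RintegralZl; [|exact: measurableT|exact: ip].
    rewrite -big_enumT -Rintegral_sum3; last exact: igJ.
    rewrite /kinetic -RintegralD; [|exact: measurableT|exact: iz|exact: intg_sum].
    apply: eq_Rintegral => y _; rewrite big_enumT.
    have [[J Cy]|nC] := EM (exists J, C J y); last first.
      have [|-> -> _ _] := outC y; first by move=> J Cy; apply: nC; exists J.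
      rewrite big1 ?addr0// => J _.
      have [-> -> _ _] : vanishes (w J) y by apply: sw => Cy; apply: nC; exists J.
      by rewrite !mulr0 expr0n !addr0 mulr0.
    have [-> -> _ _] := inC _ _ Cy.
    rewrite (sum_collapse (J := J)); first by ring.
    move=> i iJ; have [-> -> _ _] : vanishes (w i) y.
      by apply: sw => Ci; move: iJ; rewrite (grid_unique n0 Ci Cy) eqxx.
    by rewrite !mulr0 expr0n !addr0 mulr0.
  rewrite kE -addrA lerD2l.
  (* Cauchy-Schwarz turns the sum of local gains into a function of the total deficit alone. *)
  have CS : wave_gain * S ^+ 2 <= \sum_J wave_gain * e J ^+ 2 * h ^+ 3.
    under eq_bigr do rewrite -mulrA; rewrite -mulr_sumr ler_wpM2l ?(ltW (@wave_gain_gt0 R))//.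
    exact: sum_sqr_ge.
  have E12 : 12 * eta = \sum_(J : T) 12 * eta * h ^+ 3 by rewrite -mulr_sumr sumh mulr1.
  rewrite E12; apply: (le_trans (lerD CS (lexx _))); rewrite -sumrB; apply: ler_sum => J _.
  have [_ _ _ _ kw] := Hw J.
  have := pair_small 0%N (fv1 z, fv2 z) cz1 cz2 erefl erefl J.
  by rewrite ler_norml => /andP[+ _]; move: kw; rewrite -/(e J); clear; lra.
(* Over a subcell each squared component of [z] changes by at most 2 eta, and h^3 is at least the
   volume of the subcell. *)
have def : l * volume E - kinetic z <= S + 4 * eta.
  rewrite (deficitE sub).
  have iC J : intg (\1_(C J) : ST -> R) by apply: indic_intg; exact: ltW.
  have iR : intg (fun y => \sum_(J <- index_enum T) (e J + 4 * eta) * (\1_(C J) : ST -> R) y).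
    by apply: intg_sum => J; exact: intgZ.
  apply: (@le_trans _ _ (\int[lebesgue3]_y \sum_(J <- index_enum T) (e J + 4 * eta) * (\1_(C J) : ST -> R) y)).
    apply: le_Rintegral; [exact: measurableT| |exact: iR|].
      by apply: intgB; [apply: intgZ; apply: indic_intg; exact: ler01|exact: kinetic_intg cz sM].
    move=> y _; rewrite big_enumT.
    have pos J : 0 <= (e J + 4 * eta) * (\1_(C J) : ST -> R) y.
      by rewrite mulr_ge0// addr_ge0// mulr_ge0// ltW.
    have [Ey|nE] := EM (E y); last first.
      have [-> -> _ _] := sz y nE.
      rewrite indicE (_ : y \in _ = false); last by apply/negbTE/negP; rewrite inE.
      by rewrite expr0n mulr0 addr0 subrr sumr_ge0.
    have [J CJ] := grid_cover n0 Ey.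
    apply: (@le_trans _ _ ((e J + 4 * eta) * (\1_(C J) : ST -> R) y)); last first.
      by rewrite (bigD1 J)//= lerDl sumr_ge0.
    rewrite !indicE !mem_set// !mulr1 /e.
    have sq k : `|nth (cst 0) fs k (c J)| <= 1 -> `|nth (cst 0) fs k y| <= 1 ->
        (nth (cst 0) fs k (c J)) ^+ 2 - 2 * eta <= (nth (cst 0) fs k y) ^+ 2.
      have := near_c k J y CJ; move: (nth _ _ _ _) (nth _ _ _ _) => x x'.
      rewrite ltr_norml !ler_norml => /andP[? ?] /andP[? ?] /andP[? ?].
      have [P|P] := leP 0 (x' + x); nra.
    have l2 : l <= 2^-1 by case/andP: l01.
    have [x1 x2] := hull_coord_le1 l2 (hz (c J)); have [x3 x4] := hull_coord_le1 l2 (hz y).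
    have S1' : fv1 z (c J) ^+ 2 - 2 * eta <= fv1 z y ^+ 2 := sq 0%N x1 x3.
    have S2' : fv2 z (c J) ^+ 2 - 2 * eta <= fv2 z y ^+ 2 := sq 1%N x2 x4.
    by move: S1' S2'; clear; lra.
  rewrite Rintegral_sum3; last by move=> J; exact: intgZ.
  rewrite big_enumT; apply: (@le_trans _ _ (\sum_(J : T) (e J + 4 * eta) * h ^+ 3)).
    apply: ler_sum => J _.
    rewrite RintegralZl; [|exact: measurableT|exact: iC].
    rewrite ler_wpM2l//; first by rewrite addr_ge0// mulr_ge0// ltW.
    by rewrite Rintegral_indic3; [exact: cell_volume_le|exact: measurable_cell].
  under eq_bigr do rewrite mulrDl.
  by rewrite big_split/= -mulr_sumr sumh mulr1.
have D0 := deficit_ge0 sub; rewrite -/E in D0.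
set Df := l * volume E - kinetic z in def D0 *.
have D2 : Df ^+ 2 <= S ^+ 2 + 8 * eta.
  have : Df ^+ 2 <= (S + 4 * eta) ^+ 2 by rewrite lerXn2r ?nnegrE//; lra.
  by move=> /le_trans; apply; move: S0 S1 eta0 eta3; clear; nra.
have G1 := wave_gain_le1; have G0 := @wave_gain_gt0 R.
have : wave_gain * Df ^+ 2 <= wave_gain * S ^+ 2 + 8 * eta.
  apply: (@le_trans _ _ (wave_gain * (S ^+ 2 + 8 * eta))); first by rewrite ler_wpM2l// ltW.
  rewrite mulrDr lerD2l -[leRHS]mul1r ler_wpM2r//; move: eta0; clear; lra.
by move: gain eta1 eta0; clear; lra.
Qed.

End improve_step.

(** * Iterating the gain until the deficit is small *)

Section saturate.
Context {R : realType}.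
Local Notation ST := (R * (R * R))%type.

Lemma subsolution_le (E : set ST) l l' (z : @field R) : l <= l' -> subsolution E l z ->
  subsolution E l' z.
Proof. by move=> ll [h1 h2 h3 h4]; split => // y; exact: in_hull_le (h3 y). Qed.

Lemma kinetic_le1 (cp cq cr l : R) z : 0 <= l <= 2^-1 ->
  subsolution (cell cp cq cr 1) l z -> kinetic z <= 2^-1 * volume (cell cp cq cr 1).
Proof.
move=> /andP[l0 l1] /deficit_ge0; have /andP[v0 v1] := volume_cell1 cp cq cr.
have : l * volume (cell cp cq cr 1) <= 2^-1 * volume (cell cp cq cr 1) by rewrite ler_wpM2r.
lra.
Qed.

(** While the deficit exceeds [delta], each improvement raises the energy by a fixed amount [gam].
    The energy never exceeds 1/2 and N gam > 1, so the deficit drops below [delta] within N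
    improvements. *)
Lemma saturate (cp cq cr l l' : R) z g g' delta :
  let E := cell cp cq cr 1 in
  0 <= l -> l < l' -> l' <= 2^-1 -> subsolution E l z ->
  continuous_pair_fun g -> continuous_pair_fun g' -> 0 < delta ->
  exists z', [/\ subsolution E l' z', l * volume E - kinetic z' <= delta,
    `|pairing g z' - pairing g z| <= delta & `|pairing g' z' - pairing g' z| <= delta].
Proof.
move=> E l0 ll l1 sub cg cg' d0.
have wg0 := @wave_gain_gt0 R.
have /andP[v0 v1] := volume_cell1 cp cq cr; rewrite -/E in v0 v1.
(* Half of the guaranteed gain; the other half covers the error [eps] of one improvement. *)
pose gam := wave_gain * delta ^+ 2 / 2.
have gam0 : 0 < gam by rewrite divr_gt0// mulr_gt0// exprn_gt0.
pose N := (Num.truncn gam^-1).+1.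
have N0 : 0 < N%:R :> R by rewrite ltr0n.
have Ngam : 1 < N%:R * gam.
  rewrite -ltr_pdivrMr// mul1r.
  have gi0 : 0 <= gam^-1 by rewrite invr_ge0 ltW.
  by have /andP[] := truncn_itv gi0.
pose eps := Num.min gam (delta / N%:R).
have eps0 : 0 < eps by rewrite lt_min gam0 divr_gt0.
have epsg : eps <= gam by rewrite /eps ge_min lexx.
have epsN : N%:R * eps <= delta.
  rewrite mulrC -ler_pdivlMr//; by rewrite /eps ge_min lexx orbT.
pose lv (i : nat) := l + (l' - l) * (i%:R / N%:R).
have lv_lt i : lv i < lv i.+1.
  by rewrite /lv ltrD2l ltr_pM2l ?subr_gt0// ltr_pM2r ?invr_gt0// ltr_nat.
have lv_ge i : l <= lv i.
  by rewrite /lv lerDl mulr_ge0 ?subr_ge0 ?divr_ge0//; exact: ltW.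
have lv_N : lv N = l' by rewrite /lv divff ?gt_eqF//; ring.
have lv_le i : (i <= N)%N -> lv i <= l'.
  move=> iN; rewrite -lv_N /lv lerD2l; apply: ler_wpM2l.
    by rewrite subr_ge0; exact: ltW.
  by apply: ler_wpM2r; [rewrite invr_ge0; exact: ltW|rewrite ler_nat].
(* The target l is fixed, whereas the level of the subsolution moves up in N equal parts from l to
   l'. Once the first alternative holds the field is kept unchanged. *)
have claim i : (i <= N)%N -> exists z', [/\ subsolution E (lv i) z',
    l * volume E - kinetic z' <= delta \/ i%:R * gam <= kinetic z',
    `|pairing g z' - pairing g z| <= i%:R * eps & `|pairing g' z' - pairing g' z| <= i%:R * eps].
  elim: i => [_|i IH iN].
    exists z; rewrite !subrr normr0 !mul0r lexx; split => //.
      by apply: subsolution_le sub; exact: lv_ge.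
    by right; apply: Rintegral_ge0 => y _; rewrite addr_ge0// sqr_ge0.
  have [z1 [s1 k1 p1 p1']] := IH (ltnW iN).
  have step (x y w : R) : `|y - x| <= i%:R * eps -> `|w - y| <= eps -> `|w - x| <= i.+1%:R * eps.
    move=> h1 h2; rewrite (_ : w - x = (w - y) + (y - x)); last by ring.
    by apply: le_trans (ler_normD _ _) _; rewrite -natr1 mulrDl mul1r addrC lerD.
  have [D|D] := leP (l * volume E - kinetic z1) delta.
    exists z1; split; [by apply: subsolution_le s1; exact: ltW|by left| |].
    - by apply: step p1 _; rewrite subrr normr0 ltW.
    - by apply: step p1' _; rewrite subrr normr0 ltW.
  case: k1 => k1; first by move: D; rewrite ltNge k1.
  have lvi0 : 0 <= lv i by exact: le_trans (lv_ge i).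
  have [z2 [s2 k2 p2 p2']] := improve lvi0 (lv_lt i) (le_trans (lv_le _ iN) l1) s1 cg cg' eps0.
  exists z2; split => //; [right|exact: step p1 p2|exact: step p1' p2'].
  have Dv : delta <= lv i * volume E - kinetic z1.
    by have := ler_wpM2r v0 (lv_ge i); move: D; clear; lra.
  have D2 : delta ^+ 2 <= (lv i * volume E - kinetic z1) ^+ 2.
    apply: lerXn2r; rewrite ?nnegrE; [exact: ltW| |exact: Dv].
    by apply: le_trans Dv; exact: ltW.
  have -> : i.+1%:R * gam = i%:R * gam + gam by rewrite -natr1; ring.
  have := ler_wpM2l (ltW wg0) D2.
  by move: k2 k1 epsg; rewrite /gam -/E; clear; lra.
have [z' [s' [k'|k'] p p']] := claim N (leqnn N).
  by exists z'; rewrite -lv_N; split => //; apply: le_trans epsN.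
have l'01 : 0 <= l' <= 2^-1 by rewrite l1 andbT; apply: le_trans l0 _; exact: ltW.
rewrite lv_N in s'; have := kinetic_le1 l'01 s'.
by rewrite -/E; move: k' Ngam v1; clear; lra.
Qed.

(* Strictly increasing levels: the room between two of them absorbs the error
   terms of the waves. *)
Definition level (k : nat) : R := 2^-1 - 16^-1 ^+ k.+1.

Lemma level_bounds k : [/\ 0 <= level k, level k < level k.+1 & level k <= 2^-1].
Proof.
have q0 : 0 < 16^-1 ^+ k.+1 :> R by rewrite exprn_gt0// invr_gt0 ltr0n.
have q1 : 16^-1 ^+ k.+1 <= 16^-1 :> R.
  rewrite exprS ler_piMr ?invr_ge0 ?ler0n// exprn_ile1 ?invr_ge0 ?ler0n//.
  by rewrite invf_le1 ?ltr0n// ler1n.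
have q2 : 16^-1 ^+ k.+2 = 16^-1 * 16^-1 ^+ k.+1 :> R by rewrite exprS.
by rewrite /level q2; split; move: q0 q1; clear; lra.
Qed.

(* The last estimate makes consecutive increments almost orthogonal, so that the
   growth of the kinetic energy controls their L^2 norms. *)
Lemma saturating_sequence (cp cq cr : R) z0 g eps :
  let E := cell cp cq cr 1 in
  subsolution E (level 0) z0 -> continuous_pair_fun g -> 0 < eps ->
  exists z : nat -> field, [/\ z 0%N = z0, forall k, subsolution E (level k) (z k),
    forall k, level k * volume E - kinetic (z k.+1) <= 16^-1 ^+ k.+1,
    forall k, `|pairing g (z k.+1) - pairing g (z k)| <= eps * 16^-1 ^+ k.+1 &
    forall k, `|pairing (fv1 (z k), fv2 (z k)) (z k.+1) - kinetic (z k)| <= 16^-1 ^+ k.+1].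
Proof.
move=> E sub0 cg eps0.
(* The step number travels with the field, so that a single relation for dependent choice can
   prescribe tolerances depending on it. *)
pose X := {kz : nat * @field R | subsolution E (level kz.1) kz.2}.
pose rel (x y : X) := let k := (sval x).1 in let z := (sval x).2 in let z' := (sval y).2 in
  [/\ (sval y).1 = k.+1, level k * volume E - kinetic z' <= 16^-1 ^+ k.+1,
    `|pairing g z' - pairing g z| <= eps * 16^-1 ^+ k.+1 &
    `|pairing (fv1 z, fv2 z) z' - kinetic z| <= 16^-1 ^+ k.+1].
have next x : {y | rel x y}.
  apply: cid; case: x => -[k z] /= sz.
  have [l0 ll _] := level_bounds k; have [_ _ l1] := level_bounds k.+1.
  pose q : R := 16^-1 ^+ k.+1.
  have q0 : 0 < q by rewrite exprn_gt0// invr_gt0 ltr0n.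
  have d0 : 0 < Num.min q (eps * q) by rewrite lt_min q0 mulr_gt0.
  have [[cz1 cz2 _ _] _ _ _] := sz.
  (* The second functional is the velocity of [z] itself, whose value at [z] is [kinetic z]. *)
  have [z' [s' d' p p']] := saturate l0 ll l1 sz cg (conj cz1 cz2 : continuous_pair_fun (fv1 z, fv2 z)) d0.
  exists (exist _ (k.+1, z') s'); split => //=.
  - by apply: le_trans d' _; rewrite ge_min lexx.
  - by apply: le_trans p _; rewrite ge_min lexx orbT.
  - apply: le_trans (_ : _ <= Num.min q (eps * q)) _; last by rewrite ge_min lexx.
    suff -> : kinetic z = pairing (fv1 z, fv2 z) z by exact: p'.
    by apply: eq_Rintegral => y _; rewrite !expr2.
have [f [f0 fS]] := dependent_choice next (exist _ (0%N, z0) sub0).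
have fk k : (sval (f k)).1 = k.
  by elim: k => [|k IH]; [rewrite f0|have [-> _ _ _] := fS k; rewrite IH].
exists (fun k => (sval (f k)).2); split.
- by rewrite f0.
- by move=> k; have := svalP (f k); rewrite fk.
- by move=> k; have [_ + _ _] := fS k; rewrite fk.
- by move=> k; have [_ _ + _] := fS k; rewrite fk.
- by move=> k; have [_ _ _ +] := fS k; rewrite fk.
Qed.

End saturate.

(** * Convergence almost everywhere and dominated convergence *)

Section limit.
Context {R : realType}.
Local Notation ST := (R * (R * R))%type.

Lemma geometric_increments_cvg (x : nat -> R) A :
  (forall k, `|x k.+1 - x k| <= A * 2^-1 ^+ k) -> cvgn x.
Proof.
move=> hx.
have A0 : 0 <= A by have := le_trans (normr_ge0 _) (hx 0%N); rewrite expr0 mulr1.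
have cs : cvgn (series (telescope x)).
  apply: normed_cvg; apply: (@series_le_cvg _ _ (geometric A 2^-1)).
  - by move=> n; exact: normr_ge0.
  - by move=> n; rewrite /geometric /= mulr_ge0// exprn_ge0// invr_ge0.
  - by move=> n; exact: (hx n).
  - apply: is_cvg_geometric_series; rewrite ger0_norm ?invr_ge0//.
    by rewrite invf_lt1// ltr1n.
have -> : x = fun n => x 0%N + series (telescope x) n.
  by apply/funext => n; rewrite -eq_sum_telescope.
by apply: is_cvgD => //; exact: is_cvg_cst.
Qed.

(** By monotone convergence the sum of the [F k] is integrable, hence finite off a null set, and
    there it bounds every term. With a weight 4^k inside [F k] this yields pointwise geometric
    rates. *)
Lemma ae_bounded_sequence (F : nat -> ST -> R) :
  (forall k y, 0 <= F k y) -> (forall k, intg (F k)) ->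
  (forall k, \int[lebesgue3]_y F k y <= 2^-1 ^+ k) ->
  exists N : set ST, [/\ measurable N, lebesgue3 N = 0%E &
    forall y, ~ N y -> exists S, forall k, F k y <= S].
Proof.
move=> F0 Fi Fle.
pose G (y : ST) := (\sum_(0 <= k <oo) (F k y)%:E)%E.
have mF k : measurable_fun [set: ST] (fun y => (F k y)%:E) by exact: measurable_int (Fi k).
have mG : measurable_fun [set: ST] G.
  by apply: ge0_emeasurable_sum => // k y _ _; rewrite lee_fin.
have G0 y : (0 <= G y)%E by apply: nneseries_ge0 => k _ _; rewrite lee_fin.
have iG : lebesgue3.-integrable [set: ST] G.
  apply/integrableP; split => //.
  under eq_integral do rewrite gee0_abs//.
  rewrite (integral_nneseries lebesgue3 measurableT); last 2 first.
  - exact: mF.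
  - by move=> k y _; rewrite lee_fin.
  apply: (@le_lt_trans _ _ 2%:E); last by rewrite ltry.
  apply: (le_trans _ (epsilon_trick0 xpredT (ler0n R 2))).
  apply: lee_nneseries => k _; first by move=> _; apply: integral_ge0 => y _; rewrite lee_fin.
  have -> : (\int[lebesgue3]_y (F k y)%:E = (\int[lebesgue3]_y F k y)%:E)%E.
    rewrite /Rintegral fineK; first by [].
    exact: (integrable_fin_num measurableT (Fi k)).
  rewrite lee_fin; apply: le_trans (Fle k) _.
  by rewrite natrX exprS invfM mulrA divff// mul1r exprVn.
have [N [mN N0 sN]] := integrable_ae measurableT iG.
exists N; split => // y Ny.
have fy : G y \is a fin_num by apply: contrapT => h; apply: Ny; apply: sN => /(_ I).
exists (fine (G y)) => k; rewrite -lee_fin fineK//.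
have P0 n : (0 <= n)%N -> xpredT n -> (0%R <= (F n y)%:E)%E by rewrite lee_fin.
apply: (le_trans _ (nneseries_lim_ge k.+1 P0)).
rewrite big_nat_recr//= leeDr// sume_ge0// => i _; by rewrite lee_fin.
Qed.

Lemma dominated_Rintegral d (T : measurableType d) (m : {measure set T -> \bar R})
  (N : set T) (f_ : nat -> T -> R) (f h : T -> R) :
  measurable N -> m N = 0%E -> (forall k, measurable_fun setT (f_ k)) -> measurable_fun setT f ->
  (forall y, ~ N y -> f_ k y @[k --> \oo] --> f y) ->
  m.-integrable setT (EFin \o h) -> (forall k y, `|f_ k y| <= h y) ->
  \int[m]_y f_ k y @[k --> \oo] --> \int[m]_y f y.
Proof.
move=> mN N0 mf_ mf cf ih bf.
have cE : {ae m, forall y, setT y -> (fun k => (f_ k y)%:E) @ \oo --> (f y)%:E}.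
  exists N; split => // y /= hy; apply: contrapT => Ny; apply: hy => _.
  by apply: cvg_EFin; [exact: nearW|exact: cf].
have bE : {ae m, forall y k, setT y -> (`|(f_ k y)%:E| <= (h y)%:E)%E}.
  by apply: aeW => y k _ /=; rewrite lee_fin; exact: bf.
have mfE k : measurable_fun setT (fun y => (f_ k y)%:E) by exact/measurable_EFinP.
have mfE' : measurable_fun setT (fun y => (f y)%:E) by exact/measurable_EFinP.
have [i1 _ H] := @dominated_convergence _ _ R m setT measurableT
  (fun k y => (f_ k y)%:E) (fun y => (f y)%:E) (fun y => (h y)%:E) mfE mfE' cE ih bE.
apply: fine_cvg => /=.
rewrite /Rintegral fineK; first exact: H.
exact: (integrable_fin_num measurableT i1).
Qed.

End limit.

(** * Passing to the limit in a cell *)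

Section exact.
Context {R : realType}.
Local Notation ST := (R * (R * R))%type.

(** The extreme case l = 1/2 of the hull: a nonnegative matrix of trace zero vanishes, which forces
    u = v (x) v - 1/4 I. The identities hold at every point of the cell. *)
Definition exact_field (E : set ST) (w : @field R) :=
  [/\ measurable_fun [set: ST] (fv1 w), measurable_fun [set: ST] (fv2 w),
      forall y, ~ E y -> vanishes w y,
      forall y, E y -> [/\ fv1 w y ^+ 2 + fv2 w y ^+ 2 = 2^-1,
        fa w y = fv1 w y ^+ 2 - 4^-1 & fb w y = fv1 w y * fv2 w y] & weak_euler w].

Lemma cvg0_geometric_bound (r : nat -> R) S : (forall k, `|r k| <= S * 4^-1 ^+ k) ->
  r k @[k --> \oo] --> 0.
Proof.
move=> hr.
have q1 : `|4^-1| < 1 :> R by rewrite ger0_norm ?invr_ge0// invf_lt1// ltr1n.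
have g0 := @cvg_geometric R S _ q1.
apply: (@squeeze_cvgr _ _ _ _ (fun k => - geometric S 4^-1 k) (geometric S 4^-1)) => //.
  by apply: nearW => k; rewrite /geometric /= -ler_norml.
by rewrite -oppr0; apply: cvgN.
Qed.

Lemma cvg_geometric_close (x y : nat -> R) (S l : R) : (forall k, `|x k - y k| <= S * 4^-1 ^+ k) ->
  y k @[k --> \oo] --> l -> x k @[k --> \oo] --> l.
Proof.
move=> /cvg0_geometric_bound xy yl.
rewrite -[l]add0r (_ : x = fun k => (x k - y k) + y k); first exact: cvgD.
by apply/funext => k; rewrite subrK.
Qed.

(** The entries of a nonnegative matrix are bounded by its trace. The deficit thus controls the
    distance of u from v (x) v - 1/4 I, and the stress converges along with the velocity. *)
Lemma hull_stress_bounds (l v1 v2 a b : R) : l <= 2^-1 -> in_hull l v1 v2 a b ->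
  [/\ `|a - (v1 ^+ 2 - 4^-1)| <= 2^-1 - (v1 ^+ 2 + v2 ^+ 2),
      `|b - v1 * v2| <= 2^-1 - (v1 ^+ 2 + v2 ^+ 2), `|a| <= 1 & `|b| <= 1].
Proof.
move=> l1 /(in_hull_le l1) hu.
have [p0 r0] := in_hull_diag hu; have det := in_hull_det hu.
have s1 := sqr_ge0 v1; have s2 := sqr_ge0 v2.
have h1 : `|b - v1 * v2| <= 2^-1 - (v1 ^+ 2 + v2 ^+ 2).
  rewrite -ler_sqr ?nnegrE ?normr_ge0; [|by []|lra].
  rewrite real_normK ?num_real//; apply: le_trans det _.
  set p := _ + a in p0 *; set r := _ - a in r0 *.
  have -> : 2^-1 - (v1 ^+ 2 + v2 ^+ 2) = p + r by rewrite /p /r; field.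
  by rewrite sqrrD; have := sqr_ge0 p; have := sqr_ge0 r; have := mulr_ge0 p0 r0; clear; lra.
have h2 : `|v1 * v2| <= 4^-1.
  have := sqr_ge0 (v1 - v2); have := sqr_ge0 (v1 + v2).
  by rewrite ler_norml sqrrD sqrrB => *; apply/andP; split; lra.
split => //.
- by rewrite ler_norml; apply/andP; split; lra.
- by rewrite ler_norml; apply/andP; split; lra.
- by move: h1 h2; rewrite !ler_norml => /andP[? ?] /andP[? ?]; apply/andP; split; lra.
Qed.

(** Deficits and squared increments are of order 16^-k in L^1; off a null set they are O(4^-k).
    There the velocities converge, their speed saturates and the stress follows. The weak system is
    linear in (v, u), so dominated convergence carries it to the limit. *)
Lemma exact_cell (cp cq cr : R) z0 g eps :
  let E := cell cp cq cr 1 in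
  subsolution E (level 0) z0 -> continuous_pair_fun g -> 0 < eps ->
  exists w, exact_field E w /\ `|pairing g w - pairing g z0| <= eps.
Proof.
move=> E sub0 cg eps0.
have [z [z00 zs zk zg zv]] := saturating_sequence sub0 cg eps0.
have /andP[v0 v1] := volume_cell1 cp cq cr; rewrite -/E in v0 v1.
pose M := `|cp| + `|cq| + `|cr| + 1.
have mE : measurable (E : set ST) by exact: measurable_cell.
have fE : (lebesgue3 E < +oo)%E by apply: cell_lty; exact: ler01.
have EM : E `<=` box M by apply: cell_box; exact: ler01.
have iE := integrable_indic3 mE fE.
(* A shift by one, since the estimate on the deficit starts at [z 1]. *)
pose u k := z k.+1.
have us k : subsolution E (level k.+1) (u k) by exact: zs.
have uc k : continuous_field (u k) by have [] := us k.
have uo k y : ~ E y -> vanishes (u k) y by have [_ + _ _] := us k; exact.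
have uM k : supported_field M (u k) by exact: subsolution_supported (us k).
have l2 k : level k <= 2^-1 :> R by have [] := @level_bounds R k.
have uh k y : in_hull (level k.+1) (fv1 (u k) y) (fv2 (u k) y) (fa (u k) y) (fb (u k) y).
  by have [_ _ + _] := us k; exact.
pose Dk k (y : ST) := 2^-1 * (\1_E : ST -> R) y - (fv1 (u k) y ^+ 2 + fv2 (u k) y ^+ 2).
pose dv k (y : ST) := (fv1 (u k.+1) y - fv1 (u k) y) ^+ 2 + (fv2 (u k.+1) y - fv2 (u k) y) ^+ 2.
have D0 k y : 0 <= Dk k y.
  have [Ey|nE] := pselect (E y).
    rewrite /Dk indicE mem_set// mulr1 subr_ge0.
    by apply: le_trans (in_hull_bound (uh k y)) _; exact: l2.
  have [z1 z2 _ _] := uo k y nE.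
  rewrite /Dk z1 z2 expr0n addr0 subr0 mulr_ge0 ?invr_ge0//.
have dv0 k y : 0 <= dv k y by rewrite addr_ge0// sqr_ge0.
have iD k : intg (Dk k) by apply: intgB; [exact: intgZ|exact: kinetic_intg (uc k) (uM k)].
have ip k := field_intg2 (uc k.+1) (uM k.+1) (let: And4 a b _ _ := uc k in a) (let: And4 a b _ _ := uc k in b).
have dvE k : dv k = fun y => (fv1 (u k.+1) y ^+ 2 + fv2 (u k.+1) y ^+ 2) +
    (fv1 (u k) y ^+ 2 + fv2 (u k) y ^+ 2) -
    2 * (fv1 (u k) y * fv1 (u k.+1) y + fv2 (u k) y * fv2 (u k.+1) y).
  by apply/funext => y; rewrite /dv; ring.
have idv k : intg (dv k).
  rewrite dvE; apply: intgB; [apply: intgD; exact: kinetic_intg (uc _) (uM _)|exact: intgZ].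
pose q k : R := 16^-1 ^+ k.+1.
have q0 k : 0 < q k by rewrite exprn_gt0// invr_gt0 ltr0n.
have qS k : q k.+1 = 16^-1 * q k by rewrite /q exprS.
have kin_le k : kinetic (u k) <= 2^-1 * volume E.
  have [a _ c] := @level_bounds R k.+1.
  by apply: kinetic_le1 (us k); rewrite a c.
have ID k : \int[lebesgue3]_y Dk k y <= 2 * q k.
  rewrite RintegralB; [|exact: measurableT|exact: intgZ|exact: kinetic_intg (uc k) (uM k)].
  rewrite RintegralZl; [|exact: measurableT|exact: iE].
  rewrite Rintegral_indic3// -/(kinetic (u k)) -/(volume E).
  have : (2^-1 - level k) * volume E <= q k.
    by rewrite /level opprB addrCA subrr addr0 -[leRHS]mulr1 ler_wpM2l// ltW.
  by have := zk k; rewrite -/E -/(u k) -/(q k); clear; lra.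
(* In |x - y|^2 = |x|^2 + |y|^2 - 2 <x, y> the pairing is nearly the older energy. What remains is
   the growth of the energy, at most the deficit 2 q k, plus 2 q k.+1. *)
have Idv k : \int[lebesgue3]_y dv k y <= 4 * q k.
  rewrite dvE RintegralB; [|exact: measurableT| |by apply: intgZ; exact: ip]; last first.
    by apply: intgD; exact: kinetic_intg (uc _) (uM _).
  rewrite RintegralD; [|exact: measurableT|exact: kinetic_intg (uc _) (uM _)|exact: kinetic_intg (uc _) (uM _)].
  rewrite RintegralZl; [|exact: measurableT|exact: ip].
  rewrite -/(kinetic (u k)) -/(kinetic (u k.+1)) -/(pairing (fv1 (u k), fv2 (u k)) (u k.+1)).
  have := zv k.+1; rewrite -/(u k) -/(u k.+1) -/(q k.+1) qS ler_norml => /andP[h1 _].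
  have h2 := kin_le k.+1.
  have h3 : 2^-1 * volume E - kinetic (u k) <= 2 * q k.
    apply: le_trans (ID k).
    rewrite [leRHS]RintegralB; [|exact: measurableT|exact: intgZ|exact: kinetic_intg (uc k) (uM k)].
    rewrite RintegralZl; [|exact: measurableT|exact: iE].
    by rewrite Rintegral_indic3.
  by move: h1 h2 h3 (q0 k); clear; lra.
(* The weight 4^k splits the decay 16^-k: one factor 4^-k secures summability, the other becomes the
   pointwise rate. *)
pose F k (y : ST) := 4 ^+ k * (Dk k y + dv k y).
have F0 k y : 0 <= F k y by rewrite mulr_ge0 ?exprn_ge0// addr_ge0.
have iF k : intg (F k) by apply: intgZ; exact: intgD.
have IF k : \int[lebesgue3]_y F k y <= 2^-1 ^+ k.
  rewrite RintegralZl; [|exact: measurableT|exact: intgD].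
  rewrite RintegralD; [|exact: measurableT|exact: iD|exact: idv].
  apply: (@le_trans _ _ (4 ^+ k * (6 * q k))).
    rewrite ler_wpM2l ?exprn_ge0//; have := ID k; have := Idv k; clear; lra.
  have -> : 4 ^+ k * (6 * q k) = 6 / 16 * 4^-1 ^+ k.
    have E4 : 4 ^+ k * 4^-1 ^+ k = 1 :> R by rewrite -exprMn mulfV ?expr1n// pnatr_eq0.
    have -> : q k = 16^-1 * (4^-1 ^+ k * 4^-1 ^+ k).
      rewrite /q exprS; congr (_ * _); rewrite -exprMn; congr (_ ^+ _).
      by field.
    transitivity (6 / 16 * 4^-1 ^+ k * (4 ^+ k * 4^-1 ^+ k) : R); first by ring.
    by rewrite E4 mulr1.
  apply: (@le_trans _ _ (1 * 4^-1 ^+ k)).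
    rewrite ler_wpM2r ?exprn_ge0 ?invr_ge0//; lra.
  rewrite mul1r lerXn2r ?nnegrE ?invr_ge0//; lra.
have [N [mN N0 bN]] := ae_bounded_sequence F0 iF IF.
have pt y : ~ N y -> exists2 S, 0 <= S & forall k, Dk k y <= S * 4^-1 ^+ k /\
    (`|fv1 (u k.+1) y - fv1 (u k) y| <= (1 + S) * 2^-1 ^+ k /\
     `|fv2 (u k.+1) y - fv2 (u k) y| <= (1 + S) * 2^-1 ^+ k).
  move=> /bN[S hS]; have S0 : 0 <= S by apply: le_trans (hS 0%N); exact: F0.
  exists S => // k.
  have h4 : Dk k y + dv k y <= S * 4^-1 ^+ k.
    by rewrite exprVn ler_pdivlMr ?exprn_gt0// mulrC; exact: hS.
  (* Here S <= (1 + S)^2 replaces taking the square root of S. *)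
  have sq (x : R) : x ^+ 2 <= S * 4^-1 ^+ k -> `|x| <= (1 + S) * 2^-1 ^+ k.
    move=> hx; rewrite -ler_sqr ?nnegrE ?normr_ge0//; last first.
      by rewrite mulr_ge0 ?addr_ge0// exprn_ge0// invr_ge0.
    rewrite real_normK ?num_real// exprMn -exprM mulnC exprM.
    have -> : 2^-1 ^+ 2 = 4^-1 :> R by field.
    apply: le_trans hx _; rewrite ler_wpM2r ?exprn_ge0 ?invr_ge0//.
    by rewrite sqrrD; have := sqr_ge0 S; move: S0; clear; lra.
  split; first by have := dv0 k y; move: h4; clear; lra.
  have := D0 k y; have := sqr_ge0 (fv1 (u k.+1) y - fv1 (u k) y).
  have := sqr_ge0 (fv2 (u k.+1) y - fv2 (u k) y); move: h4; rewrite /dv => *.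
  by split; apply: sq; lra.
(* On the null set a constant vector of the right speed is used inside the cell, so that the
   identities hold there as well. *)
pose w1 y : R := if `[< N y >] then (if `[< E y >] then Num.sqrt 2^-1 else 0)
  else limn (fun k => fv1 (u k) y).
pose w2 y : R := if `[< N y >] then 0 else limn (fun k => fv2 (u k) y).
have c1 y : ~ N y -> fv1 (u k) y @[k --> \oo] --> w1 y.
  move=> Ny; rewrite /w1 asboolF//; have [S _ hS] := pt y Ny.
  by apply: (@geometric_increments_cvg _ _ (1 + S)) => k; have [_ []] := hS k.
have c2 y : ~ N y -> fv2 (u k) y @[k --> \oo] --> w2 y.
  move=> Ny; rewrite /w2 asboolF//; have [S _ hS] := pt y Ny.
  by apply: (@geometric_increments_cvg _ _ (1 + S)) => k; have [_ []] := hS k.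
have mu1 k : measurable_fun [set: ST] (fv1 (u k)) by apply: continuous_measurable3; have [] := uc k.
have mu2 k : measurable_fun [set: ST] (fv2 (u k)) by apply: continuous_measurable3; have [] := uc k.
have mi (A : set ST) : measurable A -> measurable_fun [set: ST] (\1_A : ST -> R).
  by move=> mA; exact: measurable_indic.
have mNC : measurable (~` N) by exact: measurableC.
have mw1 : measurable_fun [set: ST] w1.
  apply: (@measurable_fun_cvg _ _ _ setT (fun k y => fv1 (u k) y * (\1_(~` N) : ST -> R) y +
      Num.sqrt 2^-1 * (\1_(E `&` N) : ST -> R) y)).
    move=> k; apply: measurable_funD; apply: measurable_funM.
    - exact: mu1.
    - exact: mi.
    - exact: measurable_cst.
    - by apply: mi; exact: measurableI.
  move=> y _; have [Ny|Ny] := pselect (N y).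
    rewrite (_ : (fun k => _) = fun k => w1 y); first exact: cvg_cst.
    apply/funext => k; rewrite /w1 asboolT// !indicE (_ : y \in ~` N = false) ?mulr0 ?add0r; last first.
      by apply/negbTE/negP; rewrite inE => /(_ Ny).
    case: asboolP => Ey; first by rewrite mem_set// mulr1.
    by rewrite memNset ?mulr0// => -[].
  rewrite (_ : (fun k => _) = fun k => fv1 (u k) y); first exact: c1.
  apply/funext => k; rewrite !indicE mem_set// memNset ?mulr0 ?addr0 ?mulr1//.
  by move=> -[].
have mw2 : measurable_fun [set: ST] w2.
  apply: (@measurable_fun_cvg _ _ _ setT (fun k y => fv2 (u k) y * (\1_(~` N) : ST -> R) y)).
    by move=> k; apply: measurable_funM; [exact: mu2|exact: mi].
  move=> y _; have [Ny|Ny] := pselect (N y).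
    rewrite (_ : (fun k => _) = fun k => w2 y); first exact: cvg_cst.
    apply/funext => k; rewrite /w2 asboolT// !indicE (_ : y \in ~` N = false) ?mulr0//.
    by apply/negbTE/negP; rewrite inE => /(_ Ny).
  rewrite (_ : (fun k => _) = fun k => fv2 (u k) y); first exact: c2.
  by apply/funext => k; rewrite !indicE mem_set// mulr1.
pose w := Field w1 w2 (fun y => w1 y ^+ 2 - 4^-1 * (\1_E : ST -> R) y) (fun y => w1 y * w2 y).
have wout y : ~ E y -> vanishes w y.
  move=> nE; have w10 : w1 y = 0.
    rewrite /w1 (asboolF nE); case: ifP => // _.
    rewrite (_ : (fun k => _) = fun k => 0); first exact: lim_cst.
    by apply/funext => k; have [] := uo k y nE.
  have w20 : w2 y = 0.
    rewrite /w2; case: ifP => // _.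
    rewrite (_ : (fun k => _) = fun k => 0); first exact: lim_cst.
    by apply/funext => k; have [] := uo k y nE.
  by split; rewrite /w /= ?w10 ?w20 ?mul0r// indicE memNset// mulr0 subr0 expr0n.
have win y : E y -> w1 y ^+ 2 + w2 y ^+ 2 = 2^-1.
  move=> Ey; have [Ny|Ny] := pselect (N y).
    by rewrite /w1 /w2 !asboolT// expr0n addr0 sqr_sqrtr// invr_ge0.
  have [S _ hS] := pt y Ny.
  have cD : Dk k y @[k --> \oo] --> 2^-1 * (\1_E : ST -> R) y - (w1 y ^+ 2 + w2 y ^+ 2).
    apply: cvgB; first exact: cvg_cst.
    by rewrite !expr2; apply: cvgD; under eq_fun do rewrite expr2; apply: cvgM;
      [exact: c1|exact: c1|exact: c2|exact: c2].
  have cD0 : Dk k y @[k --> \oo] --> 0.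
    by apply: (@cvg0_geometric_bound _ S) => k; rewrite ger0_norm//; have [] := hS k.
  have E0 : 2^-1 * (\1_E : ST -> R) y - (w1 y ^+ 2 + w2 y ^+ 2) = 0 by exact: cvg_unique cD cD0.
  by apply/esym/eqP; rewrite -subr_eq0 -E0 indicE mem_set// mulr1.
have cab y : ~ N y -> (fa (u k) y @[k --> \oo] --> fa w y) /\ (fb (u k) y @[k --> \oo] --> fb w y).
  move=> Ny; have [Ey|nE] := pselect (E y); last first.
    have [_ _ -> ->] := wout y nE.
    by split; rewrite (_ : (fun k => _) = fun k => 0) ?[cvg_to _ _](@cvg_cst R)//; try exact: cvg_cst;
      apply/funext => k; have [] := uo k y nE.
  have [S _ hS] := pt y Ny.
  have DE k : Dk k y = 2^-1 - (fv1 (u k) y ^+ 2 + fv2 (u k) y ^+ 2).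
    by rewrite /Dk indicE mem_set// mulr1.
  split.
  - apply: (@cvg_geometric_close _ (fun k => fv1 (u k) y ^+ 2 - 4^-1) S) => [k|].
      have [+ _ _ _] := hull_stress_bounds (l2 k.+1) (uh k y).
      by move=> /le_trans; apply; rewrite -DE; have [] := hS k.
    rewrite /= indicE mem_set// mulr1; apply: cvgB; last exact: cvg_cst.
    by rewrite expr2; under eq_fun do rewrite expr2; apply: cvgM; exact: c1.
  - apply: (@cvg_geometric_close _ (fun k => fv1 (u k) y * fv2 (u k) y) S) => [k|].
      have [_ + _ _] := hull_stress_bounds (l2 k.+1) (uh k y).
      by move=> /le_trans; apply; rewrite -DE; have [] := hS k.
    by apply: cvgM; [exact: c1|exact: c2].
have mwa : measurable_fun [set: ST] (fa w).
  apply: measurable_funB; first exact: measurable_funX.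
  by apply: measurable_funM; [exact: measurable_cst|exact: mi].
have mwb : measurable_fun [set: ST] (fb w) by exact: measurable_funM.
have bounds k y : [/\ `|fv1 (u k) y| <= 1, `|fv2 (u k) y| <= 1, `|fa (u k) y| <= 1 & `|fb (u k) y| <= 1].
  have [b1 b2] := hull_coord_le1 (l2 k.+1) (uh k y).
  by have [_ _ b3 b4] := hull_stress_bounds (l2 k.+1) (uh k y).
(* Three products cover every equation of the system and also the pairing; shorter integrands are
   padded with a zero coefficient. *)
have pass (f1 f2 f3 : nat -> ST -> R) (e1 e2 e3 d1 d2 d3 : ST -> R) :
    (forall k, measurable_fun [set: ST] (f1 k)) -> (forall k, measurable_fun [set: ST] (f2 k)) ->
    (forall k, measurable_fun [set: ST] (f3 k)) ->
    measurable_fun [set: ST] e1 -> measurable_fun [set: ST] e2 -> measurable_fun [set: ST] e3 ->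
    continuous d1 -> continuous d2 -> continuous d3 ->
    (forall k y, `|f1 k y| <= 1 /\ (~ E y -> f1 k y = 0)) ->
    (forall k y, `|f2 k y| <= 1 /\ (~ E y -> f2 k y = 0)) ->
    (forall k y, `|f3 k y| <= 1 /\ (~ E y -> f3 k y = 0)) ->
    (forall y, ~ N y -> f1 k y @[k --> \oo] --> e1 y) ->
    (forall y, ~ N y -> f2 k y @[k --> \oo] --> e2 y) ->
    (forall y, ~ N y -> f3 k y @[k --> \oo] --> e3 y) ->
    \int[lebesgue3]_y (f1 k y * d1 y + f2 k y * d2 y + f3 k y * d3 y) @[k --> \oo] -->
    \int[lebesgue3]_y (e1 y * d1 y + e2 y * d2 y + e3 y * d3 y).
  move=> mf1 mf2 mf3 me1 me2 me3 cd1 cd2 cd3 b1 b2 b3 cf1 cf2 cf3.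
  have [B1 hB1] := continuous_bounded_box M cd1.
  have [B2 hB2] := continuous_bounded_box M cd2.
  have [B3 hB3] := continuous_bounded_box M cd3.
  have md1 := continuous_measurable3 cd1.
  have md2 := continuous_measurable3 cd2.
  have md3 := continuous_measurable3 cd3.
  have msum (m1 m2 m3 : ST -> R) : measurable_fun [set: ST] m1 -> measurable_fun [set: ST] m2 ->
      measurable_fun [set: ST] m3 -> measurable_fun [set: ST] (fun y => m1 y * d1 y + m2 y * d2 y + m3 y * d3 y).
    by move=> mc1 mc2 mc3; do 2?apply: measurable_funD; apply: measurable_funM.
  apply: (@dominated_Rintegral _ _ _ lebesgue3 N
    (fun k y => f1 k y * d1 y + f2 k y * d2 y + f3 k y * d3 y)
    (fun y => e1 y * d1 y + e2 y * d2 y + e3 y * d3 y)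
    (fun y => (B1 + B2 + B3) * (\1_E : ST -> R) y)); [exact: mN|exact: N0| | | | |].
  - by move=> k; apply: msum.
  - exact: msum.
  - move=> y Ny; apply: cvgD; [apply: cvgD|]; apply: cvgM; try exact: cvg_cst;
      [exact: cf1|exact: cf2|exact: cf3].
  - by apply: intgZ; exact: integrable_indic3.
  - move=> k y; have [x1 o1] := b1 k y; have [x2 o2] := b2 k y; have [x3 o3] := b3 k y.
    have [Ey|nE] := pselect (E y); last first.
      by rewrite o1// o2// o3// !mul0r !addr0 normr0 indicE memNset// mulr0.
    rewrite indicE mem_set// mulr1.
    have one (x d B : R) : `|x| <= 1 -> `|d| <= B -> `|x * d| <= B.
      by move=> h1 h2; rewrite normrM -[leRHS]mul1r ler_pM.
    have t1 := one _ _ _ x1 (hB1 _ (EM _ Ey)).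
    have t2 := one _ _ _ x2 (hB2 _ (EM _ Ey)).
    have t3 := one _ _ _ x3 (hB3 _ (EM _ Ey)).
    apply: le_trans (ler_normD _ _) _; apply: lerD => //.
    by apply: le_trans (ler_normD _ _) _; exact: lerD.
have mua k : measurable_fun [set: ST] (fa (u k)) by apply: continuous_measurable3; have [] := uc k.
have mub k : measurable_fun [set: ST] (fb (u k)) by apply: continuous_measurable3; have [] := uc k.
have bo1 k y : `|fv1 (u k) y| <= 1 /\ (~ E y -> fv1 (u k) y = 0).
  by split; [have [] := bounds k y|move=> /(uo k)[]].
have bo2 k y : `|fv2 (u k) y| <= 1 /\ (~ E y -> fv2 (u k) y = 0).
  by split; [have [] := bounds k y|move=> /(uo k)[]].
have boa k y : `|fa (u k) y| <= 1 /\ (~ E y -> fa (u k) y = 0).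
  by split; [have [] := bounds k y|move=> /(uo k)[]].
have bob k y : `|fb (u k) y| <= 1 /\ (~ E y -> fb (u k) y = 0).
  by split; [have [] := bounds k y|move=> /(uo k)[]].
have c0 : continuous (fun _ : ST => 0 : R) by move=> y; exact: cvg_cst.
exists w; split.
- split => //.
  + move=> y Ey; split; [exact: win| |by []].
    by rewrite /= indicE mem_set// mulr1.
  + move=> psi d Cpsi; have [_ cd _] := Cpsi.
    have W k := (let: And4 _ _ _ W := us k in W) psi d Cpsi.
    have cN : continuous (fun y => - d A2 y) by move=> y; apply: cvgN; exact: cd.
    have lim0 (f : nat -> R) x : f k @[k --> \oo] --> x -> (forall k, f k = 0) -> x = 0.
      move=> cf f0; have f0' : f = fun=> 0 by apply/funext.
      by rewrite f0' in cf; exact: cvg_unique cf (cvg_cst 0).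
    split.
    * have P := pass _ _ _ _ _ _ _ _ _ mu1 mu2 mu2 mw1 mw2 mw2 (cd A1) (cd A2) c0 bo1 bo2 bo2 c1 c2 c2.
      rewrite -[RHS](lim0 _ _ P) => [|k].
        by apply: eq_Rintegral => y _; rewrite mulr0 addr0.
      have [W1 _ _] := W k; rewrite -[RHS]W1.
      by apply: eq_Rintegral => y _; rewrite mulr0 addr0.
    * have P := pass _ _ _ _ _ _ _ _ _ mu1 mua mub mw1 mwa mwb (cd At) (cd A1) (cd A2) bo1 boa bob
        c1 (fun y h => (cab y h).1) (fun y h => (cab y h).2).
      by apply: (lim0 _ _ P) => k; have [_ + _] := W k.
    * have P := pass _ _ _ _ _ _ _ _ _ mu2 mub mua mw2 mwb mwa (cd At) (cd A1) cN bo2 bob boa c2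
        (fun y h => (cab y h).2) (fun y h => (cab y h).1).
      rewrite -[RHS](lim0 _ _ P) => [|k].
        by apply: eq_Rintegral => y _; rewrite mulrN.
      have [_ _ W3] := W k; rewrite -[RHS]W3.
      by apply: eq_Rintegral => y _; rewrite mulrN.
- have [cg1 cg2] := cg.
  have P := pass _ _ _ _ _ _ _ _ _ mu1 mu2 mu2 mw1 mw2 mw2 cg1 cg2 c0 bo1 bo2 bo2 c1 c2 c2.
  have {}P : pairing g (u k) @[k --> \oo] --> pairing g w.
    rewrite (_ : pairing g w = \int[lebesgue3]_y (w1 y * g.1 y + w2 y * g.2 y + w2 y * 0)).
      rewrite (_ : (fun k => _) = fun k => \int[lebesgue3]_y (fv1 (u k) y * g.1 y + fv2 (u k) y *
        g.2 y + fv2 (u k) y * 0)) //.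
      by apply/funext => k; apply: eq_Rintegral => y _; ring.
    by apply: eq_Rintegral => y _ /=; ring.
  (* The sum of 16^-j over 1 <= j <= k is at most 1 - 16^-k, a bound that passes through the
     induction. *)
  have bnd k : `|pairing g (z k) - pairing g (z 0%N)| <= eps * (1 - 16^-1 ^+ k).
    elim: k => [|k IH]; first by rewrite subrr normr0 expr0 subrr mulr0.
    rewrite (_ : _ - _ = (pairing g (z k.+1) - pairing g (z k)) + (pairing g (z k) - pairing g (z
      0%N))); last by ring.
    apply: le_trans (ler_normD _ _) _; apply: le_trans (lerD (zg k) IH) _.
    rewrite -mulrDr ler_wpM2l ?(ltW eps0)//.
    have := q0 k; rewrite /q exprS; move: (16^-1 ^+ k) => x; clear; lra.
  rewrite -z00.
  have cn : `|pairing g (u k) - pairing g (z 0%N)| @[k --> \oo] --> `|pairing g w - pairing g (z 0%N)|.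
    by apply: cvg_norm; apply: cvgB => //; exact: cvg_cst.
  rewrite -(cvg_lim _ cn)//; apply: limr_le; first by apply/cvg_ex; eexists; exact: cn.
  apply: nearW => k; apply: le_trans (bnd k.+1) _.
  by rewrite -[leRHS]mulr1 ler_wpM2l ?(ltW eps0)// gerBl ltW// (q0 k).
Qed.

End exact.

(** * Riemann solutions *)

Section glue.
Context {R : realType}.
Local Notation ST := (R * (R * R))%type.

Lemma in_hull0 (l : R) : 0 <= l -> in_hull l 0 0 0 0.
Proof.
move=> l0 k1 k2; have := mulr_ge0 l0 (addr_ge0 (sqr_ge0 k1) (sqr_ge0 k2)).
by clear; lra.
Qed.

Definition zero_field : @field R := Field (cst 0) (cst 0) (cst 0) (cst 0).

Lemma subsolution0 (E : set ST) (l : R) : 0 <= l -> subsolution E l zero_field.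
Proof.
move=> l0; split => //=.
- by split => y; exact: cvg_cst.
- by move=> y; exact: in_hull0.
- move=> psi d _; split; rewrite -[RHS](@mul0r R (fine (lebesgue3 [set: ST]))) -Rintegral_cst//;
  by apply: eq_Rintegral => y _ /=; ring.
Qed.

(** Start once from the zero field and once from a single wave [w], and let [g] be the velocity of
    [w]. The pairings are 0 and [kinetic w], and saturation moves each by at most a third of that
    gap. *)
Lemma two_exact_fields (cp cq cr : R) : exists g (wA wB : field),
  [/\ continuous_pair_fun g, exact_field (cell cp cq cr 1) wA,
      exact_field (cell cp cq cr 1) wB & pairing g wA != pairing g wB].
Proof.
have q0 : 0 <= 4^-1 :> R by rewrite invr_ge0 ler0n.
have q4 : 0 <= (4^-1 : R) <= 2^-1 by rewrite q0/= lef_pV2 ?posrE// ler_nat.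
(* The wave is built at l = 1/4, and 1/4 + 40/640 = 5/16 is below level 0, which is 7/16. *)
have e0 : 0 < 640^-1 :> R by rewrite invr_gt0 ltr0n.
have [w [cw sw Ww hw kw]] := @cell_wave R cp cq cr 1 _ _ _ _ _ _ ltr01 q4 (in_hull0 q0) e0.
have lev0 : level 0 = 7 / 16 :> R by rewrite /level expr1; field.
have sub : subsolution (cell cp cq cr 1) (level 0) w.
  split => // y; have [u1 [u2 [ua [ub [hu]]]]] := hw y; rewrite !add0r => b1 b2 b3 b4.
  apply: (in_hull_perturb _ _ _ b1 b2 b3 b4 hu).
  - by rewrite q0/= invf_le1// ler1n.
  - by rewrite (ltW e0)/= invf_le1 ?ltr0n// ler1n.
  - by rewrite lev0; clear; lra.
have [cw1 cw2 _ _] := cw.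
pose g := (fv1 w, fv2 w); have cg : continuous_pair_fun g by [].
pose K := kinetic w.
have K0 : 0 < K.
  apply: lt_le_trans kw; rewrite expr0n !subr0 expr1n mulr1.
  by apply: mulr_gt0; [exact: wave_gain_gt0|rewrite exprn_gt0// invr_gt0 ltr0n].
have K3 : 0 < K / 3 by rewrite divr_gt0.
have [l0 _ _] := @level_bounds R 0.
have s0 : subsolution (cell cp cq cr 1) (level 0) zero_field by exact: subsolution0.
have [wA [eA pA]] := exact_cell s0 cg K3.
have [wB [eB pB]] := exact_cell sub cg K3.
exists g, wA, wB; split => //.
have z0 : pairing g zero_field = 0.
  rewrite -[RHS](@mul0r R (fine (lebesgue3 [set: ST]))) -Rintegral_cst//.
  by apply: eq_Rintegral => y _ /=; ring.
have zw : pairing g w = K by apply: eq_Rintegral => y _; rewrite !expr2.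
move: pA pB; rewrite z0 zw subr0 !ler_norml => /andP[_ hA] /andP[hB _].
by rewrite lt_eqF//; lra.
Qed.

Definition cone : set ST := [set y | 0 <= y.1 - y.2.2 /\ 0 <= y.1 + y.2.2].

Definition index := (nat * nat * int)%type.

Definition index_cell (k : index) : set ST := cell k.1.1%:R k.1.2%:R k.2%:~R 1.

Definition index_of (y : ST) : index :=
  (Num.truncn (y.1 - y.2.2), Num.truncn (y.1 + y.2.2), Num.floor y.2.1).

Lemma index_ofP y : cone y -> index_cell (index_of y) y.
Proof.
move=> [p0 q0]; rewrite /index_cell /index_of /=; split => /=.
- by have := truncn_itv p0; rewrite -natr1.
- by have := truncn_itv q0; rewrite -natr1.
- by have := floor_itv y.2.1; rewrite intrD.
Qed.

Lemma index_cell_cone k : index_cell k `<=` cone.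
Proof. by move=> y [/andP[p _] /andP[q _] _]; split; [apply: le_trans p|apply: le_trans q]. Qed.

Lemma index_cell_unique k y : index_cell k y -> index_of y = k.
Proof.
move=> ky; have cy := index_cell_cone ky; move: ky (index_ofP cy).
case: k => -[i j] k [/= /andP[p1 p2] /andP[q1 q2] /andP[r1 r2]].
case: (index_of y) => -[i' j'] k' [/= /andP[p1' p2'] /andP[q1' q2'] /andP[r1' r2']].
have nat_eq (a b : nat) (x : R) : a%:R <= x -> x < a%:R + 1 -> b%:R <= x -> x < b%:R + 1 -> a = b.
  move=> h1 h2 h3 h4; apply/eqP; rewrite eqn_leq; apply/andP.
  by split; rewrite -ltnS -(ltr_nat R) -natr1; lra.
have int_eq (a b : int) (x : R) : a%:~R <= x -> x < a%:~R + 1 -> b%:~R <= x -> x < b%:~R + 1 -> a = b.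
  move=> h1 h2 h3 h4; apply/eqP; rewrite eq_le; apply/andP.
  by split; rewrite -ltzD1 -(ltr_int R) intrD; lra.
by rewrite (nat_eq i' i _ p1' p2' p1 p2) (nat_eq j' j _ q1' q2' q1 q2) (int_eq k' k _ r1' r2' r1 r2).
Qed.

(** Half-open cells tile the cone, so each point selects one field, also on the faces. *)
Definition glued (w : index -> @field R) : field :=
  let sel (f : @field R -> ST -> R) (y : ST) := if `[< cone y >] then f (w (index_of y)) y else 0 in
  Field (sel fv1) (sel fv2) (sel fa) (sel fb).

Lemma glued_in w k y : index_cell k y -> [/\ fv1 (glued w) y = fv1 (w k) y,
  fv2 (glued w) y = fv2 (w k) y, fa (glued w) y = fa (w k) y & fb (glued w) y = fb (w k) y].
Proof.
by move=> ky; rewrite /= (index_cell_unique ky) asboolT//; exact: index_cell_cone ky.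
Qed.

Lemma glued_out w y : ~ cone y -> vanishes (glued w) y.
Proof. by move=> nc; split; rewrite /= asboolF. Qed.

(** Numbers that code no index receive the empty set, so that countable additivity over the naturals
    applies. *)
Definition enum_cell (n : nat) : set ST :=
  if @pickle_inv index n is Some k then index_cell k else set0.

Lemma cone_enum : cone = \bigcup_n enum_cell n.
Proof.
apply/seteqP; split => [y cy|y [n _]].
  by exists (pickle (index_of y)) => //; rewrite /enum_cell pickleK_inv; exact: index_ofP.
by rewrite /enum_cell; case: pickle_inv => // k; exact: index_cell_cone.
Qed.

Lemma enum_cell_measurable n : measurable (enum_cell n : set ST).
Proof. by rewrite /enum_cell; case: pickle_inv => // k; exact: measurable_cell. Qed.

Lemma cone_measurable : measurable (cone : set ST).
Proof. by rewrite cone_enum; apply: bigcup_measurable => n _; exact: enum_cell_measurable. Qed.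

Lemma enum_cell_trivIset : trivIset setT enum_cell.
Proof.
have inv n y : enum_cell n y -> n = pickle (index_of y).
  rewrite /enum_cell; have := @pickle_invK index n; case: pickle_inv => //= k kn.
  by move=> /index_cell_unique ->; rewrite kn.
by move=> m n _ _ [y [/inv -> /inv]].
Qed.

Lemma cone_partition_measurable (f : ST -> R) (F : index -> ST -> R) :
  (forall k, measurable_fun [set: ST] (F k)) ->
  (forall k y, index_cell k y -> f y = F k y) -> (forall y, ~ cone y -> f y = 0) ->
  measurable_fun [set: ST] f.
Proof.
move=> mF fF f0.
have -> : f = f \_ cone.
  apply/funext => y; rewrite patchE; case: ifPn => // /negP h.
  by apply: f0 => cy; apply: h; rewrite inE.
apply/(measurable_restrictT f cone_measurable); rewrite cone_enum.
apply/measurable_fun_bigcup; first exact: enum_cell_measurable.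
move=> n; rewrite /enum_cell; case: pickle_inv => [k|]; last exact: measurable_fun_set0.
apply: (eq_measurable_fun (F k)); first by move=> y /set_mem /fF.
exact: measurable_funS (mF k).
Qed.

(** Countable additivity over the disjoint cells, legitimate because [f] is integrable. *)
Lemma cone_partition_integral (f : ST -> R) (F : index -> ST -> R) : intg f ->
  (forall k y, index_cell k y -> f y = F k y) ->
  (forall k y, ~ index_cell k y -> F k y = 0) ->
  (forall k, \int[lebesgue3]_y F k y = 0) ->
  \int[lebesgue3]_(y in cone) f y = 0.
Proof.
move=> fi fF F0 IF; rewrite /Rintegral cone_enum.
have fi' n : lebesgue3.-integrable (enum_cell n) (EFin \o f).
  by apply: integrableS fi => //; exact: enum_cell_measurable.
rewrite integral_bigcup; last 3 first.
- exact: enum_cell_trivIset.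
- exact: enum_cell_measurable.
- by apply: integrableS fi => //; apply: bigcup_measurable => n _; exact: enum_cell_measurable.
rewrite eseries0// => n _ _.
have : \int[lebesgue3]_(y in enum_cell n) f y = 0.
  rewrite /enum_cell; case: pickle_inv => [k|]; last by rewrite Rintegral_set0.
  rewrite Rintegral_mkcond -[RHS](IF k); apply: eq_Rintegral => y _.
  rewrite patchE; case: ifPn => [/set_mem/fF//|/negP h].
  by rewrite F0// => ky; apply: h; rewrite inE.
rewrite /Rintegral => h.
apply: (etrans (esym (fineK _))); last by rewrite h.
exact: (@integrable_fin_num _ _ _ lebesgue3 _ (enum_cell_measurable n) _ (fi' n)).
Qed.

Section glued_properties.
Variable w : index -> @field R.
Hypothesis exw : forall k, exact_field (index_cell k) (w k).

Let mw1 k : measurable_fun [set: ST] (fv1 (w k)). Proof. by have [] := exw k. Qed.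
Let mw2 k : measurable_fun [set: ST] (fv2 (w k)). Proof. by have [] := exw k. Qed.

Lemma glued_speed y : cone y -> fv1 (glued w) y ^+ 2 + fv2 (glued w) y ^+ 2 = 2^-1.
Proof.
move=> cy; have ky := index_ofP cy; have [-> -> _ _] := glued_in w ky.
by have [_ _ _ /(_ y ky)[]] := exw (index_of y).
Qed.

Lemma glued_stress y : cone y -> fa (glued w) y = fv1 (glued w) y ^+ 2 - 4^-1 /\
  fb (glued w) y = fv1 (glued w) y * fv2 (glued w) y.
Proof.
move=> cy; have ky := index_ofP cy; have [-> -> -> ->] := glued_in w ky.
by have [_ _ _ /(_ y ky)[]] := exw (index_of y).
Qed.

Lemma glued_measurable1 : measurable_fun [set: ST] (fv1 (glued w)).
Proof.
apply: (@cone_partition_measurable _ (fun k => fv1 (w k))) => [k|k y|y].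
- exact: mw1.
- by move=> /(glued_in w)[].
- by move=> /(glued_out w)[].
Qed.

Lemma glued_measurable2 : measurable_fun [set: ST] (fv2 (glued w)).
Proof.
apply: (@cone_partition_measurable _ (fun k => fv2 (w k))) => [k|k y|y].
- exact: mw2.
- by move=> /(glued_in w)[].
- by move=> /(glued_out w)[].
Qed.

Lemma glued_bounds y : [/\ `|fv1 (glued w) y| <= 1, `|fv2 (glued w) y| <= 1,
  `|fa (glued w) y| <= 1 & `|fb (glued w) y| <= 1].
Proof.
have [cy|nc] := pselect (cone y); last first.
  by have [-> -> -> ->] := glued_out w nc; rewrite normr0.
have := glued_speed cy; have [-> ->] := glued_stress cy.
move: (fv1 _ _) (fv2 _ _) => x z xz; have sx := sqr_ge0 x; have sz := sqr_ge0 z.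
have sD := sqr_ge0 (x + z); have sB := sqr_ge0 (x - z).
by split; rewrite ler_norml; apply/andP; split; nra.
Qed.

Lemma glued_measurablea : measurable_fun [set: ST] (fa (glued w)).
Proof.
apply: (@cone_partition_measurable _ (fun k y => fv1 (w k) y ^+ 2 - 4^-1)) => [k|k y ky|y].
- by apply: measurable_funB; [exact: measurable_funX|exact: measurable_cst].
- have [-> _] := glued_stress (index_cell_cone ky).
  by have [-> _ _ _] := glued_in w ky.
- by move=> /(glued_out w)[].
Qed.

Lemma glued_measurableb : measurable_fun [set: ST] (fb (glued w)).
Proof.
apply: (@cone_partition_measurable _ (fun k y => fv1 (w k) y * fv2 (w k) y)) => [k|k y ky|y].
- exact: measurable_funM.
- have [_ ->] := glued_stress (index_cell_cone ky).
  by have [-> -> _ _] := glued_in w ky.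
- by move=> /(glued_out w)[].
Qed.

Lemma intg_glued (f : ST -> R) (d : ST -> R) M : measurable_fun [set: ST] f ->
  (forall y, `|f y| <= 1) -> continuous d -> box_supported M d -> intg (fun y => f y * d y).
Proof.
move=> mf bf cd sd; have [B hB] := continuous_bounded_box M cd.
apply: (@integrable_box _ _ M B).
- by apply: measurable_funM => //; exact: continuous_measurable3.
- by move=> y /sd ->; rewrite mulr0.
- by move=> y /hB h; rewrite normrM -[leRHS]mul1r ler_pM.
Qed.

Lemma glued_intg M (d : axis -> ST -> R) : (forall i, continuous (d i)) ->
  (forall i, box_supported M (d i)) -> forall i,
  [/\ intg (fun y => fv1 (glued w) y * d i y), intg (fun y => fv2 (glued w) y * d i y),
      intg (fun y => fa (glued w) y * d i y) & intg (fun y => fb (glued w) y * d i y)].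
Proof.
move=> cd sd i; split; apply: intg_glued (cd i) (sd i); try by move=> y; have [] := glued_bounds y.
- exact: glued_measurable1.
- exact: glued_measurable2.
- exact: glued_measurablea.
- exact: glued_measurableb.
Qed.

(** Every cell contributes zero because its field solves the system when extended by zero. The
    equations therefore hold on the cone even for tests that do not vanish on its boundary, and the
    glued field contributes nothing to the jump conditions at the fronts. *)
Lemma glued_weak M psi d : C1 psi d -> (forall i, box_supported M (d i)) ->
  [/\ \int[lebesgue3]_(y in cone) (fv1 (glued w) y * d A1 y + fv2 (glued w) y * d A2 y) = 0,
      \int[lebesgue3]_(y in cone) (fv1 (glued w) y * d At y + fa (glued w) y * d A1 y + fb (glued w) y * d A2 y) = 0 &
      \int[lebesgue3]_(y in cone) (fv2 (glued w) y * d At y + fb (glued w) y * d A1 y - fa (glued w) y * d A2 y) = 0].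
Proof.
move=> Cpsi sd; have [_ cd _] := Cpsi.
have W k := (let: And5 _ _ _ _ W := exw k in W) psi d Cpsi.
have wo k y : ~ index_cell k y -> vanishes (w k) y by have [_ _ + _ _] := exw k; exact.
have iw := glued_intg cd sd.
have i1 i : intg (fun y => fv1 (glued w) y * d i y) by have [] := iw i.
have i2 i : intg (fun y => fv2 (glued w) y * d i y) by have [] := iw i.
have ia i : intg (fun y => fa (glued w) y * d i y) by have [] := iw i.
have ib i : intg (fun y => fb (glued w) y * d i y) by have [] := iw i.
split.
- apply: (@cone_partition_integral _ (fun k y => fv1 (w k) y * d A1 y + fv2 (w k) y * d A2 y)).
  + exact: intgD.
  + by move=> k y /(glued_in w)[-> -> _ _].
  + by move=> k y /wo[-> -> _ _]; rewrite !mul0r addr0.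
  + by move=> k; have [] := W k.
- apply: (@cone_partition_integral _ (fun k y => fv1 (w k) y * d At y + fa (w k) y * d A1 y + fb (w k) y * d A2 y)).
  + by apply: intgD => //; exact: intgD.
  + by move=> k y /(glued_in w)[-> _ -> ->].
  + by move=> k y /wo[-> _ -> ->]; rewrite !mul0r !addr0.
  + by move=> k; have [] := W k.
- apply: (@cone_partition_integral _ (fun k y => fv2 (w k) y * d At y + fb (w k) y * d A1 y - fa (w k) y * d A2 y)).
  + by apply: intgB => //; exact: intgD.
  + by move=> k y /(glued_in w)[_ -> -> ->].
  + by move=> k y /wo[_ -> -> ->]; rewrite !mul0r addr0 subrr.
  + by move=> k; have [] := W k.
Qed.

End glued_properties.

End glue.

(** * Integration by parts on the half-space t >= 0 *)

Section balance.
Context {R : realType}.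
Local Notation ST := (R * (R * R))%type.
Local Notation mu := (@lebesgue_measure R).

Lemma integral_deriv_half (H G : R -> R) M : (forall x : R, is_derive x 1 H (G x)) ->
  continuous G -> (forall x, M < `|x| -> H x = 0 /\ G x = 0) ->
  (\int[mu]_x ((G \_ [set t | 0 <= t]) x)%:E)%E = (- H 0)%:E.
Proof.
move=> dH cG z0.
pose N := `|M| + 1; have N0 : 0 < N by rewrite /N ltr_pwDr.
have MN : M < N by rewrite /N; have := ler_norm M; lra.
have -> : (fun x => ((G \_ [set t | 0 <= t]) x)%:E) = (fun x => (G x)%:E) \_ `[0, N].
  apply/funext => x; rewrite !patchE; case: ifPn => [/set_mem /= x0|/negP x0]; case: ifPn => [/set_mem/= h|/negP h] //=.
  - have /z0[_ ->//] : M < `|x|.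
    rewrite ger0_norm//; apply: (lt_trans MN); rewrite ltNge; apply/negP => xN; apply: h.
    by rewrite inE /= in_itv /= x0.
  - exfalso; apply: x0; rewrite inE /=; by move: h; rewrite in_itv/= => /andP[].
have cH : continuous H.
  by move=> x; apply: differentiable_continuous; apply/derivable1_diffP; have [] := dH x.
rewrite -integral_mkcond (@continuous_FTC2 _ G H)//; last 3 first.
- exact: continuous_subspaceT.
- split; first by move=> x _; have [] := dH x.
  + exact: cvg_at_right_filter (cH _).
  + exact: cvg_at_left_filter (cH _).
- by move=> x _; rewrite derive1E; have [] := dH x.
have [-> _] : H N = 0 /\ G N = 0 by apply: z0; rewrite gtr0_norm.
by rewrite -EFinB sub0r.
Qed.

Lemma halfspace_measurable : measurable (@halfspace R : set ST).
Proof.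
rewrite (_ : halfspace = (fun y : ST => y.1) @^-1` `[0, +oo[%classic).
  by apply: measurable_preimage3 => //; exact: continuous_t.
by apply/seteqP; split => y /=; rewrite in_itv/= andbT.
Qed.

Lemma measurable_patch (f : ST -> R) (A : set ST) : measurable A ->
  measurable_fun [set: ST] f -> measurable_fun [set: ST] (f \_ A).
Proof. by move=> mA mf; apply/(measurable_restrictT f mA); exact: measurable_funS mf. Qed.

Lemma halfspace_time_derivative (K G : ST -> R) M : continuous K -> continuous G ->
  box_supported M K -> box_supported M G -> pderive At K G ->
  \int[lebesgue3]_(y in halfspace) G y = - \int[lebesgue2]_x K (0, x).
Proof.
move=> cK cG sK sG dK; rewrite Rintegral_mkcond.
have [B hB] := continuous_bounded_box M cG.
have iG : intg (G \_ halfspace).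
  apply: (@integrable_box _ _ M `|B|).
  - by apply: measurable_patch; [exact: halfspace_measurable|exact: continuous_measurable3].
  - by move=> y h; rewrite patchE sG//; case: ifP.
  - move=> y /hB h; rewrite patchE; case: ifP => _; last by rewrite normr0.
    by apply: le_trans h _; exact: ler_norm.
have [B' hB'] := continuous_bounded_box M cK.
have iK : intg2 (fun x => K (0, x)).
  exact: slice_integrable (continuous_measurable3 cK) sK hB'.
have slice (x : R * R) : continuous (fun t : R => G (t, x)).
  apply: continuous_slice => //; apply: continuous_pair; first by move=> ?; exact: cvg_id.
  by move=> ?; exact: cvg_cst.
rewrite {1}/Rintegral -(integral21_prod_meas1 iG).
rewrite (_ : (\int[_]_x _)%E = (\int[lebesgue2]_x (- K (0, x))%:E)%E); last first.
  apply: eq_integral => x _; rewrite /fubini_G /=.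
  have dKx (t : R) : is_derive t 1 (fun s => K (s, x)) (G (t, x)) := dK (t, x).
  have zx t : M < `|t| -> K (t, x) = 0 /\ G (t, x) = 0.
    by move=> tM; split; [apply: sK|apply: sG] => /boxP[/= h _ _]; move: tM; rewrite ltNge h.
  rewrite -(integral_deriv_half dKx (slice x) zx).
  by apply: eq_integral => t _; rewrite !patchE; congr (_%:E); rewrite /halfspace !inE.
rewrite -[LHS]/(\int[lebesgue2]_x (- K (0, x))).
under eq_Rintegral do rewrite -mulN1r.
by rewrite RintegralZl// mulN1r.
Qed.

End balance.

(** * Balance laws for piecewise constant states with two fronts *)

Section rankine_hugoniot.
Context {R : realType}.
Local Notation ST := (R * (R * R))%type.
Local Notation iH := (\1_halfspace : ST -> R).

(* C^1 approximations of the indicator function of ]0, +oo[, used to smooth the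
   jumps across the fronts. *)
Definition step (k : nat) (s : R) : R := 1 - (1 + 4 ^+ k * pospow 2 s)^-1.

Definition dstep (k : nat) (s : R) : R :=
  (1 + 4 ^+ k * pospow 2 s) ^- 2 * (4 ^+ k * (2 * pospow 1 s)).

Lemma step_shift_ge0 k (s : R) : 0 <= 4 ^+ k * pospow 2 s.
Proof. by apply: mulr_ge0; [exact: exprn_ge0|exact: pospow_ge0]. Qed.

Lemma step_den_gt0 k (s : R) : 0 < 1 + 4 ^+ k * pospow 2 s.
Proof. by rewrite ltr_pwDl// step_shift_ge0. Qed.

Lemma is_derive_step k (s : R) : is_derive s 1 (step k) (dstep k s).
Proof.
have n0 : 1 + 4 ^+ k * pospow 2 s != 0 by rewrite gt_eqF ?step_den_gt0.
have h1 : is_derive s 1 (fun x => 4 ^+ k * pospow 2 x) (4 ^+ k * (2 * pospow 1 s)).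
  have hc : is_derive s 1 (fun _ : R => 4 ^+ k : R) (0 : R) by exact: is_derive_cst.
  have h := is_deriveM hc (is_derive_pospow2 s).
  by apply: is_derive_eq h _; rewrite /GRing.scale/= mulr0 addr0.
have h2 : is_derive s 1 (fun x => 1 + 4 ^+ k * pospow 2 x) (0 + 4 ^+ k * (2 * pospow 1 s)).
  by apply: is_deriveD => //; exact: is_derive_cst.
have h3 : is_derive s 1 (fun x => (1 + 4 ^+ k * pospow 2 x)^-1)
    (- (1 + 4 ^+ k * pospow 2 s) ^- 2 * (0 + 4 ^+ k * (2 * pospow 1 s))).
  have [d2 e2] := h2; split; first exact: derivableV.
  by rewrite deriveV// e2.
have h4 : is_derive s 1 (fun _ : R => 1 : R) (0 : R) by exact: is_derive_cst.
have h := is_deriveB h4 h3.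
apply: is_derive_eq h _; by rewrite /dstep /= !add0r mulNr opprK.
Qed.

Lemma continuous_dstep (k : nat) : continuous (dstep k).
Proof.
have cp n : continuous (fun s => 4 ^+ k * (2 * pospow n s) : R).
  by move=> s; apply: cvgM; [exact: cvg_cst|apply: cvgM; [exact: cvg_cst|exact: continuous_pospow]].
move=> s; apply: cvgM; last exact: cp.
have cd : {for s, continuous (fun s => (1 + 4 ^+ k * pospow 2 s) ^+ 2)}.
  apply: (@continuous_comp _ _ _ (fun s => 1 + 4 ^+ k * pospow 2 s) (fun x => x ^+ 2)); last exact: exprn_continuous.
  apply: cvgD; first exact: cvg_cst.
  by apply: cvgM; [exact: cvg_cst|exact: continuous_pospow].
apply: cvgV => //; by rewrite sqrf_eq0 gt_eqF ?step_den_gt0.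
Qed.

Lemma continuous_step (k : nat) : continuous (step k).
Proof.
move=> x; apply: differentiable_continuous; apply/derivable1_diffP.
by have [] := is_derive_step k x.
Qed.

Lemma step_bounds k (s : R) : 0 <= step k s <= 1.
Proof.
have d0 := step_den_gt0 k s.
have d1 : (1 + 4 ^+ k * pospow 2 s)^-1 <= 1.
  by rewrite invf_le1// lerDl step_shift_ge0.
have d2 : 0 <= (1 + 4 ^+ k * pospow 2 s)^-1 by rewrite invr_ge0 ltW.
by rewrite /step; apply/andP; split; move: d1 d2; clear; lra.
Qed.

(** For s > 0 the error 1 / (1 + 4^k s^2) is at most 4^-k / s^2; for s <= 0 the step vanishes
    identically. *)
Lemma cvg_step (s : R) : step k s @[k --> \oo] --> (if 0 < s then 1 else 0 : R).
Proof.
case: ifPn => s0; last first.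
  have E k : step k s = 0.
    by rewrite /step /pospow max_l ?expr0n ?mulr0 ?addr0 ?invr1 ?subrr// leNgt.
  by under eq_fun do rewrite E; exact: cvg_cst.
have p0 : 0 < pospow 2 s by rewrite exprn_gt0// lt_max s0 orbT.
apply: (@cvg_geometric_close _ _ (fun=> 1) ((pospow 2 s)^-1)) => [k|]; last exact: cvg_cst.
have d0 := step_den_gt0 k s.
rewrite /step (_ : _ - 1 = - (1 + 4 ^+ k * pospow 2 s)^-1); last by ring.
rewrite normrN ger0_norm ?invr_ge0 ?(ltW d0)// exprVn -invfM lef_pV2 ?posrE//.
  by rewrite mulrC lerDr.
by rewrite mulr_gt0// exprn_gt0.
Qed.

Lemma intg2Z (r : R) (f : R * R -> R) : intg2 f ->
  intg2 (fun x => r * f x) /\ \int[lebesgue2]_x (r * f x) = r * \int[lebesgue2]_x f x.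
Proof.
move=> fi; split; last by rewrite RintegralZl.
rewrite /intg2 (_ : _ \o _ = fun y => (r%:E * (f y)%:E)%E); first exact: integrableZl.
by apply/funext => y /=; rewrite EFinM.
Qed.

Lemma intg2D (f g : R * R -> R) : intg2 f -> intg2 g -> intg2 (fun x => f x + g x) /\
  \int[lebesgue2]_x (f x + g x) = \int[lebesgue2]_x f x + \int[lebesgue2]_x g x.
Proof.
move=> fi gi; split; last by rewrite RintegralD.
rewrite /intg2 (_ : _ \o _ = fun y => ((f y)%:E + (g y)%:E)%E); first exact: integrableD.
by apply/funext => y /=; rewrite EFinD.
Qed.

Section balance.
Variables (M : R) (phi : ST -> R) (d : axis -> ST -> R).
Hypotheses (Cphi : C1 phi d) (sphi : box_supported M phi)
  (sd : forall i, box_supported M (d i)).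

Let cphi : continuous phi. Proof. by have [] := Cphi. Qed.
Let cd i : continuous (d i). Proof. by have [_ + _] := Cphi; exact. Qed.
Let dphi i : pderive i phi (d i). Proof. by have [_ _ +] := Cphi; exact. Qed.

(** Positive beyond the front x2 = t if sg = 1, and beyond the front x2 = -t if sg = -1. *)
Definition front (sg : R) (y : ST) : R := sg * y.2.2 - y.1.

Lemma frontE sg : front sg = ev (linear_form (-1) 0 sg).
Proof. by apply/funext => y; rewrite /front /=; ring. Qed.

Lemma continuous_front sg : continuous (front sg).
Proof. by rewrite frontE; exact: continuous_ev. Qed.

Lemma pderive_front_t sg : pderive At (front sg) (fun=> -1).
Proof.
rewrite frontE (_ : (fun=> -1) = ev (D At (linear_form (-1) 0 sg))); first exact: pderive_ev.
by apply/funext => y /=; ring.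
Qed.

Lemma pderive_front_x2 sg : pderive A2 (front sg) (fun=> sg).
Proof.
rewrite frontE (_ : (fun=> sg) = ev (D A2 (linear_form (-1) 0 sg))); first exact: pderive_ev.
by apply/funext => y /=; ring.
Qed.

Lemma indic_halfspace_space_invariant i (y : ST) s : i <> At ->
  iH (upd i y s) = iH y.
Proof. by case: i => // _; rewrite !indicE /halfspace /in_mem. Qed.

Lemma Rintegral_halfspace (f : ST -> R) :
  \int[lebesgue3]_(y in halfspace) f y = \int[lebesgue3]_y (iH y * f y).
Proof.
rewrite Rintegral_mkcond; apply: eq_Rintegral => y _.
by rewrite patchE indicE; case: (y \in halfspace); rewrite ?mul1r ?mul0r.
Qed.

Lemma measurable_indic_halfspace : measurable_fun [set: ST] iH.
Proof. by apply: measurable_indic; exact: halfspace_measurable. Qed.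

Lemma intg_halfspace (f : ST -> R) : continuous f -> box_supported M f ->
  intg (fun y => iH y * f y).
Proof.
move=> cf sf; have [B hB] := continuous_bounded_box M cf.
apply: (@integrable_box _ _ M B).
- apply: measurable_funM; last exact: continuous_measurable3.
  exact: measurable_indic_halfspace.
- by move=> y /sf ->; rewrite mulr0.
- move=> y /hB h; rewrite normrM -[leRHS]mul1r ler_pM// indicE.
  by case: (y \in _); rewrite ?normr1 ?normr0.
Qed.

Lemma halfspace_space_derivative i (K G : ST -> R) : i <> At ->
  continuous G -> box_supported M K -> box_supported M G -> pderive i K G ->
  \int[lebesgue3]_(y in halfspace) G y = 0.
Proof.
move=> iA cG sK sG KG; rewrite Rintegral_halfspace.
apply: (@coefficient_space_derivative0 _ i _ K G M) => //.
- exact: measurable_indic_halfspace.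
- by move=> y; rewrite indicE; case: (y \in _); rewrite ?normr1 ?normr0.
- by move=> y s; exact: indic_halfspace_space_invariant.
Qed.

Lemma halfspaceD (f g : ST -> R) : continuous f -> continuous g ->
  box_supported M f -> box_supported M g ->
  \int[lebesgue3]_(y in halfspace) (f y + g y) =
  \int[lebesgue3]_(y in halfspace) f y + \int[lebesgue3]_(y in halfspace) g y.
Proof.
move=> cf cg sf sg; rewrite !Rintegral_halfspace -RintegralD; last 3 first.
- exact: measurableT.
- exact: intg_halfspace.
- exact: intg_halfspace.
by apply: eq_Rintegral => y _; ring.
Qed.

(** The operator d_t + sg d_2 annihilates [front sg] because sg^2 = 1. The integrand is thus a total
    derivative of [step k (front sg y) * phi y], and only the trace at t = 0 survives. *)
Lemma transported_flux (sg : R) k : sg ^+ 2 = 1 ->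
  \int[lebesgue3]_(y in halfspace) (step k (front sg y) * (d At y + sg * d A2 y)) =
  - \int[lebesgue2]_x (step k (front sg (0, x)) * phi (0, x)).
Proof.
move=> sg1.
pose K (y : ST) := step k (front sg y) * phi y.
pose Gt (y : ST) := (dstep k (front sg y) * -1) * phi y + step k (front sg y) * d At y.
pose Gx (y : ST) := (dstep k (front sg y) * sg) * phi y + step k (front sg y) * d A2 y.
have cs : continuous (fun y => step k (front sg y)).
  by apply: continuous_slice; [exact: continuous_step|exact: continuous_front].
have cds a : continuous (fun y => dstep k (front sg y) * a).
  apply: continuousM3; last by move=> y; exact: cvg_cst.
  by apply: continuous_slice; [exact: continuous_dstep|exact: continuous_front].
have cK : continuous K by exact: continuousM3.
have cGt : continuous Gt by apply: continuousD3; exact: continuousM3.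
have cGx : continuous Gx by apply: continuousD3; exact: continuousM3.
have sK : box_supported M K by move=> y /sphi h; rewrite /K h mulr0.
have sGt : box_supported M Gt.
  by move=> y h; rewrite /Gt (sphi h) (sd At h) !mulr0 addr0.
have sGx : box_supported M Gx.
  by move=> y h; rewrite /Gx (sphi h) (sd A2 h) !mulr0 addr0.
have dKt : pderive At K Gt.
  apply: pderiveM; last exact: dphi.
  by apply: (pderive_comp _ (pderive_front_t sg)) => x; exact: is_derive_step.
have dKx : pderive A2 K Gx.
  apply: pderiveM; last exact: dphi.
  by apply: (pderive_comp _ (pderive_front_x2 sg)) => x; exact: is_derive_step.
have It := halfspace_time_derivative cK cGt sK sGt dKt.
have Ix : \int[lebesgue3]_(y in halfspace) (sg * Gx y) = 0.
  apply: (@halfspace_space_derivative A2 (fun y => sg * K y)); first by [].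
  - by apply: continuousM3 => // y; exact: cvg_cst.
  - by move=> y /sK ->; rewrite mulr0.
  - by move=> y /sGx ->; rewrite mulr0.
  - have := @pderiveM R A2 (fun=> sg) (fun=> 0) K Gx _ dKx.
    rewrite (_ : (fun y => 0 * K y + sg * Gx y) = (fun y => sg * Gx y)).
      by apply; move=> y; exact: is_derive_cst.
    by apply/funext => y; rewrite mul0r add0r.
change (\int[lebesgue2]_x (step k (front sg (0, x)) * phi (0, x))) with (\int[lebesgue2]_x K (0, x)).
rewrite -It -[RHS]addr0 -Ix -halfspaceD //; last 2 first.
- by apply: continuousM3 => // y; exact: cvg_cst.
- by move=> y /sGx ->; rewrite mulr0.
apply: eq_Rintegral => y _; rewrite /Gt /Gx.
transitivity (step k (front sg y) * (d At y + sg * d A2 y) +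
   (sg ^+ 2 - 1) * (dstep k (front sg y) * phi y)); last by ring.
by rewrite sg1 subrr mul0r addr0.
Qed.

(* The values on x2 > t, on x2 < -t and in between, in this order. *)
Definition sector (cR cL cM : R) (y : ST) : R :=
  if y.1 < y.2.2 then cR else if y.2.2 < - y.1 then cL else cM.

Lemma measurable_fronts : measurable_fun [set: ST] (fun y : ST => y.1 < y.2.2) /\
  measurable_fun [set: ST] (fun y : ST => y.2.2 < - y.1).
Proof.
split; apply: measurable_fun_ltr; apply: continuous_measurable3.
- exact: continuous_t.
- exact: continuous_x2.
- exact: continuous_x2.
- by move=> y; apply: cvgN; exact: continuous_t.
Qed.

Lemma measurable_sector cR cL cM : measurable_fun [set: ST] (sector cR cL cM).
Proof.
have [mR mL] := measurable_fronts.
by do 2 apply: measurable_fun_ifT => //.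
Qed.

(* The hypotheses are the Rankine-Hugoniot conditions on x2 = t and x2 = -t. *)
Lemma sector_balance (dR dL dM fR fL fM : R) :
  dR - dM = fR - fM -> dL - dM = - (fL - fM) ->
  \int[lebesgue3]_(y in halfspace) (sector dR dL dM y * d At y + sector fR fL fM y * d A2 y)
  + \int[lebesgue2]_x ((if x.2 < 0 then dL else dR) * phi (0, x)) = 0.
Proof.
move=> RHR RHL.
(* By the Rankine-Hugoniot conditions the jumps of the flux are [a] and [- b]. With the steps in
   place of indicators, the pairs [Dk], [Fk] then satisfy the balance exactly for every k. *)
pose a := dR - dM; pose b := dL - dM.
pose Dk k y := dM + a * step k (front 1 y) + b * step k (front (-1) y).
pose Fk k y := fM + a * step k (front 1 y) - b * step k (front (-1) y).
have ccst (r : R) : continuous (fun _ : ST => r) by move=> y; exact: cvg_cst.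
have cst_ k sg : continuous (fun y => step k (front sg y)).
  by apply: continuous_slice; [exact: continuous_step|exact: continuous_front].
have cDk k : continuous (Dk k).
  apply: continuousD3; last exact: continuousM3.
  by apply: continuousD3 => //; exact: continuousM3.
have cFk k : continuous (Fk k).
  move=> y; apply: cvgB; last by apply: cvgM; [exact: cvg_cst|exact: cst_].
  by apply: cvgD; [exact: cvg_cst|apply: cvgM; [exact: cvg_cst|exact: cst_]].
have bal k : \int[lebesgue3]_(y in halfspace) (Dk k y * d At y + Fk k y * d A2 y) =
    - \int[lebesgue2]_x (Dk k (0, x) * phi (0, x)).
  have i2 : intg2 (fun x => phi (0, x)).
    have [B hB] := continuous_bounded_box M cphi.
    exact: slice_integrable (continuous_measurable3 cphi) sphi hB.
  have i2s sg : intg2 (fun x => step k (front sg (0, x)) * phi (0, x)).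
    have cK : continuous (fun y => step k (front sg y) * phi y) by exact: continuousM3.
    have [B hB] := continuous_bounded_box M cK.
    have sK : box_supported M (fun y => step k (front sg y) * phi y).
      by move=> y /sphi ->; rewrite mulr0.
    exact: (slice_integrable 0 (continuous_measurable3 cK) sK hB).
  have T1 := transported_flux k (expr1n R 2).
  have T2 := transported_flux k (sqrr_sign R 1); rewrite expr1 in T2.
  have T0 := halfspace_time_derivative cphi (@cd At) sphi (sd At) (@dphi At).
  have X0 := @halfspace_space_derivative A2 phi (d A2) ltac:(by []) (@cd A2) sphi (sd A2) (@dphi A2).
  have intH (f : ST -> R) : continuous f -> box_supported M f ->
    forall r, \int[lebesgue3]_(y in halfspace) (r * f y) = r * \int[lebesgue3]_(y in halfspace) f y.
    move=> cf sf r; rewrite !Rintegral_halfspace -RintegralZl; last 2 first.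
    - exact: measurableT.
    - exact: intg_halfspace.
    by apply: eq_Rintegral => y _; ring.
  pose P sg y := step k (front sg y) * (d At y + sg * d A2 y).
  have cP sg : continuous (P sg) by apply: continuousM3 => //; apply: continuousD3 => //; exact: continuousM3.
  have sP sg : box_supported M (P sg).
    by move=> y h; rewrite /P (sd At h) (sd A2 h) mulr0 addr0 mulr0.
  have cZ r (f : ST -> R) : continuous f -> continuous (fun y => r * f y) by move=> cf; exact: continuousM3.
  have sZ r (f : ST -> R) : box_supported M f -> box_supported M (fun y => r * f y).
    by move=> sf y /sf ->; rewrite mulr0.
  have sD (f g : ST -> R) : box_supported M f -> box_supported M g -> box_supported M (fun y => f y + g y).
    by move=> sf sg y h; rewrite sf// sg// addr0.
  pose f0 y := dM * d At y; pose f1 y := fM * d A2 y; pose f2 y := a * P 1 y; pose f3 y := b * P (-1) y.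
  have [c0 c1 c2 c3] : [/\ continuous f0, continuous f1, continuous f2 & continuous f3].
    by split; exact: cZ.
  have [s0 s1 s2 s3] : [/\ box_supported M f0, box_supported M f1, box_supported M f2 & box_supported M f3].
    by split; exact: sZ.
  have c01 := continuousD3 c0 c1; have s01 := sD _ _ s0 s1.
  have -> : \int[lebesgue3]_(y in halfspace) (Dk k y * d At y + Fk k y * d A2 y) =
      \int[lebesgue3]_(y in halfspace) (f0 y + f1 y + f2 y + f3 y).
    by apply: eq_Rintegral => y _; rewrite /Dk /Fk /f0 /f1 /f2 /f3 /P; ring.
  rewrite (halfspaceD (continuousD3 c01 c2) c3 (sD _ _ s01 s2) s3).
  rewrite (halfspaceD c01 c2 s01 s2) (halfspaceD c0 c1 s0 s1).
  rewrite !intH // X0 T0 /P T1 // T2 //.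
  rewrite (_ : (fun x => Dk k (0, x) * phi (0, x)) = (fun x => dM * phi (0, x) +
    a * (step k (front 1 (0, x)) * phi (0, x)) + b * (step k (front (-1) (0, x)) * phi (0, x)))); last first.
    by apply/funext => x; rewrite /Dk; ring.
  have [i0 e0] := intg2Z dM i2; have [i1 e1] := intg2Z a (i2s 1).
  have [i3 e3] := intg2Z b (i2s (-1)); have [i4 e4] := intg2D i0 i1.
  have [_ ->] := intg2D i4 i3; rewrite e4 e0 e1 e3; ring.
have bS k sg y : `|step k (front sg y)| <= 1.
  by have /andP[h0 h1] := step_bounds k (front sg y); rewrite ger0_norm.
pose C := `|dM| + `|fM| + `|a| + `|b|.
have bMul r k sg y : `|r * step k (front sg y)| <= `|r|.
  by rewrite normrM ler_piMr.
have bDk k y : `|Dk k y| <= C.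
  have h1 := bMul a k 1 y; have h2 := bMul b k (-1) y; have h3 := normr_ge0 fM.
  have h4 := ler_normD (dM + a * step k (front 1 y)) (b * step k (front (-1) y)).
  have h5 := ler_normD dM (a * step k (front 1 y)).
  by move: h1 h2 h3 h4 h5; rewrite /Dk /C; clear; lra.
have bFk k y : `|Fk k y| <= C.
  have h1 := bMul a k 1 y; have h2 := bMul b k (-1) y; have h3 := normr_ge0 dM.
  have h4 := ler_normB (fM + a * step k (front 1 y)) (b * step k (front (-1) y)).
  have h5 := ler_normD fM (a * step k (front 1 y)).
  by move: h1 h2 h3 h4 h5; rewrite /Fk /C; clear; lra.
have lim_ (c e r : R) sg y : e = (if 0 < front sg y then 1 else 0) ->
    r * step k (front sg y) @[k --> \oo] --> r * e.
  by move=> ->; apply: cvgM; [exact: cvg_cst|exact: cvg_step].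
have limD y : Dk k y @[k --> \oo] -->
    dM + a * (if 0 < front 1 y then 1 else 0) + b * (if 0 < front (-1) y then 1 else 0).
  by apply: cvgD; [apply: cvgD; [exact: cvg_cst|exact: lim_]|exact: lim_].
have limF y : Fk k y @[k --> \oo] -->
    fM + a * (if 0 < front 1 y then 1 else 0) - b * (if 0 < front (-1) y then 1 else 0).
  by apply: cvgB; [apply: cvgD; [exact: cvg_cst|exact: lim_]|exact: lim_].
have fr1 (y : ST) : (0 < front 1 y) = (y.1 < y.2.2) by rewrite /front mul1r subr_gt0.
have fr2 (y : ST) : (0 < front (-1) y) = (y.2.2 < - y.1).
  by rewrite /front mulN1r subr_gt0 ltrNr.
have mH : measurable_fun [set: ST] iH.
  exact: measurable_indic_halfspace.
have L3 : \int[lebesgue3]_(y in halfspace) (Dk k y * d At y + Fk k y * d A2 y) @[k --> \oo] -->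
    \int[lebesgue3]_(y in halfspace) (sector dR dL dM y * d At y + sector fR fL fM y * d A2 y).
  pose F k y := iH y * (Dk k y * d At y + Fk k y * d A2 y).
  pose G y := iH y * (sector dR dL dM y * d At y + sector fR fL fM y * d A2 y).
  rewrite Rintegral_halfspace (_ : (fun k => _) = fun k => \int[lebesgue3]_y F k y); last first.
    by apply/funext => k; rewrite Rintegral_halfspace.
  pose h y := C * `|d At y| + C * `|d A2 y|.
  apply: (@dominated_Rintegral _ _ _ lebesgue3 set0 F G h).
  - exact: measurable0.
  - exact: measure0.
  - move=> k; apply: measurable_funM => //; apply: continuous_measurable3.
    by apply: continuousD3; exact: continuousM3.
  - apply: measurable_funM => //; apply: measurable_funD; apply: measurable_funM;
      solve [exact: measurable_sector|exact: continuous_measurable3].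
  - move=> y _; have [y0|y0] := pselect (halfspace y); last first.
      have i0 : iH y = 0 by rewrite indicE memNset.
      by rewrite /F /G i0 mul0r; under eq_fun do rewrite mul0r; exact: cvg_cst.
    apply: cvgM; first exact: cvg_cst.
    (* For t >= 0 the two fronts are not both positive, so at most one correction is active. *)
    have E (cR cL cM a' b' : R) : cR = cM + a' -> cL = cM + b' ->
        sector cR cL cM y = cM + a' * (if 0 < front 1 y then 1 else 0) + b' * (if 0 < front (-1) y then 1 else 0).
      move=> -> ->; rewrite fr1 fr2 /sector; case: ifPn => h1; case: ifPn => h2.
      - by move: y0 h1 h2; rewrite /halfspace /=; lra.
      - by rewrite mulr1 mulr0 addr0.
      - by rewrite mulr1 mulr0 addr0.
      - by rewrite !mulr0 !addr0.
    have eR : dR = dM + a by rewrite /a addrC subrK.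
    have eL : dL = dM + b by rewrite /b addrC subrK.
    have eR' : fR = fM + a by rewrite /a RHR addrC subrK.
    have eL' : fL = fM + - b by rewrite /b RHL opprK addrC subrK.
    rewrite /G (E _ _ _ _ _ eR eL) (E _ _ _ _ _ eR' eL').
    rewrite mulNr.
    by apply: cvgD; (apply: cvgM; last exact: cvg_cst); [exact: limD|exact: limF].
  - have ci : continuous h.
      have cn i : continuous (fun y => C * `|d i y|).
        by apply: continuousM3 => // y; apply: cvg_norm; exact: cd.
      exact: continuousD3.
    apply: (@integrable_continuous_box _ _ M) => //.
    by move=> y h0; rewrite /h !sd// normr0 mulr0 addr0.
  - move=> k y; rewrite /F normrM /h indicE.
    have h1 := bDk k y; have h2 := bFk k y.
    have h3 : `|Dk k y * d At y + Fk k y * d A2 y| <= C * `|d At y| + C * `|d A2 y|.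
      by apply: (le_trans (ler_normD _ _)); rewrite !normrM lerD// ler_wpM2r.
    apply: le_trans h3; rewrite ler_piMl//; case: (_ \in _); rewrite ?normr1 ?normr0//.
have L2 : \int[lebesgue2]_x (Dk k (0, x) * phi (0, x)) @[k --> \oo] -->
    \int[lebesgue2]_x ((if x.2 < 0 then dL else dR) * phi (0, x)).
  (* At t = 0 and x2 = 0 both steps vanish, so the limit there is [dM] instead of the datum; this
     line is null. *)
  pose N : set (R * R) := [set: R] `*` [set 0].
  have mslice (f : ST -> R) : continuous f ->
      measurable_fun [set: measurableTypeR R * measurableTypeR R] (fun x => f (0, x)).
    by move=> /continuous_measurable3 mf; exact: (measurable_fun_pair2 (0 : R) mf).
  apply: (@dominated_Rintegral _ _ _ lebesgue2 N (fun k x => Dk k (0, x) * phi (0, x))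
    (fun x => (if x.2 < 0 then dL else dR) * phi (0, x)) (fun x => C * `|phi (0, x)|)).
  - exact: measurableX.
  - pose Z : set R := [set 0]; pose A : set R := [set: R].
    rewrite -[LHS]/(lebesgue2 N).
    have -> : lebesgue2 N = (@lebesgue_measure R A * @lebesgue_measure R Z)%E.
      apply: (product_measure1E (@lebesgue_measure R) (@lebesgue_measure R)) => //.
    by rewrite lebesgue_measure_set1 mule0.
  - by move=> k; apply: measurable_funM; [exact: mslice|exact: mslice].
  - apply: measurable_funM; last exact: mslice.
    apply: measurable_fun_ifT; [|exact: measurable_cst|exact: measurable_cst].
    by apply: measurable_fun_ltr; [exact: measurable_snd|exact: measurable_cst].
  - move=> x Nx; apply: cvgM; last exact: cvg_cst.
    have x0 : x.2 != 0 by apply/eqP => x0; apply: Nx; split.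
    have E : (if x.2 < 0 then dL else dR) = dM + a * (if 0 < front 1 (0, x) then 1 else 0) +
        b * (if 0 < front (-1) (0, x) then 1 else 0).
      rewrite fr1 fr2 /= oppr0; case: ltgtP x0 => // _ _;
        rewrite /a /b mulr0 mulr1; lra.
    by rewrite E; exact: limD.
  - have [B hB] := continuous_bounded_box M cphi.
    have cs : continuous (fun y => C * `|phi y|).
      by apply: continuousM3 => // y; apply: cvg_norm; exact: cphi.
    have ss : box_supported M (fun y => C * `|phi y|).
      by move=> y /sphi ->; rewrite normr0 mulr0.
    have [B' hB'] := continuous_bounded_box M cs.
    exact: (slice_integrable 0 (continuous_measurable3 cs) ss hB').
  - by move=> k x; rewrite normrM ler_wpM2r.
rewrite (_ : (fun k => _) = fun k => - \int[lebesgue2]_x (Dk k (0, x) * phi (0, x))) in L3; last first.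
  by apply/funext => k; exact: bal.
rewrite -(cvg_lim (@norm_hausdorff _ _) L3) (cvg_lim (@norm_hausdorff _ _) (cvgN L2)).
exact: addNr.
Qed.

End balance.
End rankine_hugoniot.

(** * From smooth test functions to partial derivatives with bounded support *)

Section test_functions.
Context {R : realType}.
Local Notation ST := (R * (R * R))%type.

Definition directional (W : normedModType R) (f : ST -> W) (i : axis) : ST -> W :=
  match i with At => dt f | A1 => dx1 f | A2 => dx2 f end.

Definition unit_vector (i : axis) : ST :=
  match i with At => (1, (0, 0)) | A1 => (0, (1, 0)) | A2 => (0, (0, 1)) end.

Lemma directionalE (W : normedModType R) (f : ST -> W) i :
  directional f i = 'D_(unit_vector i) f.
Proof. by case: i. Qed.

Lemma upd_unit_vector i (y : ST) h : upd i y (h + crd i y) = h *: unit_vector i + y.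
Proof.
case: y => t [a b]; case: i.
- by rewrite -[RHS]/(h * 1 + t, (h * 0 + a, h * 0 + b)) mulr1 mulr0 !add0r.
- by rewrite -[RHS]/(h * 0 + t, (h * 1 + a, h * 0 + b)) mulr1 mulr0 !add0r.
- by rewrite -[RHS]/(h * 0 + t, (h * 0 + a, h * 1 + b)) mulr1 mulr0 !add0r.
Qed.

Lemma bounded_box (K : set ST) : compact K -> exists M, K `<=` box M.
Proof.
move=> /compact_bounded[M [_ hM]]; exists (M + 1) => y Ky.
have h : `|y| <= M + 1 by apply: (hM (M + 1)) => //; rewrite ltrDl.
by move: h; rewrite !prod_normE !ge_max => /andP[h1 /andP[h2 h3]]; apply/boxP.
Qed.

(** A continuous linear [p] handles scalar tests and the two components of vector tests in one
    argument. *)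
Lemma test_projection (W : normedModType R) (p : W -> R) (f : ST -> W) :
  continuous p -> (forall u v, p (u - v) = p u - p v) -> (forall a u, p (a *: u) = a * p u) ->
  test_function f ->
  exists M, [/\ C1 (fun y => p (f y)) (fun i y => p (directional f i y)),
    box_supported M (fun y => p (f y)) &
    forall i, box_supported M (fun y => p (directional f i y))].
Proof.
move=> cp pB pZ [sf /bounded_box[M KM]]; exists M.
have p0 : p 0 = 0 by rewrite -(subrr 0) pB subrr.
have [df cD] := sf 1%N.
(* Vanishing on a whole neighbourhood is required, as it makes the derivatives vanish too. *)
have f0 y : ~ box M y -> \forall z \near y, f z = 0.
  move=> yM; have yK : (~` closure [set z | f z != 0]) y by move=> /KM.
  have oK : open (~` closure [set z | f z != 0]) by apply: closed_openC; exact: closed_closure.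
  apply: filterS (open_nbhs_nbhs (conj oK yK)) => z zK.
  by apply/eqP/negPn/negP => z0; apply: zK; exact: subset_closure.
split.
- split.
  + move=> y; apply: (@continuous_comp _ _ _ f p); last exact: cp.
    by apply: differentiable_continuous; exact: df.
  + move=> i y; rewrite directionalE; apply: (@continuous_comp _ _ _ ('D_(unit_vector i) f) p); last exact: cp.
    exact: cD.
  + move=> i y; rewrite directionalE.
    have dv : derivable f y (unit_vector i) by exact: diff_derivable.
    have cv : h^-1 *: (f (upd i y (h *: 1 + crd i y)) - f (upd i y (crd i y))) @[h --> 0^'] -->
        'D_(unit_vector i) f y.
      rewrite upd_crd (_ : (fun h => _) = fun h => h^-1 *: (f (h *: unit_vector i + y) - f y)); first exact: dv.
      by apply/funext => h; rewrite -upd_unit_vector /GRing.scale/= mulr1.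
    have cv' : h^-1 *: (p (f (upd i y (h *: 1 + crd i y))) - p (f (upd i y (crd i y)))) @[h --> 0^'] -->
        p ('D_(unit_vector i) f y).
      rewrite (_ : (fun h => _) = fun h => p (h^-1 *: (f (upd i y (h *: 1 + crd i y)) - f (upd i y (crd i y))))).
        exact: (cvg_comp _ _ cv (cp _)).
      by apply/funext => h; rewrite pZ pB.
    by split; [apply/cvg_ex; eexists; exact: cv'|exact: cvg_lim cv'].
- by move=> y /f0 h; rewrite (nbhs_singleton h).
- move=> i y /f0 h; rewrite directionalE.
  have -> : 'D_(unit_vector i) f y = 'D_(unit_vector i) (cst 0) y by exact: near_eq_derive.
  by rewrite derive_cst.
Qed.

Lemma test_scalar (f : ST -> R) : test_function f ->
  exists M, [/\ C1 f (directional f), box_supported M f &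
    forall i, box_supported M (directional f i)].
Proof. by apply: (@test_projection R idfun) => // y; exact: cvg_id. Qed.

Lemma test_components (f : ST -> R * R) : test_function f -> 
  (exists M, [/\ C1 (fun y => (f y).1) (fun i y => (directional f i y).1),
    box_supported M (fun y => (f y).1) &
    forall i, box_supported M (fun y => (directional f i y).1)]) /\
  (exists M, [/\ C1 (fun y => (f y).2) (fun i y => (directional f i y).2),
    box_supported M (fun y => (f y).2) &
    forall i, box_supported M (fun y => (directional f i y).2)]).
Proof.
move=> tf; split.
- by apply: (@test_projection _ fst) => // y; exact: cvg_fst.
- by apply: (@test_projection _ snd) => // y; exact: cvg_snd.
Qed.

End test_functions.

(** * The glued states solve the Riemann problem *)

Section riemann_solutions.
Context {R : realType}.
Local Notation ST := (R * (R * R))%type.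
Local Notation iH := (\1_halfspace : ST -> R).

Definition intgH (f : ST -> R) := intg (fun y => iH y * f y).

Lemma intgHD (f g : ST -> R) : intgH f -> intgH g -> intgH (fun y => f y + g y) /\
  \int[lebesgue3]_(y in halfspace) (f y + g y) =
  \int[lebesgue3]_(y in halfspace) f y + \int[lebesgue3]_(y in halfspace) g y.
Proof.
move=> fi gi.
have E : (fun y => iH y * (f y + g y)) =
    (fun y => iH y * f y + iH y * g y).
  by apply/funext => y; rewrite mulrDr.
split; first by rewrite /intgH E; exact: intgD.
by rewrite !Rintegral_halfspace E RintegralD.
Qed.

Lemma intgHZ (r : R) (f : ST -> R) : intgH f -> intgH (fun y => r * f y) /\
  \int[lebesgue3]_(y in halfspace) (r * f y) = r * \int[lebesgue3]_(y in halfspace) f y.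
Proof.
move=> fi.
have E : (fun y => iH y * (r * f y)) =
    (fun y => r * (iH y * f y)).
  by apply/funext => y; rewrite mulrCA.
split; first by rewrite /intgH E; exact: intgZ.
by rewrite !Rintegral_halfspace E RintegralZl.
Qed.

Lemma intgH_sector cR cL cM M (f : ST -> R) : continuous f -> box_supported M f ->
  intgH (fun y => sector cR cL cM y * f y).
Proof.
move=> cf sf; have [B hB] := continuous_bounded_box M cf.
apply: (@integrable_box _ _ M ((`|cR| + `|cL| + `|cM|) * B)).
- apply: measurable_funM; first exact: measurable_indic_halfspace.
  by apply: measurable_funM; [exact: measurable_sector|exact: continuous_measurable3].
- by move=> y /sf ->; rewrite !mulr0.
- move=> y /hB h; rewrite !normrM -[leRHS]mul1r.
  apply: ler_pM => //; first by rewrite indicE; case: (y \in _); rewrite ?normr1 ?normr0.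
  apply: ler_pM => //; rewrite /sector.
  have h1 := normr_ge0 cR; have h2 := normr_ge0 cL; have h3 := normr_ge0 cM.
  by case: ifPn => _; [|case: ifPn => _]; move: h1 h2 h3; clear; lra.
Qed.

Lemma intgH_cone (f : ST -> R) : intg f -> (forall y, ~ cone y -> f y = 0) ->
  intgH f /\ \int[lebesgue3]_(y in halfspace) f y = \int[lebesgue3]_(y in cone) f y.
Proof.
move=> fi f0.
have E : (fun y => iH y * f y) = f.
  apply/funext => y; have [cy|/f0 ->] := pselect (cone y); last by rewrite mulr0.
  rewrite indicE mem_set ?mul1r//; case: cy; rewrite /halfspace/= => h1 h2.
  by move: h1 h2; clear; lra.
split; first by rewrite /intgH E.
rewrite Rintegral_halfspace E Rintegral_mkcond [RHS]Rintegral_mkcond.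
apply: eq_Rintegral => y _; rewrite !patchE in_setT; case: ifPn => // /negP h.
by rewrite f0// => cy; apply: h; rewrite inE.
Qed.

Section glued_state.
Variable w : index -> @field R.
Hypothesis exw : forall k, exact_field (index_cell k) (w k).
Local Notation W := (glued w).

Definition left_state : ST := (2^-1, (0, 1)).
Definition right_state : ST := (2^-1, (0, -1)).

Definition glued_state (y : ST) : ST :=
  if y.1 < y.2.2 then right_state
  else if y.2.2 < - y.1 then left_state else (1, (fv1 W y, fv2 W y)).

(** A view for case analysis: it fixes the state, the four glued components and all [sector] values
    at once, after which each integrand identity is elementary algebra. *)
Variant region_spec (y : ST) : ST -> R -> R -> R -> R -> Prop :=
| RegionRight of (forall a b c, sector a b c y = a) : region_spec y right_state 0 0 0 0
| RegionLeft of (forall a b c, sector a b c y = b) : region_spec y left_state 0 0 0 0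
| RegionCone of (forall a b c, sector a b c y = c) & fa W y = fv1 W y ^+ 2 - 4^-1 &
    fb W y = fv1 W y * fv2 W y & fv2 W y ^+ 2 = 2^-1 - fv1 W y ^+ 2 :
    region_spec y (1, (fv1 W y, fv2 W y)) (fv1 W y) (fv2 W y) (fa W y) (fb W y).

Lemma regionP y : halfspace y ->
  region_spec y (glued_state y) (fv1 W y) (fv2 W y) (fa W y) (fb W y).
Proof.
move=> yH; have y0 : 0 <= y.1 by []; rewrite /glued_state.
case: ifPn => h1.
  have nc : ~ cone y by case; move: y0 h1; clear; lra.
  have [-> -> -> ->] := glued_out w nc; apply: RegionRight => a b c.
  by rewrite /sector h1.
case: ifPn => h2.
  have nc : ~ cone y by case; move: y0 h2; clear; lra.
  have [-> -> -> ->] := glued_out w nc; apply: RegionLeft => a b c.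
  by rewrite /sector (negbTE h1) h2.
have cy : cone y by split; move: h1 h2; clear; lra.
have [ea eb] := glued_stress exw cy; have sp := glued_speed exw cy.
apply: RegionCone => // [a b c|]; first by rewrite /sector (negbTE h1) (negbTE h2).
by rewrite -sp addrC addKr.
Qed.

Lemma glued_state_measurable : measurable_fun [set: ST] glued_state.
Proof.
have [mR mL] := @measurable_fronts R.
apply: measurable_fun_ifT => //; apply: measurable_fun_ifT => //.
apply: measurable_fun_pair => //; apply: measurable_fun_pair.
- exact: glued_measurable1.
- exact: glued_measurable2.
Qed.

Lemma glued_state_Linfty : Linfty_loc glued_state.
Proof.
split.
- by apply: measurable_funS glued_state_measurable.
- apply: aeW => y _; rewrite /glued_state.
  by case: ifP => _; [|case: ifP => _]; rewrite /= ?invr_gt0.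
- move=> K _ _; exists 1; apply: aeW => y _; rewrite !prod_normE /glued_state.
  have [b1 b2 _ _] := glued_bounds exw y.
  have h2 : `|2^-1 : R| <= 1 by rewrite ger0_norm ?invr_ge0// invf_le1// ler1n.
  case: ifP => _; [|case: ifP => _]; rewrite /= !ge_max.
  + by rewrite h2 normr0 normrN normr1 ler01 lexx.
  + by rewrite h2 normr0 normr1 ler01 lexx.
  + by rewrite b1 b2 normr1 lexx.
Qed.

Local Notation U0 := (riemann_data left_state right_state).

Section test.
Variables (M : R) (psi : ST -> R) (d : axis -> ST -> R).
Hypotheses (Cpsi : C1 psi d) (spsi : box_supported M psi)
  (sd : forall i, box_supported M (d i)).

Let cd i : continuous (d i). Proof. by have [_ + _] := Cpsi; exact. Qed.

Definition mass_part (y : ST) := fv1 W y * d A1 y + fv2 W y * d A2 y.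
Definition momentum1_part (y : ST) := fv1 W y * d At y + fa W y * d A1 y + fb W y * d A2 y.
Definition momentum2_part (y : ST) := fv2 W y * d At y + fb W y * d A1 y - fa W y * d A2 y.

Lemma cone_parts : [/\ intgH mass_part /\ \int[lebesgue3]_(y in halfspace) mass_part y = 0,
  intgH momentum1_part /\ \int[lebesgue3]_(y in halfspace) momentum1_part y = 0 &
  intgH momentum2_part /\ \int[lebesgue3]_(y in halfspace) momentum2_part y = 0].
Proof.
have iw := glued_intg exw cd sd.
have i1 i : intg (fun y => fv1 W y * d i y) by have [] := iw i.
have i2 i : intg (fun y => fv2 W y * d i y) by have [] := iw i.
have ia i : intg (fun y => fa W y * d i y) by have [] := iw i.
have ib i : intg (fun y => fb W y * d i y) by have [] := iw i.
have [w0 w1 w2] := glued_weak exw Cpsi sd.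
have out y : ~ cone y -> [/\ mass_part y = 0, momentum1_part y = 0 & momentum2_part y = 0].
  move=> /(@glued_out _ w)[e1 e2 e3 e4].
  by rewrite /mass_part /momentum1_part /momentum2_part e1 e2 e3 e4 !mul0r !addr0 subr0.
split.
- have [||-> ->] := @intgH_cone mass_part _ _; rewrite ?w0//; first exact: intgD.
  by move=> y /out[].
- have [||-> ->] := @intgH_cone momentum1_part _ _; rewrite ?w1//; last by move=> y /out[].
  by apply: intgD => //; exact: intgD.
- have [||-> ->] := @intgH_cone momentum2_part _ _; rewrite ?w2//; last by move=> y /out[].
  by apply: intgB => //; exact: intgD.
Qed.

Lemma sector_part (dR dL dM fR fL fM : R) :
  intgH (fun y => sector dR dL dM y * d At y + sector fR fL fM y * d A2 y).
Proof.
have [] := @intgHD (fun y => sector dR dL dM y * d At y) (fun y => sector fR fL fM y * d A2 y) => //.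
- exact: intgH_sector.
- exact: intgH_sector.
Qed.

(** The sector values do not depend on x1, so the integral of the x1-derivative vanishes line by
    line. *)
Lemma normal_flux_part (cO cM : R) : intgH (fun y => sector cO cO cM y * d A1 y) /\
  \int[lebesgue3]_(y in halfspace) (sector cO cO cM y * d A1 y) = 0.
Proof.
split; first exact: intgH_sector.
rewrite Rintegral_halfspace.
(* Scaling by [C] brings the coefficient below 1 in absolute value; the summand 1 keeps [C]
   positive. *)
pose C := `|cO| + `|cM| + 1.
have C0 : 0 < C by rewrite ltr_wpDl// addr_ge0.
pose c y := C^-1 * (iH y * sector cO cO cM y).
have E : (fun y => iH y * (sector cO cO cM y * d A1 y)) =
    (fun y => c y * (C * d A1 y)).
  by apply/funext => y; rewrite /c mulrACA mulVf ?gt_eqF// mul1r mulrA.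
rewrite E; have [cpsi _ dpsi] := Cpsi.
apply: (@coefficient_space_derivative0 _ A1 c (fun y => C * psi y) _ M); first by [].
- apply: measurable_funM => //; apply: measurable_funM; last exact: measurable_sector.
  exact: measurable_indic_halfspace.
- move=> y; rewrite /c normrM normfV (gtr0_norm C0) ler_pdivrMl// mulr1 normrM.
  have h1 := normr_ge0 cO; have h3 := normr_ge0 cM.
  have h2 : `|sector cO cO cM y| <= C.
    by rewrite /sector /C; case: ifPn => _; [|case: ifPn => _]; lra.
  apply: le_trans h2; rewrite ler_piMl// indicE.
  by case: (y \in _); rewrite ?normr1 ?normr0.
- by move=> y s; rewrite /c !indicE.
- by apply: continuousM3 => // y; exact: cvg_cst.
- by move=> y /spsi ->; rewrite mulr0.
- by move=> y /sd ->; rewrite mulr0.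
- have hc : pderive A1 (fun _ : ST => C) (fun=> 0) by move=> y; exact: is_derive_cst.
  have := pderiveM hc (dpsi A1); congr pderive.
  by apply/funext => y; rewrite mul0r add0r.
Qed.

End test.

(** Density 1/2, 1/2, 1 and flux -1/2, 1/2, 0 on the right, on the left and in the cone; the
    velocity in the cone adds only the part [mass_part], which integrates to zero. *)
Lemma glued_state_mass : weak_mass U0 glued_state.
Proof.
move=> psi tpsi.
have rh1 : 2^-1 - 1 = - 2^-1 - 0 :> R by field.
have rh2 : 2^-1 - 1 = - (2^-1 - 0) :> R by field.
have [M [Cpsi spsi sd]] := test_scalar tpsi; set d := directional psi in Cpsi sd.
have [[i1 e1] _ _] := cone_parts Cpsi sd.
have s1 := @sector_part M psi d Cpsi sd (2^-1) (2^-1) 1 (- 2^-1) (2^-1) 0.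
have [_ es] := intgHD s1 i1.
apply: (etrans _ (sector_balance Cpsi spsi sd rh1 rh2)); congr (_ + _).
  rewrite -[RHS]addr0 -[X in _ = _ + X]e1 -es; apply: eq_Rintegral => y /set_mem yH.
  rewrite /mass_part /dot /grad /d.
  by case: (regionP yH) => [S|S|S _ _ _]; rewrite !S /left_state /right_state /directional /=; ring.
by apply: eq_Rintegral => x _; rewrite /riemann_data; case: ifP.
Qed.

(** Energy density 1/2, 1/2, 5/4 and flux -3/4, 3/4, 0. In the cone the true energy flux is 9/4 v,
    so its integral is 9/4 times that of [mass_part]. *)
Lemma glued_state_energy : weak_energy U0 glued_state.
Proof.
move=> psi tpsi.
have rh1 : 2^-1 - 5 / 4 = - (3 / 4) - 0 :> R by field.
have rh2 : 2^-1 - 5 / 4 = - (3 / 4 - 0) :> R by field.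
have [M [Cpsi spsi sd]] := test_scalar tpsi; set d := directional psi in Cpsi sd.
have [[i1 e1] _ _] := cone_parts Cpsi sd.
have [i2 e2] := intgHZ (9 / 4) i1.
have s1 := @sector_part M psi d Cpsi sd (2^-1) (2^-1) (5 / 4) (- (3 / 4)) (3 / 4) 0.
have [_ es] := intgHD s1 i2.
apply: (etrans _ (sector_balance Cpsi spsi sd rh1 rh2)); congr (_ + _).
  rewrite -[RHS]addr0 -[X in _ = _ + X](mulr0 (9 / 4)) -[X in _ = _ + _ * X]e1 -e2 -es.
  apply: eq_Rintegral => y /set_mem yH.
  rewrite /mass_part /energy /pressure /pressure_potential /dot /grad /d.
  case: (regionP yH) => [S|S|S _ _ sp]; rewrite !S /left_state /right_state /directional.
  - by rewrite [LHS]/= [RHS]/=; field.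
  - by rewrite [LHS]/= [RHS]/=; field.
  - move: sp; move: (fv1 W y) (fv2 W y) => v1 v2 sp /=.
    have sp' : v2 * v2 = 2^-1 - v1 * v1 by rewrite -!expr2.
    by rewrite sp'; field.
apply: eq_Rintegral => x _; rewrite /riemann_data /energy /pressure_potential /dot.
by congr (_ * _); case: ifP => _ /=; field.
Qed.

(** Outside the cone the stress is diagonal, with entries p = 1/4 along x1 and 1/2 + 1/4 = 3/4 along
    x2. Inside it is v (x) v + I = u + 5/4 I, where u goes into the two glued parts. *)
Lemma momentum_integrand (phi : ST -> R * R) y : halfspace y ->
  let d1 i y := (directional phi i y).1 in let d2 i y := (directional phi i y).2 in
  (glued_state y).1 * dot (glued_state y).2 (dt phi y)
    + (glued_state y).1 * tensor_contract (glued_state y).2 phi y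
    + pressure (glued_state y).1 * div phi y =
  sector (- 2^-1) (2^-1) 0 y * d2 At y + sector (3 / 4) (3 / 4) (5 / 4) y * d2 A2 y
    + sector (4^-1) (4^-1) (5 / 4) y * d1 A1 y + momentum1_part d1 y + momentum2_part d2 y.
Proof.
move=> yH d1 d2.
rewrite /momentum1_part /momentum2_part /pressure /dot /tensor_contract /div /d1 /d2 /directional.
move: (dt phi y) (dx1 phi y) (dx2 phi y) => [p0 q0] [p1 q1] [p2 q2].
case: (regionP yH) => [S|S|S -> -> sp]; rewrite !S /left_state /right_state.
- by rewrite [LHS]/= [RHS]/=; field.
- by rewrite [LHS]/= [RHS]/=; field.
- move: sp; move: (fv1 W y) (fv2 W y) => v1 v2 sp /=; apply/eqP; rewrite -subr_eq0; apply/eqP.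
  transitivity ((v2 ^+ 2 - (2^-1 - v1 ^+ 2)) * q2); first by field.
  by rewrite sp subrr mul0r.
Qed.

Lemma glued_state_momentum : weak_momentum U0 glued_state.
Proof.
move=> phi tphi.
have rh1 : - 2^-1 - 0 = 3 / 4 - 5 / 4 :> R by field.
have rh2 : 2^-1 - 0 = - (3 / 4 - 5 / 4) :> R by field.
have [[M [C1_1 sphi1 sd1]] [N [C1_2 sphi2 sd2]]] := test_components tphi.
set d1 := (fun i y => (directional phi i y).1) in C1_1 sd1.
set d2 := (fun i y => (directional phi i y).2) in C1_2 sd2.
have [_ [i1 e1] _] := cone_parts C1_1 sd1.
have [_ _ [i2 e2]] := cone_parts C1_2 sd2.
have [j1 f1] := normal_flux_part C1_1 sphi1 sd1 (4^-1) (5 / 4).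
have s1 := @sector_part N _ d2 C1_2 sd2 (- 2^-1) (2^-1) 0 (3 / 4) (3 / 4) (5 / 4).
have [k1 g1] := intgHD s1 j1; have [k2 g2] := intgHD k1 i1; have [_ g3] := intgHD k2 i2.
apply: (etrans _ (sector_balance C1_2 sphi2 sd2 rh1 rh2)); congr (_ + _).
  rewrite -[RHS]addr0 -[RHS]addr0 -[RHS]addr0 -[X in _ = _ + X]e2 -[X in _ = _ + X + _]e1.
  rewrite -[X in _ = _ + X + _ + _]f1 -g1 -g2 -g3.
  by apply: eq_Rintegral => y /set_mem; exact: momentum_integrand.
apply: eq_Rintegral => x _; rewrite /riemann_data /dot.
by case: ifP => _ /=; field.
Qed.

Lemma glued_state_solution : energy_conserving_weak_solution U0 glued_state.
Proof.
split; last exact: glued_state_energy.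
by split; [exact: glued_state_Linfty|exact: glued_state_mass|exact: glued_state_momentum].
Qed.

End glued_state.
End riemann_solutions.

(** * Infinitely many distinct solutions *)

Section distinct_solutions.
Context {R : realType}.
Local Notation ST := (R * (R * R))%type.

Lemma glued_state_cone (w : index -> @field R) y : cone y ->
  glued_state w y = (1, (fv1 (glued w) y, fv2 (glued w) y)).
Proof.
move=> [h1 h2]; rewrite /glued_state; case: ifPn => [h|_].
  by exfalso; move: h h1; clear; lra.
by case: ifPn => // h; exfalso; move: h h2; clear; lra.
Qed.

(* The cell (j.+1, l, k) lies in t > 0, where ae_class compares states. *)
Lemma glued_state_pairing (w w' : index -> @field R) (j l : nat) (k : int) g :
  (forall i, exact_field (index_cell i) (w i)) ->
  (forall i, exact_field (index_cell i) (w' i)) -> continuous_pair_fun g ->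
  ae_eq lebesgue3 open_halfspace (glued_state w) (glued_state w') ->
  pairing g (w (j.+1, l, k)) = pairing g (w' (j.+1, l, k)).
Proof.
move=> ew ew' [cg1 cg2] aeq; set i := (j.+1, l, k).
have mint (v : index -> @field R) : (forall i, exact_field (index_cell i) (v i)) ->
    measurable_fun [set: ST] (fun y => (g.1 y * fv1 (v i) y + g.2 y * fv2 (v i) y)%:E).
  move=> /(_ i)[m1 m2 _ _ _]; apply/measurable_EFinP; apply: measurable_funD.
  - by apply: measurable_funM => //; exact: continuous_measurable3.
  - by apply: measurable_funM => //; exact: continuous_measurable3.
rewrite /pairing /Rintegral; congr fine.
apply: (@ae_eq_integral _ _ _ lebesgue3 setT _ _ measurableT (mint _ ew) (mint _ ew')).
apply: filterS aeq => y H _.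
have [iy|niy] := pselect (index_cell i y); last first.
  have [_ _ /(_ y niy)[-> -> _ _] _ _] := ew i.
  by have [_ _ /(_ y niy)[-> -> _ _] _ _] := ew' i.
have cy := index_cell_cone iy.
have y0 : open_halfspace y.
  case: iy => /andP[h _] _ _; case: cy => _ h'.
  have p : 0 < j.+1%:R :> R by rewrite ltr0n.
  by move: h h' p; rewrite /open_halfspace /=; clear; lra.
have := H y0; rewrite !glued_state_cone//.
have [-> -> _ _] := glued_in w iy; have [-> -> _ _] := glued_in w' iy.
by case=> -> ->.
Qed.

Lemma infinitely_many_states : exists u : nat -> ST -> ST,
  (forall n, energy_conserving_weak_solution (riemann_data left_state right_state) (u n)) /\
  (forall m n, ae_eq lebesgue3 open_halfspace (u m) (u n) -> m = n).
Proof.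
have ex (k : index) : exists t : ((ST -> R) * (ST -> R)) * (@field R * @field R),
    [/\ continuous_pair_fun t.1, exact_field (index_cell k) t.2.1,
      exact_field (index_cell k) t.2.2 & pairing t.1 t.2.1 != pairing t.1 t.2.2].
  by have [g [wA [wB H]]] := two_exact_fields (k.1.1%:R : R) k.1.2%:R k.2%:~R; exists (g, (wA, wB)).
have [t tP] := choice ex.
(* For different numbers the exceptional cells differ, so in the cell of either one the two states
   use different fields. *)
pose w (n : nat) (k : index) := if k == (n.+1, 0%N, 0) then (t k).2.2 else (t k).2.1.
have ew n k : exact_field (index_cell k) (w n k).
  by have [_ e1 e2 _] := tP k; rewrite /w; case: ifP.
exists (fun n => glued_state (w n)); split; first by move=> n; exact: glued_state_solution.
move=> m n H; apply/eqP/negPn/negP => mn.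
have [cg _ _ /negP] := tP (m.+1, 0%N, 0); apply; apply/eqP.
have := glued_state_pairing m 0 0 (ew m) (ew n) cg H.
by rewrite /w eqxx !xpair_eqE eqSS (negbTE mn).
Qed.

End distinct_solutions.

Theorem theorem1p3 (R : realType) :
  exists (rho_minus rho_plus : R) (v_minus v_plus : R * R),
    [/\ 0 < rho_minus, 0 < rho_plus &
        infinite_set
          (ae_class @`
             [set U | energy_conserving_weak_solution
                        (riemann_data (rho_minus, v_minus) (rho_plus, v_plus))
                        U])].
Proof.
have h0 : 0 < 2^-1 :> R by rewrite invr_gt0.
exists (2^-1), (2^-1), (0, 1), (0, -1); split => //.
have [u [solu inju]] := @infinitely_many_states R => fin.
apply: infinite_nat.
(* A finite set of classes would have a finite preimage under the injective map from n to the class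
   of [u n], yet this preimage consists of all naturals. *)
suff -> : [set: nat] = (fun n => ae_class (u n)) @^-1`
    (ae_class @` [set U | energy_conserving_weak_solution (riemann_data left_state right_state) U]).
  apply: finite_preimage fin => m n _ _ eqmn; apply: inju.
  have : ae_class (u n) (u n) by apply: aeW => y _.
  by rewrite -eqmn.
by apply/seteqP; split => n // _; exists (u n) => //; exact: solu.
Qed.
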